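(* Let $\mathscr{A}$ be a linear homogeneous constant-coefficient partial differential operator of constant rank on $\mathbb{R}^n$, from $\mathbb{V}$-valued to $\mathbb{W}$-valued fields, with spanning wave cone, $\mathrm{span}\,\Lambda_{\mathscr{A}}=\mathbb{V}$. Let $\mathscr{B}$ be a linear homogeneous constant-coefficient operator of order $l\ge1$ from $\mathbb{U}$-valued to $\mathbb{V}$-valued fields with $\ker\mathscr{A}(\xi)=\mathrm{im}\,\mathscr{B}(\xi)$ for all $\xi\ne0$. Let $\nu^0$ be a probability measure on $\mathbb{V}$ with finite first moment, $\nu^\infty$ a probability measure on $\mathbb{S}_{\mathbb{V}}$ and $t>0$, and suppose that $F(\overline\nu^0)\le\int_{\mathbb{V}}F\,d\nu^0$ for all $\mathscr{A}$-quasiconvex $F\in\mathbb{H}$. Set $z=\overline\nu^0+t\overline\nu^\infty$. Then $(\nu^0,t\nu^\infty)\in Y_z$ if and only if $$G_F(\overline\nu^\infty)\le\int_{\mathbb{S}_{\mathbb{V}}}F^\infty\,d\nu^\infty\qquad\text{for all }\mathscr{A}\text{-quasiconvex }F\in\mathbb{H},$$ where $G_F(y)=\sup\{F'(z_0)\cdot y:\ z_0\in\mathbb{V},\ F\text{ is differentiable at }z_0\}$.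
   Context: $\mathbb{U},\mathbb{V},\mathbb{W}$ are finite-dimensional real inner product spaces; $\mathbb{S}_{\mathbb{V}}$ is the unit sphere of $\mathbb{V}$. $\mathscr{A}=\sum_{|\alpha|=k}A_\alpha\partial^\alpha$, $A_\alpha\colon\mathbb{V}\to\mathbb{W}$ linear, with symbol $\mathscr{A}(\xi)=\sum_{|\alpha|=k}\xi^\alpha A_\alpha$, and similarly $\mathscr{B}=\sum_{|\beta|=l}B_\beta\partial^\beta$, $\mathscr{B}(\xi)=\sum_{|\beta|=l}\xi^\beta B_\beta$. Constant rank: $\mathrm{rank}\,\mathscr{A}(\xi)$ is independent of $\xi\neq0$. Wave cone: $\Lambda_{\mathscr{A}}=\bigcup_{|\xi|=1}\ker\mathscr{A}(\xi)$. $\mathbb{H}$ is the space of continuous $\Phi\colon\mathbb{V}\to\mathbb{R}$ of linear growth ($|\Phi(z)|\le c(1+|z|)$) for which $\Phi^\infty(z)=\lim_{t\to\infty}\Phi(tz)/t$ exists locally uniformly in $z\in\mathbb{V}$. A continuous $f\colon\mathbb{V}\to\mathbb{R}$ is $\mathscr{A}$-quasiconvex if $f(z)\le\int_{(0,1)^n}f(z+w(x))\,dx$ for all $z\in\mathbb{V}$ and all $(0,1)^n$-periodic $w\in C^\infty(\mathbb{R}^n,\mathbb{V})$ with $\int_{(0,1)^n}w\,dx=0$ and $\mathscr{A}w=0$. (With spanning wave cone, $\mathscr{A}$-quasiconvex functions of linear growth are Lipschitz.) Barycentres: $\overline\nu^0=\int_{\mathbb{V}}y\,d\nu^0(y)$,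 $\overline\nu^\infty=\int_{\mathbb{S}_{\mathbb{V}}}y\,d\nu^\infty(y)$. For $z\in\mathbb{V}$, $Y_z$ is the set of pairs $(\mu^0,\mu^\infty)$, with $\mu^0$ a probability measure on $\mathbb{V}$ and $\mu^\infty$ a positive Radon measure on $\mathbb{S}_{\mathbb{V}}$, for which there is a sequence $u_j\in C^\infty_c((0,1)^n,\mathbb{U})$ with $\|u_j\|_{W^{l-1,1}}\to0$ and $\int_{(0,1)^n}\Phi(z+\mathscr{B}u_j(x))\,dx\to\int_{\mathbb{V}}\Phi\,d\mu^0+\int_{\mathbb{S}_{\mathbb{V}}}\Phi^\infty\,d\mu^\infty$ for all $\Phi\in\mathbb{H}$. *)

(* Defs.v *)
From HB Require Import structures.
From mathcomp Require Import all_boot all_order all_algebra sesquilinear.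
From mathcomp Require Import all_classical all_reals all_analysis.
Set Implicit Arguments.
Unset Strict Implicit.
Unset Printing Implicit Defensive.
Import Order.TTheory GRing.Theory Num.Theory.
Import numFieldNormedType.Exports.
Local Open Scope classical_set_scope.
Local Open Scope ring_scope.

(* Finite-dimensional real inner product spaces: [vectType]s whose norm (hence
   whose topology) comes from a positive definite symmetric bilinear form. *)
HB.mixin Record NormedVector_isInner (R : realType) V
    of NormedModule R V & Vector R V := {
  inner : {dot V for (idfun : R -> R)};
  inner_normE : forall x : V, `|x| = Num.sqrt (inner x x)
}.

#[short(type="innerProductType")]
HB.structure Definition InnerProduct (R : realType) :=
  {V of NormedModule R V & Vector R V & NormedVector_isInner R V}.

Section domain.
Context {R : realType}.

Local Notation RB := (measurableTypeR R).

Definition cons_tuple n (x : RB * n.-tuple RB) : n.+1.-tuple RB :=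
  [tuple of x.1 :: x.2].

Lemma measurable_cons_tuple n : measurable_fun setT (@cons_tuple n).
Proof. exact: measurable_cons. Qed.

HB.instance Definition _ n :=
  isMeasurableFun.Build _ _ _ _ (@cons_tuple n) (@measurable_cons_tuple n).

(* Lebesgue measure on the unit cube of R^n, as the n-fold product of the
   one-dimensional Lebesgue measure on [0, 1]; the boundary is negligible. *)
Fixpoint cube_measure n : probability (n.-tuple RB) R :=
  match n with
  | 0 => \d_[tuple]
  | m.+1 => distribution (uniform_prob (@ltr01 R) \x cube_measure m)%E
                         (@cons_tuple m)
  end.

Definition cube_integral n (f : 'rV[R]_n -> R) : R :=
  \int[cube_measure n]_p f (\row_i (tnth p i : R)).

Definition cube (n : nat) : set 'rV[R]_n := [set x | forall i, 0 < x 0 i < 1].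

End domain.

Section differential_operators.
Context {R : realType}.

Definition partial n (V : normedModType R) (i : 'I_n) (f : 'rV[R]_n -> V) :
  'rV[R]_n -> V := fun x => 'D_(delta_mx 0 i) f x.

Definition smooth n (V : normedModType R) (f : 'rV[R]_n -> V) : Prop :=
  forall s : seq 'I_n, let g := foldr (fun i => partial i) f s in
  continuous g /\ forall i x, derivable g x (delta_mx 0 i).

(* Multi-indices with all entries at most k; every multi-index of order at
   most k is one of them. *)
Definition multi_index (n k : nat) := {ffun 'I_n -> 'I_k.+1}.

Definition mi_order n k (a : multi_index n k) : nat := (\sum_(i < n) a i)%N.

Definition partial_mi n k (V : normedModType R) (a : multi_index n k)
    (f : 'rV[R]_n -> V) : 'rV[R]_n -> V :=
  foldr (fun i => iter (a i) (partial i)) f (enum 'I_n).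

Definition monomial n k (a : multi_index n k) (xi : 'rV[R]_n) : R :=
  \prod_(i < n) xi 0 i ^+ a i.

(* The homogeneous operator of order k on R^n with coefficients [A a]; only
   the coefficients with |a| = k matter. *)
Definition diff_op (n k : nat) (V W : innerProductType R) :=
  multi_index n k -> 'Hom(V, W).

Section operator.
Context {n k : nat} {V W : innerProductType R}.
Variable A : diff_op n k V W.

Definition op_apply (f : 'rV[R]_n -> V) (x : 'rV[R]_n) : W :=
  \sum_(a : multi_index n k | mi_order a == k) A a (partial_mi a f x).

Definition symbol (xi : 'rV[R]_n) : 'Hom(V, W) :=
  \sum_(a : multi_index n k | mi_order a == k) monomial a xi *: A a.

Definition constant_rank : Prop := forall xi eta : 'rV[R]_n,
  xi != 0 -> eta != 0 -> \dim (limg (symbol xi)) = \dim (limg (symbol eta)).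

(* The norm |xi| is the Euclidean one; the library norm on ['rV_n] is not. *)
Definition wave_cone : set V :=
  [set v | exists2 xi : 'rV[R]_n,
     Num.sqrt (\sum_(i < n) xi 0 i ^+ 2) = 1 & v \in lker (symbol xi)].

End operator.

Definition linear_span (V : vectType R) (L : set V) : set V :=
  [set v | exists2 s : seq V, {in s, forall x, L x} & v \in << s >>%VS].

(* The W^{m,1} norm on the unit cube. *)
Definition sobolev_norm n (m : nat) (U : normedModType R)
    (u : 'rV[R]_n -> U) : R :=
  \sum_(a : multi_index n m | (mi_order a <= m)%N)
    cube_integral (fun x => `|partial_mi a u x|).

End differential_operators.

Section young_measures.
Context {R : realType}.

Definition borel (V : innerProductType R) := g_sigma_algebraType (@open V).

Definition unit_sphere (V : innerProductType R) : set V := [set y | `|y| = 1].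
Arguments unit_sphere : clear implicits.

(* Integral of a vector-valued function, taken componentwise in a basis. *)
Definition vector_integral d (T : measurableType d) (V : innerProductType R)
    (mu : {measure set T -> \bar R}) (D : set T) (f : T -> V) : V :=
  \sum_(i < \dim {:V})
    (\int[mu]_(x in D) coord (vbasis {:V}) i (f x)) *: (vbasis {:V})`_i.

(* [rec_fun F z] is F^oo(z), a junk value if the limit does not exist. *)
Definition rec_fun (V : innerProductType R) (F : V -> R) (z : V) : R :=
  lim (F (t *: z) / t @[t --> +oo]).

Definition H_space (V : innerProductType R) (F : V -> R) : Prop :=
  [/\ continuous F,
      exists c : R, forall z, `|F z| <= c * (1 + `|z|) &
      forall z : V, exists2 N : set V, nbhs z N &
        {uniform N, (fun (t : R) (y : V) => F (t *: y) / t) @ +oo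
                      --> rec_fun F}].

Definition periodic n (V : innerProductType R) (w : 'rV[R]_n -> V) : Prop :=
  forall (i : 'I_n) x, w (x + delta_mx 0 i) = w x.

Definition quasiconvex n k (V W : innerProductType R) (A : diff_op n k V W)
    (f : V -> R) : Prop :=
  continuous f /\
  forall (z : V) (w : 'rV[R]_n -> V), smooth w -> periodic w ->
    vector_integral (cube_measure n) setT (fun p => w (\row_i (tnth p i : R))) = 0 ->
    (forall x, op_apply A w x = 0) ->
    f z <= cube_integral (fun x => f (z + w x)).

Definition test_field n (U : innerProductType R) (u : 'rV[R]_n -> U) : Prop :=
  smooth u /\ closure [set x | u x != 0] `<=` @cube R n.

(* The pairs of Y_z. A positive Radon measure on the unit sphere (a compact
   metric space) is encoded as a finite Borel measure on V that vanishes off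
   the sphere. The finite first moment makes the integrals of the functions
   of linear growth finite, which the convergence presupposes. *)
Definition young_pair n l (U V : innerProductType R) (B : diff_op n l U V)
    (z : V) (mu0 : probability (borel V) R)
    (muoo : {finite_measure set (borel V) -> \bar R}) : Prop :=
  [/\ (\int[mu0]_y `|y : V|%:E < +oo)%E,
      muoo (~` unit_sphere V) = 0%E &
      exists u : nat -> 'rV[R]_n -> U,
      [/\ forall j, test_field (u j),
          sobolev_norm l.-1 (u j) @[j --> \oo] --> (0 : R) &
          forall Phi : V -> R, H_space Phi ->
            cube_integral (fun x => Phi (z + op_apply B (u j) x))
              @[j --> \oo] -->
            \int[mu0]_y Phi y
              + \int[muoo]_(y in unit_sphere V) rec_fun Phi y]].

(* G_F(y), in the extended reals. *)
Definition dir_sup (V : innerProductType R) (F : V -> R) (y : V) : \bar R :=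
  ereal_sup [set ('d F z0 y)%:E | z0 in [set z0 : V | differentiable F z0]].

End young_measures.

Arguments unit_sphere {R} V.

(* Main.v *)
Require Import Defs.
From HB Require Import structures.
From mathcomp Require Import all_boot all_order all_algebra.
From mathcomp Require Import all_classical all_reals all_analysis.
From mathcomp Require Import measurable_realfun.
From mathcomp Require Import ring lra.

(** Write L(F) for the integral of F with respect to the pair (nu0, t nuoo).

    Necessity.  Fields B u are limits of trigonometric polynomials whose
    coefficients lie in the images of the symbol of B, that is, in the kernels of
    the symbol of A; hence a quasiconvex F satisfies F z <= int F (z + B u), and
    F z <= L(F) if the pair is generated by fields z + B u_j.  Applying this to
    y |-> F (s y + a) and letting s tend to 0 linearizes F at the point a and
    leaves F'(a) baroo <= int F^oo dnuoo.

    Sufficiency.  Averaging a Lipschitz quasiconvex F over small parallelotopes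
    makes it differentiable everywhere without changing F^oo, so that the bounds on
    directional derivatives integrate to F z <= F bar0 + t int F^oo dnuoo <= L(F).
    If Phi is Lipschitz and at bounded distance from a homogeneous function, then
    so is its envelope inf_u int Phi (z + B u), which is quasiconvex; hence this
    infimum is at most L(Phi).  Two fields can be combined on the cells of a grid,
    so the vectors (int Phi_i (z + B u))_i form a midpoint convex set, and
    separation yields one field u whose integrals are close to L(Phi_i) for
    finitely many i.  Rescaling u on a fine grid preserves the integrals and makes
    its W^{l-1,1} norm small; a countable family of such Phi, dense in the weighted
    uniform norm, concludes. *)

Set Implicit Arguments.
Unset Strict Implicit.
Unset Printing Implicit Defensive.
Import Order.TTheory GRing.Theory Num.Theory.
Import numFieldNormedType.Exports.
Local Open Scope classical_set_scope.
Local Open Scope ring_scope.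

(** * Integration over the unit cube *)

(** The condition on [dir_sup] speaks only of quasiconvex members of [H_space], and only of points
    of differentiability. Both restrictions shape the sufficiency proof. An envelope must possess a
    recession function before the condition can be applied to it; this is the reason for the class
    [tame], where the envelope of the homogeneous part is again homogeneous and stays at bounded
    distance from the envelope of the function. Moreover a Lipschitz envelope may fail to be
    differentiable along the whole segment from [bar0] to [z]. Its averages along the basis vectors
    have a derivative everywhere, with a uniform quadratic remainder, and they stay quasiconvex with
    the same recession function, so the condition applies to them with an unchanged right-hand side.
    Exactness serves twice: images inside kernels make [B u] admissible in the definition of
    quasiconvexity, and kernels inside images give potentials to periodic fields, so that an
    inequality tested on fields [B u] implies quasiconvexity. At frequency 0 it is replaced by zero
    means and by [1 <= l]. An envelope without lower bound needs no estimate, since some field then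
    lies below any prescribed value. *)

Section cube_integral.
Context {R : realType}.
Local Notation RB := (measurableTypeR R).

Definition rowt n (p : n.-tuple RB) : 'rV[R]_n := \row_i (tnth p i : R).

Lemma rat_approx (x d : R) : 0 < d -> exists q : rat, `|x - ratr q| < d.
Proof.
move=> d0; have : x - d < x + d by lra.
move=> /rat_in_itvoo[q]; rewrite in_itv/= => /andP[q1 q2].
by exists q; rewrite ltr_norml; apply/andP; split; lra.
Qed.

(** Measurability on tuples is a product notion, while continuity refers to the topology of row
    vectors. The bridge is that an open set is a countable union of balls with rational centres and
    radii [1 / (m + 1)], and a ball of the sup norm is a finite intersection of conditions on single
    coordinates. *)
Lemma measurable_rowt_open n (O : set 'rV[R]_n) : open O ->
  measurable ((@rowt n) @^-1` O).
Proof.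
move=> oO.
pose I := ({ffun 'I_n -> rat} * nat)%type.
pose ctr (q : I) : 'rV[R]_n := \row_i ratr (q.1 i).
pose P : set I := [set q | ball (ctr q) (q.2.+1%:R^-1) `<=` O].
have -> : (@rowt n) @^-1` O =
    \bigcup_(q in P) (@rowt n) @^-1` (ball (ctr q) (q.2.+1%:R^-1)).
  apply/seteqP; split => [p /= Op|p [q Pq] /=]; last exact: Pq.
  have [e e0 eO] : exists2 e : R, 0 < e & ball (rowt p) e `<=` O.
    have /nbhs_ballP[e /= e0 eO] : nbhs (rowt p) O by exact: open_nbhs_nbhs.
    by exists e.
  have [k ke] : exists k : nat, k.+1%:R^-1 < e / 2.
    have /ltr_add_invr[k] : 0 < e / 2 by rewrite divr_gt0.
    by rewrite add0r; exists k.
  have kp : 0 < k.+1%:R^-1 :> R by rewrite invr_gt0.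
  have q_ i : {q : rat | `|rowt p 0 i - ratr q| < k.+1%:R^-1}.
    by apply: cid; exact: rat_approx.
  pose q : I := ([ffun i => sval (q_ i)], k).
  exists q; last first.
    split => // i j; rewrite ord1 /ball /= mxE ffunE distrC.
    by case: (q_ j).
  move=> x [_ bx]; apply: eO; split => // i j; rewrite ord1.
  have := bx 0 j; rewrite /ball /= mxE ffunE => h.
  case: (q_ j) h => /= r hr h.
  have := ler_normD (rowt p 0 j - ratr r) (ratr r - x 0 j).
  rewrite subrKA => /le_lt_trans; apply.
  by rewrite (lt_trans (ltrD hr h))// (splitr e) ltrD.
rewrite bigcup_mkcond; apply: countable_bigcupT_measurable => [|q]; first exact: countableP.
case: ifP => // _.
rewrite [X in measurable X](_ : _ =
  \bigcap_(i in [set: 'I_n]) (fun p : n.-tuple RB => tnth p i) @^-1`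
     (ball (ctr q 0 i : R) (q.2.+1%:R^-1))); last first.
  apply/seteqP; split => [p [_ bp] i _|p bp] /=.
    by have := bp ord0 i; rewrite [rowt p _ _]mxE.
  by split => // i j; rewrite ord1 [rowt p _ _]mxE; exact: bp.
have [i0|i0] := pselect ([set: 'I_n] !=set0); last first.
  rewrite (_ : [set: 'I_n] = set0) ?bigcap_set0; first exact: measurableT.
  by apply: contrapT => /eqP/set0P.
apply: fin_bigcap_measurable => // i _.
rewrite -[X in measurable X]setTI; apply: measurable_tnth => //.
apply: open_measurable; exact: ball_open.
Qed.

Lemma measurable_rowt_continuous n (f : 'rV[R]_n -> R) : continuous f ->
  measurable_fun setT (f \o @rowt n).
Proof.
move=> /continuousP cf; apply: (measurability _ (RGenOpens.measurableE R)).
move=> _ [_ [a [b ->] <-]]; rewrite setTI comp_preimage.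
apply: measurable_rowt_open; exact/cf/interval_open.
Qed.


Definition tcube n : set (n.-tuple RB) := [set p | forall i, 0 < (tnth p i : R) < 1].

Lemma measurable_tcube n : measurable (@tcube n).
Proof.
rewrite [X in measurable X](_ : _ =
  \bigcap_(i in [set: 'I_n]) (fun p : n.-tuple RB => tnth p i) @^-1`
     `]0, 1[%classic); last first.
  apply/seteqP; split => p h i; first by move=> _; rewrite /= in_itv/=.
  by have := h i I; rewrite /= in_itv.
have [i0|i0] := pselect ([set: 'I_n] !=set0); last first.
  rewrite (_ : [set: 'I_n] = set0) ?bigcap_set0; first exact: measurableT.
  by apply: contrapT => /eqP/set0P.
apply: fin_bigcap_measurable => // i _.
by rewrite -[X in measurable X]setTI; apply: measurable_tnth.
Qed.

Lemma cube_measure_tcube n : cube_measure n (@tcube n) = 1%E :> \bar R.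
Proof.
elim: n => [|n ih] /=.
  by rewrite diracE mem_set// => -[].
rewrite /distribution /pushforward /=.
rewrite (_ : _ @^-1` _ = `]0, 1[%classic `*` @tcube n); last first.
  apply/seteqP; split => -[x p] /=.
    move=> h; split => [|i]; first by have := h ord0; rewrite tnth0 in_itv.
    by have := h (lift ord0 i); rewrite tnthS.
  move=> [h1 h2] i; have [j ->|->] := unliftP ord0 i; last by rewrite tnth0; rewrite in_itv in h1.
  by rewrite tnthS.
rewrite product_measure1E ?measurable_tcube//; last exact: measurable_tcube.
rewrite [X in (_ * X)%E]ih mule1.
change (\int[lebesgue_measure]_(x in `]0%R, 1%R[%classic) (uniform_pdf (0:R) 1 x)%:E = 1)%E.
rewrite integral_uniform_pdf.
rewrite (eq_integral (fun=> 1%E)); last first.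
  move=> x; rewrite inE => -[]; rewrite /= !in_itv/= => _ h.
  by rewrite /uniform_pdf h subr0 invr1.
rewrite integral_cst ?mul1e; last exact: measurableI.
rewrite (_ : _ `&` _ = `]0, 1[%classic).
  have := @lebesgue_measure_itv R `]0, 1[%R; rewrite /= lte_fin ltr01 oppr0 adde0 => <-. by [].
by apply/seteqP; split => x /=; rewrite !in_itv/=; [case|move=> /andP[a b]; rewrite a b !ltW].
Qed.

Lemma cube_measure_notcube n : cube_measure n (~` @tcube n) = 0%E :> \bar R.
Proof.
rewrite probability_setC; last exact: measurable_tcube.
by rewrite [X in (_ - X)%E]cube_measure_tcube subee.
Qed.

Lemma continuous_cube_bounded n (f : 'rV[R]_n -> R) : continuous f ->
  exists M : R, 0 < M /\ forall x : 'rV[R]_n, (forall i, 0 <= x 0 i <= 1) -> `|f x| <= M.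
Proof.
move=> cf.
have cK : compact [set v : 'rV[R]_n | forall i, v ord0 i \in `[(0 : R), 1]].
  apply: (@rV_compact _  _ (fun=> `[(0 : R), 1]%classic)).
  by move=> _; apply: segment_compact.
have /compact_bounded[M [_ hM]] := continuous_compact (continuous_subspaceT cf) cK.
exists (`|M| + 1); split; first by rewrite ltr_wpDl.
move=> x hx; apply: (hM (`|M| + 1)); first by rewrite ltr_pwDr// ler_norm.
by exists x => // i; rewrite in_itv/= hx.
Qed.

Lemma integrable_rowt n (f : 'rV[R]_n -> R) : continuous f ->
  (cube_measure n).-integrable setT (EFin \o (f \o @rowt n)).
Proof.
move=> cf; have mf := measurable_rowt_continuous cf.
apply/(@negligible_integrable _ _ _ _ _ (~` @tcube n)) => //.
- by apply: measurableC; exact: measurable_tcube.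
- exact/measurable_EFinP.
- exact: cube_measure_notcube.
rewrite setDE setCK setTI.
have [M [M0 hM]] := continuous_cube_bounded cf.
apply: measurable_bounded_integrable.
- exact: measurable_tcube.
- by rewrite [X in (X < _)%E]cube_measure_tcube ltry.
- exact: measurable_funTS.
exists M; split; first exact: num_real.
move=> N MN p hp /=; rewrite (le_trans _ (ltW MN))// hM// => i.
by rewrite mxE; have /andP[/ltW-> /ltW->] := hp i.
Qed.

(** The faces of the cube are negligible, so comparisons and limits of integrands are required on
    the open cube only. *)
Lemma cube_integralE n (f : 'rV[R]_n -> R) : continuous f ->
  cube_integral f = \int[cube_measure n]_(p in @tcube n) f (rowt p).
Proof.
move=> cf; rewrite /cube_integral /Rintegral.
rewrite (@negligible_integral _ _ _ _ _ (~` @tcube n)) //.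
- by rewrite setDE setCK setTI.
- by apply: measurableC; exact: measurable_tcube.
- exact: integrable_rowt.
- exact: cube_measure_notcube.
Qed.

Lemma cube_integralD n (f g : 'rV[R]_n -> R) : continuous f -> continuous g ->
  cube_integral (fun x => f x + g x) = cube_integral f + cube_integral g.
Proof.
by move=> cf cg; apply: RintegralD => //; exact: integrable_rowt.
Qed.

Lemma cube_integralZ n (c : R) (f : 'rV[R]_n -> R) : continuous f ->
  cube_integral (fun x => c * f x) = c * cube_integral f.
Proof.
by move=> cf; apply: RintegralZl => //; exact: integrable_rowt.
Qed.

Lemma cube_integral_cst n (c : R) : cube_integral (fun _ : 'rV[R]_n => c) = c.
Proof.
rewrite /cube_integral Rintegral_cst//.
by rewrite [X in fine X]probability_setT /= mulr1.
Qed.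

Lemma integrable_rowt_tcube n (f : 'rV[R]_n -> R) : continuous f ->
  (cube_measure n).-integrable (@tcube n) (EFin \o (f \o @rowt n)).
Proof.
move=> cf; apply: integrableS (integrable_rowt cf) => //; exact: measurable_tcube.
Qed.

Lemma rowt_cube n (p : n.-tuple RB) : tcube p -> cube (rowt p).
Proof. by move=> h i; rewrite mxE; exact: h. Qed.

Lemma le_cube_integral n (f g : 'rV[R]_n -> R) : continuous f -> continuous g ->
  (forall x, cube x -> f x <= g x) -> cube_integral f <= cube_integral g.
Proof.
move=> cf cg fg; rewrite !cube_integralE//; apply: le_Rintegral.
- exact: measurable_tcube.
- exact: integrable_rowt_tcube.
- exact: integrable_rowt_tcube.
- by move=> p /rowt_cube/fg.
Qed.

Lemma eq_cube_integral n (f g : 'rV[R]_n -> R) : continuous f -> continuous g ->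
  (forall x, cube x -> f x = g x) -> cube_integral f = cube_integral g.
Proof.
move=> cf cg fg; apply/eqP; rewrite eq_le; apply/andP; split;
  by apply: le_cube_integral => // x /fg->.
Qed.

End cube_integral.

Section unit_integral.
Context {R : realType}.
Local Notation RB := (measurableTypeR R).

Definition unit_integral (g : R -> R) : R :=
  \int[uniform_prob (@ltr01 R)]_(x in [set: RB]) g x.

Lemma unit_integralE (g : R -> R) : continuous g ->
  unit_integral g = \int[lebesgue_measure]_(x in `[0, 1]) g x.
Proof.
move=> cg.
have mg : measurable_fun [set: RB] (EFin \o g).
  by apply/measurable_EFinP; exact: continuous_measurable_fun.
rewrite /unit_integral /Rintegral; congr fine.
rewrite integralE [RHS]integralE.
rewrite !integral_uniform//; [|exact: measurable_funeneg|exact: measurable_funepos].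
by rewrite subr0 invr1 !mul1e.
Qed.

(** The margin around [[0, 1]] provides two-sided derivatives at the endpoints, hence the one-sided
    continuity that the fundamental theorem asks for. *)
Lemma unit_integral_FTC (g P : R -> R) : continuous g ->
  (forall x : R, -1 < x < 2 -> is_derive x 1 P (g x)) -> unit_integral g = P 1 - P 0.
Proof.
move=> cg dP.
have cP (x : R) : -1 < x < 2 -> P @ x --> P x.
  move=> hx.
  apply/differentiable_continuous; rewrite -derivable1_diffP.
  by have [] := dP x hx.
rewrite unit_integralE// /Rintegral (@continuous_FTC2 _ g P 0 1)//.
- exact: continuous_subspaceT.
- split.
  + by move=> x; rewrite in_itv/= => /andP[? ?]; have [] // := dP x; lra.
  + by apply/cvg_at_right_filter/cP; lra.
  + by apply/cvg_at_left_filter/cP; lra.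
- move=> x; rewrite in_itv/= => /andP[? ?].
  by rewrite derive1E; have [//|_ ->//] := dP x; lra.
Qed.

Lemma primitive_exists (g : R -> R) (a b : R) : continuous g ->
  exists P : R -> R, forall x : R, a < x < b -> is_derive x 1 P (g x).
Proof.
move=> cg; exists (fun x => \int[lebesgue_measure]_(t in `[a, x]) g t).
move=> x /andP[ax xb].
have ig : lebesgue_measure.-integrable `[a, b] (EFin \o g).
  apply: continuous_compact_integrable; first exact: segment_compact.
  exact: continuous_subspaceT.
have [dP PE] := @continuous_FTC1 R g (BLeft a) x b xb ig ax (cg x).
exact: (DeriveDef dP (etrans (esym (derive1E _ _)) PE)).
Qed.

Lemma integrable_unit (g : R -> R) : continuous g ->
  (uniform_prob (@ltr01 R)).-integrable [set: RB] (EFin \o g).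
Proof.
move=> cg.
have mg : measurable_fun [set: RB] (EFin \o g).
  by apply/measurable_EFinP; exact: continuous_measurable_fun.
apply/integrableP; split => //.
rewrite integral_uniform//; last exact: measurableT_comp.
rewrite subr0 invr1 mul1e.
have /integrableP[_ //] : lebesgue_measure.-integrable `[0, 1] (EFin \o g).
apply: continuous_compact_integrable; first exact: segment_compact.
exact: continuous_subspaceT.
Qed.

End unit_integral.

(** * Fubini's theorem: splitting off the first coordinate *)

Section fubini.
Context {R : realType}.
Local Notation RB := (measurableTypeR R).

Definition consv n (x : R) (y : 'rV[R]_n) : 'rV[R]_n.+1 :=
  \row_i (if unlift ord0 i is Some j then y 0 j else x).

Lemma consv0 n x (y : 'rV[R]_n) : consv x y 0 ord0 = x.
Proof. by rewrite mxE unlift_none. Qed.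

Lemma consvS n x (y : 'rV[R]_n) j : consv x y 0 (lift ord0 j) = y 0 j.
Proof. by rewrite mxE liftK. Qed.

Lemma rowt_cons n (x : RB) (p : n.-tuple RB) :
  rowt (Defs.cons_tuple (x, p)) = consv x (rowt p).
Proof.
apply/rowP => i; have [j ->|->] := unliftP ord0 i.
  by rewrite consvS !mxE tnthS.
by rewrite consv0 mxE tnth0.
Qed.

Lemma consv_norm n (x x' : R) (y y' : 'rV[R]_n) (e : R) : 0 < e ->
  ball x e x' -> ball y e y' -> ball (consv x y) e (consv x' y').
Proof.
move=> e0 xx' [_ yy']; split => // i j; rewrite ord1.
by have [k ->|->] := unliftP ord0 j; [rewrite !consvS|rewrite !consv0].
Qed.

Lemma consv_continuousl n (y : 'rV[R]_n) : continuous (fun x => consv x y).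
Proof.
move=> x A /nbhs_ballP[e /= e0 eA]; apply/nbhs_ballP; exists e => //= x' xx'.
by apply: eA; apply: consv_norm => //; exact: ballxx.
Qed.

Lemma consv_continuousr n (x : R) : continuous (@consv n x).
Proof.
move=> y A /nbhs_ballP[e /= e0 eA]; apply/nbhs_ballP; exists e => //= y' yy'.
by apply: eA; apply: consv_norm => //; exact: ballxx.
Qed.

Lemma consv_continuous (T : topologicalType) n (f : T -> R) (g : T -> 'rV[R]_n) :
  continuous f -> continuous g -> continuous (fun t => consv (f t) (g t)).
Proof.
move=> cf cg t A; rewrite /nbhs /= => /(@nbhs_ballP R 'rV[R]_n.+1 (consv (f t) (g t))).
move=> [e /= e0 eA].
have H1 : \forall t' \near t, ball (g t) e (g t') by apply: cg; exact: nbhsx_ballx.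
have H2 : \forall t' \near t, ball (f t) e (f t') by apply: cf; exact: nbhsx_ballx.
near=> t'; apply: eA.
apply: consv_norm => //; near: t'.
Unshelve. all: by end_near. Qed.

Variables (n : nat) (f : 'rV[R]_n.+1 -> R).
Hypothesis cf : continuous f.

Let g (q : RB * n.-tuple RB) : \bar R := (f (consv q.1 (rowt q.2)))%:E.

Let gE : g = (EFin \o (f \o @rowt R n.+1)) \o @Defs.cons_tuple R n.
Proof.
by apply/funext => -[x p]; rewrite /g /= rowt_cons.
Qed.

Let mg : measurable_fun setT g.
Proof.
rewrite gE; apply: measurableT_comp; last exact: measurable_cons_tuple.
apply/measurable_EFinP; exact: measurable_rowt_continuous.
Qed.

Let ig : (uniform_prob (@ltr01 R) \x cube_measure n)%E.-integrable setT g.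
Proof.
have /integrableP[m1 fin] := integrable_rowt cf.
apply/integrableP; split => //; rewrite gE.
move: fin; rewrite ge0_integral_pushforward//.
exact: measurableT_comp.
Qed.

Lemma cube_integral_pair : cube_integral f =
  fine (\int[(uniform_prob (@ltr01 R) \x cube_measure n)%E]_q g q).
Proof.
rewrite /cube_integral /Rintegral /=; congr fine.
rewrite integral_distribution.
- by rewrite gE.
- by apply/measurable_EFinP; exact: measurable_rowt_continuous.
- by move: ig; rewrite gE.
Qed.

Lemma cube_integralS : cube_integral f =
  unit_integral (fun x => cube_integral (fun y => f (consv x y))).
Proof.
rewrite cube_integral_pair -integral12_prod_meas1//; congr fine.
apply: eq_integral => x _; rewrite /fubini_F /=.
rewrite fineK//; apply: integrable_fin_num => //.
apply: (@integrable_rowt _ _ (fun y => f (consv x y))) => y.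
apply: continuous_comp; [exact: consv_continuousr|exact: cf].
Qed.

Lemma cube_integralSr : cube_integral f =
  cube_integral (fun y => unit_integral (fun x => f (consv x y))).
Proof.
rewrite cube_integral_pair -integral21_prod_meas1//; congr fine.
apply: eq_integral => p _; rewrite /fubini_G /=.
rewrite fineK//; apply: integrable_fin_num => //.
apply: (@integrable_unit _ (fun x => f (consv x (rowt p)))) => y.
apply: continuous_comp; [exact: consv_continuousl|exact: cf].
Qed.

End fubini.

Section derivative_estimates.
Context {R : realType} {V W : normedModType R}.

(** Multiplying the difference quotient by [h] removes the division and the exception [h = 0].
    Derivatives can then be carried from one function to another as soon as their increments along a
    line agree. *)
Lemma is_derive_epsP (f : V -> W) (x v : V) (d : W) :
  is_derive x v f d <->
  forall e : R, 0 < e -> exists2 r : R, 0 < r &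
    forall h : R, `|h| < r -> `|f (h *: v + x) - f x - h *: d| <= e * `|h|.
Proof.
have quot (h : R) (d' : W) : h != 0 ->
    `|h^-1 *: (f (h *: v + x) - f x) - d'| * `|h| = `|f (h *: v + x) - f x - h *: d'|.
  move=> h0; rewrite mulrC -normrZ scalerBr scalerA divff// scale1r.
  by [].
split=> [[df <-] e e0|H].
  have /cvgrPdist_lt/(_ e e0)[r /= r0 rP] := df.
  exists r => // h hr; have [->|h0] := eqVneq h 0.
    by rewrite !scale0r add0r subrr subr0 !normr0 mulr0.
  rewrite -quot// ler_wpM2r// distrC ltW//.
  by apply: rP => //=; rewrite /= sub0r normrN.
have cv : h^-1 *: ((f \o shift x) (h *: v) - f x) @[h --> 0^'] --> d.
  apply/cvgrPdist_le => e e0; have [r r0 rP] := H e e0.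
  exists r => //= h /=; rewrite sub0r normrN => hr h0.
  have h1 : 0 < `|h| by rewrite normr_gt0.
  by rewrite distrC -(ler_pM2r h1) quot// rP.
apply: DeriveDef; first by apply/cvg_ex; exists d.
by apply: cvg_lim => //; exact: norm_hausdorff.
Qed.

End derivative_estimates.

Section affine_derivative.
Context {R : realType} {V W : normedModType R}.

Lemma is_derive_affine (f : V -> W) (c : R) (b x v : V) (d : W) :
  is_derive (c *: x + b) v f d ->
  is_derive x v (fun y => f (c *: y + b)) (c *: d).
Proof.
move=> /is_derive_epsP H; apply/is_derive_epsP => e e0.
have [r r0 rP] := H (e / (`|c| + 1)) (divr_gt0 e0 (ltr_wpDl (normr_ge0 c) ltr01)).
have c0 : 0 < `|c| + 1 by rewrite ltr_wpDl.
exists (r / (`|c| + 1)); first exact: divr_gt0.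
move=> h; rewrite ltr_pdivlMr// => hr.
have hc : `|h * c| < r.
  by rewrite normrM (le_lt_trans _ hr)// ler_wpM2l// lerDl.
have -> : f (c *: (h *: v + x) + b) - f (c *: x + b) - h *: (c *: d) =
    f ((h * c) *: v + (c *: x + b)) - f (c *: x + b) - (h * c) *: d.
  by rewrite scalerDr !scalerA [c * h]mulrC addrA.
rewrite (le_trans (rP _ hc))// normrM.
rewrite (_ : _ * _ = e * `|h| * (`|c| / (`|c| + 1))); last by ring.
rewrite ler_piMr// ?mulr_ge0 ?(ltW e0)//.
by rewrite ler_pdivrMr// mul1r lerDl.
Qed.

End affine_derivative.

Lemma affine_continuous (R : realType) (V : normedModType R) (c : R) (b : V) :
  continuous (fun y : V => c *: y + b).
Proof. by move=> y; apply: cvgD; [exact: scaler_continuous|exact: cvg_cst]. Qed.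

Lemma cvg_sum (R : realType) (V : normedModType R) (I T : Type) (F : set_system T)
    (r : seq I) (P : pred I) (f : I -> T -> V) (a : I -> V) : Filter F ->
  (forall i, P i -> f i x @[x --> F] --> a i) ->
  \sum_(i <- r | P i) f i x @[x --> F] --> \sum_(i <- r | P i) a i.
Proof. by move=> FF; apply: cvg_big => //; exact: add_continuous. Qed.

Lemma continuous_sum (R : realType) (V : normedModType R) (I : Type) (T : topologicalType)
    (r : seq I) (P : pred I) (f : I -> T -> V) :
  (forall i, P i -> continuous (f i)) ->
  continuous (fun x => \sum_(i <- r | P i) f i x).
Proof. by move=> cf x; apply: cvg_sum => i Pi; exact: cf. Qed.

Lemma comp_continuous (S T U : topologicalType) (f : S -> T) (g : T -> U) :
  continuous f -> continuous g -> continuous (fun x => g (f x)).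
Proof. by move=> cf cg x; apply: continuous_comp; [exact: cf|exact: cg]. Qed.

Lemma mulc_continuous (R : realType) (T : topologicalType) (c : R) (f : T -> R) :
  continuous f -> continuous (fun x => c * f x).
Proof. by move=> cf x; apply: cvgM; [exact: cvg_cst|exact: cf]. Qed.

Lemma addf_continuous (R : realType) (T : topologicalType) (V : normedModType R) (f g : T -> V) :
  continuous f -> continuous g -> continuous (fun x => f x + g x).
Proof. by move=> cf cg x; apply: cvgD; [exact: cf|exact: cg]. Qed.

Lemma mulf_continuous (R : realType) (T : topologicalType) (f g : T -> R) :
  continuous f -> continuous g -> continuous (fun x => f x * g x).
Proof. by move=> cf cg x; apply: cvgM; [exact: cf|exact: cg]. Qed.

(** * Grids of cells, integrals of derivatives, dominated convergence *)

Section unit_facts.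
Context {R : realType}.

Lemma partialE n (V : normedModType R) (i : 'I_n) (f : 'rV[R]_n -> V) x d :
  is_derive x (delta_mx 0 i) f d -> partial i f x = d.
Proof. by move=> df; rewrite /partial derive_val. Qed.

Definition cell n N (m : {ffun 'I_n -> 'I_N}) (y : 'rV[R]_n) : 'rV[R]_n :=
  \row_i (N%:R^-1 * ((m i)%:R + y 0 i)).

Lemma cellE n N (m : {ffun 'I_n -> 'I_N}) (y : 'rV[R]_n) :
  cell m y = N%:R^-1 *: y + cell m 0.
Proof. by apply/rowP => i; rewrite !mxE addr0 mulrDr addrC. Qed.

Lemma cell_continuous n N (m : {ffun 'I_n -> 'I_N}) : continuous (cell m).
Proof.
rewrite (_ : cell m = fun y => N%:R^-1 *: y + cell m 0); last first.
  by apply/funext => y; exact: cellE.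
exact: affine_continuous.
Qed.

(** With [P] a primitive of [g], the sum [Q] of the functions [P ((x + j) / N)] is a primitive of
    the right-hand integrand, and [Q 1 - Q 0] telescopes to [P 1 - P 0]. The interval from -1 to 3
    contains all [(x + j) / N] with [-1 < x < 2] and [j < N]. *)
Lemma unit_integral_tile N (g : R -> R) : (0 < N)%N -> continuous g ->
  unit_integral g =
  unit_integral (fun x => N%:R^-1 * \sum_(j < N) g (N%:R^-1 *: x + N%:R^-1 * j%:R)).
Proof.
move=> N0 cg; have N0' : 0 < N%:R :> R by rewrite ltr0n.
have N1 : 1 <= N%:R :> R by rewrite ler1n.
have [P dP] := primitive_exists (-1) 3 cg.
have cj (j : nat) : continuous (fun x : R => g (N%:R^-1 *: x + N%:R^-1 * j%:R)).
  move=> x; apply: continuous_comp; last exact: cg.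
  by exact: affine_continuous.
have dP' (x : R) : -1 < x < 2 -> is_derive x 1 P (g x).
  by move=> /andP[x1 x2]; apply: dP; lra.
rewrite (unit_integral_FTC cg dP').
pose Q (x : R) := \sum_(j < N) P (N%:R^-1 *: x + N%:R^-1 * j%:R).
pose G (x : R) := N%:R^-1 * \sum_(j < N) g (N%:R^-1 *: x + N%:R^-1 * j%:R).
have cG : continuous G.
  move=> x; apply: cvgM; first exact: cvg_cst.
  by apply: cvg_sum => j _; exact: cj.
have dQ (x : R) : -1 < x < 2 -> is_derive x 1 Q (G x).
  move=> /andP[x1 x2]; rewrite /G mulr_sumr.
  have -> : Q = \sum_(j < N) (fun x : R => P (N%:R^-1 *: x + N%:R^-1 * j%:R)).
    by apply/funext => y; rewrite fct_sumE.
  apply: is_derive_sum => j; apply: is_derive_affine; apply: dP.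
  rewrite -[N%:R^-1 *: x]/(N%:R^-1 * x) -mulrDr ltr_pdivlMl// ltr_pdivrMl//.
  have : j.+1%:R <= N%:R :> R by rewrite ler_nat.
  have : 0 <= j%:R :> R by rewrite ler0n.
  rewrite -natr1; lra.
rewrite (unit_integral_FTC cG dQ).
rewrite /Q -sumrB (eq_bigr (fun j : 'I_N => P (N%:R^-1 * j.+1%:R) - P (N%:R^-1 * j%:R))).
  rewrite -(big_mkord xpredT (fun j => P (N%:R^-1 * j.+1%:R) - P (N%:R^-1 * j%:R))).
  rewrite (telescope_sumr (fun j => P (N%:R^-1 * j%:R)))//.
  by rewrite mulVf ?mulr0// gt_eqF.
move=> j _; congr (P _ - P _); last by rewrite scaler0 add0r.
by rewrite -[N%:R^-1 *: 1]/(N%:R^-1 * 1) -mulrDr -natr1 addrC.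
Qed.

Lemma row0_eq (x y : 'rV[R]_0) : x = y.
Proof. by apply/rowP => -[]. Qed.

Definition ffun_cons n (T : Type) (q : T * {ffun 'I_n -> T}) : {ffun 'I_n.+1 -> T} :=
  [ffun i => if unlift ord0 i is Some k then q.2 k else q.1].

Lemma ffun_cons_bij n (T : Type) : bijective (@ffun_cons n T).
Proof.
exists (fun m : {ffun 'I_n.+1 -> T} => (m ord0, [ffun k => m (lift ord0 k)])).
  move=> [j m]; congr (_, _); first by rewrite ffunE unlift_none.
  by apply/ffunP => k; rewrite !ffunE liftK.
move=> m; apply/ffunP => i; rewrite ffunE /=.
by case: unliftP => [k ->|->]; rewrite ?ffunE.
Qed.

Lemma cell_cons n N (j : 'I_N) (m : {ffun 'I_n -> 'I_N}) x (y : 'rV[R]_n) :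
  cell (ffun_cons (j, m)) (consv x y) = consv (N%:R^-1 *: x + N%:R^-1 * j%:R) (cell m y).
Proof.
apply/rowP => i; rewrite !mxE ffunE /=.
by case: unliftP => [k _|_]; rewrite ?mxE// mulrDr addrC.
Qed.

Lemma cube_integral_sum n (I : Type) (r : seq I) (P : pred I) (f : I -> 'rV[R]_n -> R) :
  (forall i, continuous (f i)) ->
  cube_integral (fun x => \sum_(i <- r | P i) f i x) =
  \sum_(i <- r | P i) cube_integral (f i).
Proof.
move=> cf; elim: r => [|i r ih].
  rewrite big_nil (_ : (fun x => _) = fun=> 0) ?cube_integral_cst//.
  by apply/funext => x; rewrite big_nil.
rewrite big_cons; case: ifPn => Pi; last first.
  by rewrite -ih; congr cube_integral; apply/funext => x; rewrite big_cons (negbTE Pi).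
rewrite -ih -cube_integralD//; last by apply: continuous_sum.
by congr cube_integral; apply/funext => x; rewrite big_cons Pi.
Qed.

Lemma unit_integral_ext (g h : R -> R) : g =1 h -> unit_integral g = unit_integral h.
Proof. by move=> gh; congr unit_integral; apply/funext. Qed.

Lemma cube_integral_ext n (g h : 'rV[R]_n -> R) : g =1 h -> cube_integral g = cube_integral h.
Proof. by move=> gh; congr cube_integral; apply/funext. Qed.

(** Induction on the dimension: the first coordinate is split by [unit_integral_tile], with [h j]
    the integrand transported to the [j]-th slab, and the other coordinates by the induction
    hypothesis. *)
Lemma cube_integral_tile n N (f : 'rV[R]_n -> R) : (0 < N)%N -> continuous f ->
  cube_integral f =
  N%:R^-1 ^+ n * \sum_(m : {ffun 'I_n -> 'I_N}) cube_integral (fun y => f (cell m y)).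
Proof.
move=> N0; elim: n f => [|n ih] f cf.
  rewrite expr0 mul1r (eq_bigr (fun=> cube_integral f)).
    by rewrite sumr_const card_ffun !card_ord expn0 mulr1n.
  by move=> m _; apply: cube_integral_ext => y; rewrite (row0_eq (cell m y) y).
pose h (j : 'I_N) (z : 'rV[R]_n.+1) :=
  f (consv (N%:R^-1 *: z 0 ord0 + N%:R^-1 * j%:R) (\row_k z 0 (lift ord0 k))).
have hE j x y : h j (consv x y) = f (consv (N%:R^-1 *: x + N%:R^-1 * j%:R) y).
  by rewrite /h consv0; congr (f (consv _ _)); apply/rowP => k; rewrite mxE consvS.
have rest_continuous : continuous (fun z : 'rV[R]_n.+1 => \row_k z 0 (lift ord0 k) : 'rV[R]_n).
  move=> z A /nbhs_ballP[e /= e0 eA]; apply/nbhs_ballP; exists e => //= z' [_ zz'].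
  by apply: eA; split => // i k; rewrite !mxE.
have ch j : continuous (h j).
  pose F (z : 'rV[R]_n.+1) : 'rV[R]_n.+1 :=
    consv (N%:R^-1 *: z 0 ord0 + N%:R^-1 * j%:R) (\row_k z 0 (lift ord0 k)).
  apply: (@comp_continuous _ _ _ F f) => //.
  apply: consv_continuous; last exact: rest_continuous.
  apply: (@comp_continuous _ _ _ (fun z : 'rV[R]_n.+1 => z 0 ord0)
    (fun x => N%:R^-1 *: x + N%:R^-1 * j%:R)); first exact: coord_continuous.
  exact: affine_continuous.
have Eh j : cube_integral (h j) = N%:R^-1 ^+ n * \sum_(m : {ffun 'I_n -> 'I_N})
    cube_integral (fun y => f (cell (ffun_cons (j, m)) y)).
  rewrite cube_integralS//.
  transitivity (cube_integral (fun z : 'rV[R]_n.+1 => N%:R^-1 ^+ n *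
      \sum_(m : {ffun 'I_n -> 'I_N}) f (cell (ffun_cons (j, m)) z))); last first.
    rewrite cube_integralZ ?cube_integral_sum//.
      by move=> m; apply: comp_continuous => //; exact: cell_continuous.
    apply: continuous_sum => m _.
    by apply: comp_continuous => //; exact: cell_continuous.
  rewrite [RHS]cube_integralS; last first.
    apply: mulc_continuous; apply: continuous_sum => m _.
    by apply: comp_continuous => //; exact: cell_continuous.
  apply: unit_integral_ext => x.
  have cfx : continuous (fun y => f (consv (N%:R^-1 *: x + N%:R^-1 * j%:R) y)).
    by apply: comp_continuous => //; exact: consv_continuousr.
  rewrite (cube_integral_ext (hE j x)) ih//.
  have cfm (m : {ffun 'I_n -> 'I_N}) :
      continuous (fun y => f (cell (ffun_cons (j, m)) (consv x y))).
    apply: (@comp_continuous _ _ _ (consv x) (fun z => f (cell (ffun_cons (j, m)) z))).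
      exact: consv_continuousr.
    by apply: comp_continuous => //; exact: cell_continuous.
  rewrite cube_integralZ ?cube_integral_sum//; last exact: continuous_sum.
  by congr (_ * _); apply: eq_bigr => m _; apply: cube_integral_ext => y; rewrite cell_cons.
transitivity (N%:R^-1 * \sum_(j < N) cube_integral (h j)).
  rewrite -cube_integral_sum// -cube_integralZ; last exact: continuous_sum.
  rewrite cube_integralSr// [RHS]cube_integralSr; last first.
    by apply: mulc_continuous; exact: continuous_sum.
  apply: cube_integral_ext => y; rewrite (@unit_integral_tile N)//; last first.
    by apply: comp_continuous => //; exact: consv_continuousl.
  by apply: unit_integral_ext => x; congr (_ * _); apply: eq_bigr => j _; rewrite hE.
rewrite exprS -mulrA; congr (_ * _).
rewrite (eq_bigr _ (fun j _ => Eh j)) -mulr_sumr; congr (_ * _).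
rewrite pair_big/= (reindex (@ffun_cons n 'I_N)); last exact/onW_bij/ffun_cons_bij.
by apply: eq_bigr => -[j m].
Qed.

(** Integrated along direction [i], the derivative leaves the difference of [g] on two opposite
    faces, which vanishes. Only the first coordinate can be split off directly, hence the induction
    on the dimension for the other directions. *)
Lemma cube_integral_partial n (i : 'I_n) (g : 'rV[R]_n -> R) :
  (forall x, derivable g x (delta_mx 0 i)) -> continuous (partial i g) ->
  (forall x : 'rV[R]_n, x 0 i = 0 -> g (x + delta_mx 0 i) = g x) ->
  cube_integral (partial i g) = 0.
Proof.
elim: n i g => [[]//|n ih] i g dg cdg gE.
have [k ik|i0] := unliftP ord0 i.
  have line (x : R) y h : consv x (h *: delta_mx 0 k + y) = h *: delta_mx 0 i + consv x y.
    apply/rowP => j; rewrite !mxE; have [j' ->|->] := unliftP ord0 j.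
      by rewrite !mxE ik (inj_eq lift_inj).
    by rewrite ik (negbTE (neq_lift _ _)) mulr0 add0r.
  have dE x y : is_derive y (delta_mx 0 k) (fun y => g (consv x y)) (partial i g (consv x y)).
    apply/is_derive_epsP => e e0.
    have /is_derive_epsP/(_ e e0)[r r0 rP] := derivableP (dg (consv x y)).
    by exists r => // h hr; rewrite line rP.
  rewrite cube_integralS// (@unit_integral_ext _ (fun=> 0)).
    by rewrite /unit_integral Rintegral_cst ?mul0r.
  move=> x; rewrite -(ih k (fun y => g (consv x y))).
  - by apply: cube_integral_ext => y; rewrite (partialE (dE x y)).
  - by move=> y; have [] := dE x y.
  - rewrite (_ : partial _ _ = fun y => partial i g (consv x y)); last first.
      by apply/funext => y; rewrite (partialE (dE x y)).
    by apply: comp_continuous => //; exact: consv_continuousr.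
  - move=> y yk; rewrite -(gE (consv x y)); last by rewrite ik consvS.
    by have := line x y 1; rewrite !scale1r addrC => ->; rewrite addrC.
have line (x : R) y h : consv (h *: 1 + x) y = h *: delta_mx 0 i + consv x y.
  apply/rowP => j; rewrite !mxE; have [j' ->|->] := unliftP ord0 j.
    by rewrite i0 mulr0 add0r.
  by rewrite i0 eqxx.
have dE (x : R) y : is_derive x 1 (fun x => g (consv x y)) (partial i g (consv x y)).
  apply/is_derive_epsP => e e0.
  have /is_derive_epsP/(_ e e0)[r r0 rP] := derivableP (dg (consv x y)).
  by exists r => // h hr; rewrite line rP.
rewrite cube_integralSr// -(@cube_integral_cst _ n 0); apply: cube_integral_ext => y.
rewrite (@unit_integral_FTC _ _ (fun x => g (consv x y))).
- apply/eqP; rewrite subr_eq0 -(gE (consv 0 y)) ?i0 ?consv0//.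
  by have := line 0 y 1; rewrite addr0 !scale1r i0 addrC => ->.
- by apply: comp_continuous => //; exact: consv_continuousl.
Qed.

Lemma cube_integral_cvg n (f_ : nat -> 'rV[R]_n -> R) (f : 'rV[R]_n -> R) (M : R) :
  (forall j, continuous (f_ j)) -> continuous f ->
  (forall j x, cube x -> `|f_ j x| <= M) ->
  (forall x, cube x -> f_ ^~ x @ \oo --> f x) ->
  (fun j => cube_integral (f_ j)) @ \oo --> cube_integral f.
Proof.
move=> cf_ cf fM ff.
rewrite (_ : (fun j => _) =
  fun j => \int[cube_measure n]_(p in @tcube R n) (f_ j \o @rowt R n) p); last first.
  by apply/funext => j; rewrite cube_integralE.
rewrite cube_integralE//; apply: fine_cvg; rewrite fineK; last first.
  by apply: integrable_fin_num; [exact: measurable_tcube|exact: integrable_rowt_tcube].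
have [|||||_ _] := @dominated_convergence _ _ R (cube_measure n) (@tcube R n)
   (@measurable_tcube R n) (fun j => EFin \o (f_ j \o @rowt R n)) (EFin \o (f \o @rowt R n))
   (fun=> M%:E).
- move=> j; apply/measurable_EFinP/measurable_funTS; exact: measurable_rowt_continuous.
- apply/measurable_EFinP/measurable_funTS; exact: measurable_rowt_continuous.
- by apply: aeW => p /rowt_cube/ff h; apply: cvg_EFin => //; exact: nearW.
- by apply: finite_measure_integrable_cst; exact: measurable_tcube.
- by apply: aeW => p j /rowt_cube /(fM j); rewrite /= lee_fin.
- by [].
Qed.

End unit_facts.

(** * Finite-dimensional spaces and smooth functions *)

Section finite_dimension.
Context {R : realType}.
Implicit Types U V W : innerProductType R.

Definition co V (i : 'I_(\dim {:V})) (v : V) : R := coord (vbasis {:V}) i v.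

Definition bv V (i : 'I_(\dim {:V})) : V := (vbasis {:V})`_i.

Lemma coE V (v : V) : v = \sum_i co i v *: bv i.
Proof. by apply: coord_vbasis; rewrite memvf. Qed.

Lemma coD V i (u v : V) : co i (u + v) = co i u + co i v.
Proof. exact: linearD. Qed.

Lemma coZ V i c (v : V) : co i (c *: v) = c * co i v.
Proof. exact: linearZ. Qed.

Lemma co_lsum V j (I : Type) (r : seq I) (P : pred I) (f : I -> V) :
  co j (\sum_(i <- r | P i) f i) = \sum_(i <- r | P i) co j (f i).
Proof. exact: linear_sum. Qed.

Lemma co_bv V (i j : 'I_(\dim {:V})) : co j (bv i) = (i == j)%:R.
Proof. exact: coord_free (basis_free (vbasisP _)). Qed.

Lemma co_sum V (f : 'I_(\dim {:V}) -> R) j : co j (\sum_i f i *: bv i) = f j.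
Proof.
rewrite co_lsum (bigD1 j)//= big1 ?addr0 => [|i ij]; first by rewrite coZ co_bv eqxx mulr1.
by rewrite coZ co_bv (negbTE ij) mulr0.
Qed.

Definition of_row V (c : 'rV[R]_(\dim {:V})) : V := \sum_i c 0 i *: bv i.

Lemma of_row_continuous V : continuous (@of_row V).
Proof.
apply: continuous_sum => i _.
apply: (@comp_continuous _ _ _ (fun c : 'rV[R]_(\dim {:V}) => c 0 i) (fun k => k *: bv i)).
  exact: coord_continuous.
exact: scalel_continuous.
Qed.

Lemma of_rowZ V k c : of_row (k *: c) = k *: of_row c :> V.
Proof.
by rewrite /of_row scaler_sumr; apply: eq_bigr => i _; rewrite mxE scalerA.
Qed.

Lemma co_of_row V (c : 'rV[R]_(\dim {:V})) i : co i (of_row c : V) = c 0 i.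
Proof. by rewrite /of_row co_sum. Qed.

Lemma of_row_co V (v : V) : of_row (\row_i co i v) = v.
Proof. by rewrite [RHS]coE; apply: eq_bigr => i _; rewrite mxE. Qed.

Lemma norm_entry_le n (c : 'rV[R]_n) i : `|c 0 i| <= `|c|.
Proof.
rewrite [leRHS]/Num.norm /= mx_normrE; apply/bigmax_geP; right => /=.
by exists (0, i).
Qed.

(** Equivalence of norms: [of_row] is injective, so the norm of its values has a positive minimum on
    the compact sphere [|c| = 1]. Compactness and bounds on coordinates are transferred to [V]
    through it. *)
Lemma of_row_lower V : exists2 m : R, 0 < m &
  forall c : 'rV[R]_(\dim {:V}), m * `|c| <= `|of_row c : V|.
Proof.
(* The sphere is empty when [V] has dimension 0. *)
have [S0|S0] := pselect ([set c : 'rV[R]_(\dim {:V}) | `|c| = 1] !=set0); last first.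
  exists 1 => // c; rewrite mul1r; have [->|c0] := eqVneq c 0; first by rewrite normr0.
  exfalso; apply: S0; exists (`|c|^-1 *: c).
  by rewrite /= normrZ normfV normr_id mulVf// normr_eq0.
have cS : compact [set c : 'rV[R]_(\dim {:V}) | `|c| = 1].
  apply: bounded_closed_compact.
    by exists 1; split => // M M1 c /= ->; exact: ltW.
  rewrite (_ : mkset _ = (@Num.norm _ _) @^-1` [set 1])//.
  by apply: preimage_closed; [move=> c _; exact: norm_continuous|exact: closed_eq].
have cf : continuous (fun c : 'rV[R]_(\dim {:V}) => `|of_row c : V|).
  by apply: comp_continuous; [exact: of_row_continuous|exact: norm_continuous].
have [c0] := EVT_min_rV S0 cS (continuous_subspaceT cf).
rewrite inE /= => c01 hmin.
have m0 : 0 < `|of_row c0 : V|.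
  rewrite normr_gt0; apply/eqP => c00; have : c0 = 0.
    by apply/rowP => i; rewrite -(@co_of_row V) c00 mxE /co linear0.
  by move/eqP; rewrite -normr_eq0 c01 oner_eq0.
exists `|of_row c0 : V| => // c; have [->|cn0] := eqVneq c 0.
  by rewrite normr0 mulr0.
have /hmin : `|c|^-1 *: c \in [set c : 'rV[R]_(\dim {:V}) | `|c| = 1].
  by rewrite inE /= normrZ normfV normr_id mulVf// normr_eq0.
by rewrite of_rowZ normrZ normfV normr_id mulrC ler_pdivlMr ?normr_gt0.
Qed.

Lemma co_bound V : exists2 K : R, 0 < K & forall (v : V) i, `|co i v| <= K * `|v|.
Proof.
have [m m0 hm] := of_row_lower V.
exists m^-1; first by rewrite invr_gt0.
move=> v i; rewrite ler_pdivlMl// -{2}(of_row_co v) (le_trans _ (hm _))//.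
by rewrite ler_pM2l// (le_trans _ (norm_entry_le _ i))// mxE.
Qed.

Lemma hom_bound U V (f : 'Hom(U, V)) :
  exists2 K : R, 0 < K & forall u, `|f u| <= K * `|u|.
Proof.
have [K K0 hK] := co_bound U.
exists (1 + \sum_i K * `|f (bv i)|).
  by rewrite ltr_pwDl// sumr_ge0// => i _; rewrite mulr_ge0 ?(ltW K0).
move=> u; rewrite {1}(coE u) linear_sum (le_trans (ler_norm_sum _ _ _))//.
rewrite mulrDl mul1r mulr_suml ler_wpDl// ler_sum// => i _.
by rewrite linearZ normrZ mulrAC ler_wpM2r.
Qed.

Lemma linear_bound_continuous (U V : normedModType R) (f : {linear U -> V}) (K : R) :
  (forall u, `|f u| <= K * `|u|) -> continuous f.
Proof.
move=> hK; apply/bounded_linear_continuous.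
have K0 : 0 < `|K| + 1 by rewrite ltr_wpDl.
exists (`|K| + 1); split => [|M KM]; first exact: num_real.
near=> u; rewrite /= (le_trans (hK u))// (le_trans _ (ltW KM))//.
have u1 : `|u| <= 1 by near: u; exact: nbhs0_le.
rewrite (le_trans (ler_wpM2r (normr_ge0 _) (ler_norm K)))//.
by rewrite (le_trans (ler_wpM2l (normr_ge0 K) u1))// mulr1 lerDl.
Unshelve. all: by end_near. Qed.

Lemma hom_continuous U V (f : 'Hom(U, V)) : continuous f.
Proof. by have [K _ hK] := hom_bound f; exact: linear_bound_continuous hK. Qed.

Lemma co_continuous V i : continuous (@co V i).
Proof.
by have [K _ hK] := co_bound V; apply: (@linear_bound_continuous _ _ _ K) => v; exact: hK.
Qed.

Lemma ball_compact V (r : R) : compact [set v : V | `|v| <= r].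
Proof.
have [K K0 hK] := co_bound V.
have -> : [set v : V | `|v| <= r] =
    @of_row V @` [set c | `|c| <= K * r /\ `|of_row c : V| <= r].
  apply/seteqP; split => [v /= vr|v [c [_ hc] <-]//].
  exists (\row_i co i v); rewrite ?of_row_co//; split => //.
  have [K' K'E] : exists K' : {nonneg R}, K'%:num = K * r.
    have h : 0 <= K * r by rewrite mulr_ge0 ?(ltW K0)// (le_trans _ vr).
    by exists (NngNum h).
  rewrite [leLHS]/Num.norm /= mx_normrE; apply/bigmax_leP; split => [|[i j] _] /=.
    by rewrite mulr_ge0 ?(ltW K0)// (le_trans _ vr).
  by rewrite mxE (le_trans (hK _ _))// ler_pM2l.
apply: continuous_compact.
  exact/continuous_subspaceT/of_row_continuous.
apply: bounded_closed_compact.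
  by exists (K * r); split; [exact: num_real|move=> M M1 c /= [h _]; exact: le_trans h (ltW M1)].
rewrite (_ : mkset _ = ((@Num.norm _ _) @^-1` [set x | x <= K * r]) `&`
  ((fun c => `|of_row c : V|) @^-1` [set x | x <= r]))//.
apply: closedI; apply: preimage_closed; [|exact: closed_le| |exact: closed_le].
  by move=> c _; exact: norm_continuous.
move=> c _; move: c; apply: comp_continuous; [exact: of_row_continuous|exact: norm_continuous].
Qed.
End finite_dimension.

(** * Calculus of smooth functions, waves and differential operators *)

Section smooth_functions.
Context {R : realType}.

Section pd.
Context {n : nat}.
Implicit Types V W : normedModType R.

Definition pd V (s : seq 'I_n) (f : 'rV[R]_n -> V) : 'rV[R]_n -> V :=
  foldr (fun i => partial i) f s.

Lemma pd_cat V s1 s2 (f : 'rV[R]_n -> V) : pd (s1 ++ s2) f = pd s1 (pd s2 f).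
Proof. exact: foldr_cat. Qed.

(** Since [smooth] quantifies over all iterated derivatives, a class stable under [partial] is
    handled by one induction on the word of derivatives. It suits families described by a formula,
    such as waves, flat functions or sums of products. *)
Lemma smooth_coind V (C : set ('rV[R]_n -> V)) :
  (forall f, C f -> [/\ continuous f, forall i x, derivable f x (delta_mx 0 i) &
     forall i, C (partial i f)]) ->
  forall f, C f -> smooth f.
Proof.
move=> HC f Cf s /=; have : C (foldr (fun i => partial i) f s).
  elim: s => //= i s ih.
  by have [_ _] := HC _ ih; exact.
by move=> /HC[].
Qed.

Lemma smooth_continuous V (f : 'rV[R]_n -> V) : smooth f -> continuous f.
Proof. by move=> /(_ [::])[]. Qed.

Lemma smooth_derivable V (f : 'rV[R]_n -> V) : smooth f ->
  forall i x, derivable f x (delta_mx 0 i).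
Proof. by move=> /(_ [::])[]. Qed.

Lemma smooth_is_derive V (f : 'rV[R]_n -> V) : smooth f ->
  forall i x, is_derive x (delta_mx 0 i) f (partial i f x).
Proof. by move=> /smooth_derivable df i x; exact: derivableP. Qed.

Lemma smooth_pd V (f : 'rV[R]_n -> V) s : smooth f -> smooth (pd s f).
Proof. by move=> sf s'; rewrite /= -foldr_cat; exact: sf. Qed.

Lemma smooth_partial V (f : 'rV[R]_n -> V) i : smooth f -> smooth (partial i f).
Proof. exact: (@smooth_pd _ _ [:: i]). Qed.

Lemma smooth_cst V (v : V) : smooth (fun _ : 'rV[R]_n => v).
Proof.
apply: (@smooth_coind _ [set f | exists v, f = fun=> v]); last by exists v.
move=> _ [{}v ->]; split; [exact: cst_continuous| |].
  by move=> i x; exact: derivable_cst.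
by move=> i; exists 0; apply/funext => x; rewrite /partial derive_cst.
Qed.

Lemma partialD V i (f g : 'rV[R]_n -> V) : smooth f -> smooth g ->
  partial i (fun x => f x + g x) = fun x => partial i f x + partial i g x.
Proof.
move=> sf sg; apply/funext => x; apply: partialE.
by apply: is_deriveD; exact: smooth_is_derive.
Qed.

Lemma smoothD V (f g : 'rV[R]_n -> V) : smooth f -> smooth g ->
  smooth (fun x => f x + g x).
Proof.
move=> sf sg.
apply: (@smooth_coind _ [set h | exists f g, [/\ smooth f, smooth g & h = fun x => f x + g x]]).
  move=> _ [{sf}f [{sg}g [sf sg ->]]]; split.
  - by apply: addf_continuous; exact: smooth_continuous.
  - move=> i x; have [] // := is_deriveD (smooth_is_derive sf i x) (smooth_is_derive sg i x).
  - move=> i; exists (partial i f), (partial i g); split; try exact: smooth_partial.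
    exact: partialD.
by exists f, g.
Qed.

Lemma pdD V s (f g : 'rV[R]_n -> V) : smooth f -> smooth g ->
  pd s (fun x => f x + g x) = fun x => pd s f x + pd s g x.
Proof.
by move=> sf sg; elim: s => //= i s ->; rewrite partialD//; exact: smooth_pd.
Qed.

Lemma is_derive_linear V W (L : {linear V -> W}) (f : 'rV[R]_n -> V) x v d :
  continuous L -> is_derive x v f d -> is_derive x v (fun x => L (f x)) (L d).
Proof.
move=> /linear_lipschitz[K K0 hK] /is_derive_epsP df; apply/is_derive_epsP => e e0.
have [r r0 rP] := df (e / K) (divr_gt0 e0 K0); exists r => // h hr.
rewrite -linearZ -!linearB (le_trans (hK _))// -ler_pdivlMl//.
by rewrite (le_trans (rP h hr))// mulrA [K^-1 * e]mulrC.
Qed.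

Lemma partial_linear V W (L : {linear V -> W}) i (f : 'rV[R]_n -> V) :
  continuous L -> smooth f -> partial i (fun x => L (f x)) = fun x => L (partial i f x).
Proof.
move=> cL sf; apply/funext => x; apply: partialE.
by apply: is_derive_linear => //; exact: smooth_is_derive.
Qed.

Lemma smooth_linear V W (L : {linear V -> W}) (f : 'rV[R]_n -> V) :
  continuous L -> smooth f -> smooth (fun x => L (f x)).
Proof.
move=> cL sf.
apply: (@smooth_coind _ [set h | exists2 f, smooth f & h = fun x => L (f x)]).
  move=> _ [{sf}f sf ->]; split.
  - by apply: comp_continuous => //; exact: smooth_continuous.
  - by move=> i x; have [] := is_derive_linear cL (smooth_is_derive sf i x).
  - by move=> i; exists (partial i f); [exact: smooth_partial|exact: partial_linear].
by exists f.
Qed.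

Lemma pd_linear V W (L : {linear V -> W}) s (f : 'rV[R]_n -> V) :
  continuous L -> smooth f -> pd s (fun x => L (f x)) = fun x => L (pd s f x).
Proof.
move=> cL sf; elim: s => //= i s ->.
by rewrite partial_linear//; exact: smooth_pd.
Qed.

Lemma partial_affine V i (c : R) (b : 'rV[R]_n) (f : 'rV[R]_n -> V) : smooth f ->
  partial i (fun x => f (c *: x + b)) = fun x => c *: partial i f (c *: x + b).
Proof.
move=> sf; apply/funext => x; apply: partialE.
by apply: is_derive_affine; exact: smooth_is_derive.
Qed.

Lemma smoothZ V (c : R) (f : 'rV[R]_n -> V) : smooth f -> smooth (fun x => c *: f x).
Proof. by move=> sf; apply: (@smooth_linear _ _ ( *:%R c)) => //; exact: scaler_continuous. Qed.

Lemma pdZ V s (c : R) (f : 'rV[R]_n -> V) : smooth f ->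
  pd s (fun x => c *: f x) = fun x => c *: pd s f x.
Proof. by move=> sf; apply: (@pd_linear _ _ ( *:%R c)) => //; exact: scaler_continuous. Qed.

Lemma smooth_affine V (c : R) (b : 'rV[R]_n) (f : 'rV[R]_n -> V) : smooth f ->
  smooth (fun x => f (c *: x + b)).
Proof.
move=> sf.
apply: (@smooth_coind _ [set h | exists k f, smooth f /\ h = fun x => k *: f (c *: x + b)]).
  move=> _ [k [{sf}f [sf ->]]]; split.
  - have c1 : continuous (fun x : 'rV[R]_n => f (c *: x + b)).
      have c0 : continuous (fun x : 'rV[R]_n => c *: x + b) by exact: affine_continuous.
      exact: (comp_continuous c0 (smooth_continuous sf)).
    have c2 : continuous (fun v : V => k *: v) by exact: scaler_continuous.
    exact: (comp_continuous c1 c2).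
  - move=> i x; apply: derivableZ.
    by have [] := is_derive_affine (smooth_is_derive sf i (c *: x + b)).
  - move=> i; exists (k * c), (partial i f); split; first exact: smooth_partial.
    apply/funext => x; rewrite /partial deriveZ; last first.
      by have [] := is_derive_affine (smooth_is_derive sf i (c *: x + b)).
    by rewrite -scalerA; congr (_ *: _); have := partial_affine i c b sf; move=> /(congr1 (@^~ x)).
by exists 1, f; split => //; apply/funext => x; rewrite scale1r.
Qed.

Lemma pd_affine V s (c : R) (b : 'rV[R]_n) (f : 'rV[R]_n -> V) : smooth f ->
  pd s (fun x => f (c *: x + b)) = fun x => c ^+ size s *: pd s f (c *: x + b).
Proof.
move=> sf; elim: s => [|i s /= ->]; first by apply/funext => x; rewrite expr0 scale1r.
have sc := @smooth_affine _ c b _ (smooth_pd s sf).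
rewrite (@partial_linear _ _ ( *:%R (c ^+ size s)) i (fun x => pd s f (c *: x + b)))//.
  rewrite (partial_affine i c b (smooth_pd s sf)); apply/funext => x; rewrite exprSr; exact: scalerA.
exact: scaler_continuous.
Qed.

Lemma smooth_sum V (I : Type) (r : seq I) (P : pred I) (f : I -> 'rV[R]_n -> V) :
  (forall i, smooth (f i)) -> smooth (fun x => \sum_(i <- r | P i) f i x).
Proof.
move=> sf; elim: r => [|i r ih].
  rewrite (_ : (fun x => _) = fun=> 0); first exact: smooth_cst.
  by apply/funext => x; rewrite big_nil.
rewrite (_ : (fun x => _) = fun x =>
  if P i then f i x + \sum_(i <- r | P i) f i x else \sum_(i <- r | P i) f i x).
  by case: (P i) => //; exact: smoothD.
by apply/funext => x; rewrite big_cons.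
Qed.

Lemma pd_cst0 V s : pd s (fun _ : 'rV[R]_n => 0 : V) = fun=> 0.
Proof. by elim: s => //= i s ->; apply/funext => x; rewrite /partial derive_cst. Qed.

Lemma pd_sum V (I : Type) (r : seq I) (P : pred I) s (f : I -> 'rV[R]_n -> V) :
  (forall i, smooth (f i)) ->
  pd s (fun x => \sum_(i <- r | P i) f i x) = fun x => \sum_(i <- r | P i) pd s (f i) x.
Proof.
move=> sf; elim: r => [|i r ih].
  rewrite (_ : (fun x => _) = fun=> 0) ?pd_cst0; last by apply/funext => x; rewrite big_nil.
  by apply/funext => x; rewrite big_nil.
rewrite (_ : (fun x => _) = fun x =>
  if P i then f i x + \sum_(i <- r | P i) f i x else \sum_(i <- r | P i) f i x); last first.
  by apply/funext => x; rewrite big_cons.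
have [Pi|Pi] := boolP (P i); last by rewrite ih; apply/funext => x; rewrite big_cons (negbTE Pi).
by rewrite pdD ?ih//; [apply/funext => x; rewrite big_cons Pi|exact: smooth_sum].
Qed.

Lemma is_derive_mul (f g : 'rV[R]_n -> R) x v df dg :
  is_derive x v f df -> is_derive x v g dg ->
  is_derive x v (fun x => f x * g x) (df * g x + f x * dg).
Proof.
move=> hf hg; have := is_deriveM hf hg.
by rewrite [_ *: _ + _ *: _](_ : _ = df * g x + f x * dg)// addrC mulrC.
Qed.

Lemma partialM i (f g : 'rV[R]_n -> R) : smooth f -> smooth g ->
  partial i (fun x => f x * g x) = fun x => partial i f x * g x + f x * partial i g x.
Proof.
move=> sf sg; apply/funext => x; apply: partialE.
by apply: is_derive_mul; exact: smooth_is_derive.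
Qed.

Lemma smoothM (f g : 'rV[R]_n -> R) : smooth f -> smooth g -> smooth (fun x => f x * g x).
Proof.
move=> sf sg.
(* Products alone are not stable under [partial]; by the Leibniz rule, finite sums of products of
   smooth functions are. *)
pose C := [set h : 'rV[R]_n -> R | exists s : seq (('rV[R]_n -> R) * ('rV[R]_n -> R)),
  (forall p, List.In p s -> smooth p.1 /\ smooth p.2) /\
  h = fun x => \sum_(p <- s) p.1 x * p.2 x].
apply: (@smooth_coind _ C); last first.
  exists [:: (f, g)]; split; first by move=> p [<-|[]]; exact: (conj sf sg).
  by apply/funext => x; rewrite big_seq1.
move=> _ [s [+ ->]]; elim: s => [_|p s ih Hs].
  have -> : (fun x : 'rV[R]_n => \sum_(p <- [::]) p.1 x * p.2 x) = (fun=> 0 : R).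
    by apply/funext => x; rewrite big_nil.
  split; [exact: cst_continuous|by move=> i x; exact: derivable_cst|].
  move=> i; exists [::]; split => //; apply/funext => x.
  by rewrite big_nil /partial derive_cst.
have [sp1 sp2] := Hs p (or_introl erefl).
have [c1 d1 C1] := ih (fun q h => Hs q (or_intror h)).
have E : (fun x : 'rV[R]_n => \sum_(p <- p :: s) p.1 x * p.2 x) =
    (fun x => p.1 x * p.2 x + \sum_(p <- s) p.1 x * p.2 x).
  by apply/funext => x; rewrite big_cons.
have dp i x : is_derive x (delta_mx 0 i) (fun x => p.1 x * p.2 x)
    (partial i p.1 x * p.2 x + p.1 x * partial i p.2 x).
  by apply: is_derive_mul; exact: smooth_is_derive.
rewrite E; split.
- apply: addf_continuous; last exact: c1.
  by apply: mulf_continuous; exact: smooth_continuous.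
- by move=> i x; apply: derivableD => //; have [] := dp i x.
- move=> i; have [s' [Hs' s'E]] := C1 i.
  exists [:: (partial i p.1, p.2), (p.1, partial i p.2) & s']; split.
    move=> q [<-|[<-|h]]; last exact: Hs'.
      exact: (conj (smooth_partial i sp1) sp2).
    exact: (conj sp1 (smooth_partial i sp2)).
  apply/funext => x; rewrite !big_cons /= addrA.
  have /= := is_deriveD (dp i x) (derivableP (d1 i x)).
  move=> /partialE ->; congr (_ + _).
  by move/(congr1 (@^~ x)) : s'E.
Qed.

Lemma scalel_linearE V (v : V) :
  exists2 L : {linear R -> V}, continuous L & forall k, L k = k *: v.
Proof.
have sx_lin : linear ( *:%R ^~ v : R -> _) by move=> u y z; rewrite scalerDl scalerA.
pose sxlM := GRing.isLinear.Build _ _ _ _ _ sx_lin.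
pose sxL : {linear _ -> _} := HB.pack ( *:%R ^~ v) sxlM.
by exists sxL => //; exact: scalel_continuous.
Qed.

Lemma smooth_scale V (f : 'rV[R]_n -> R) (v : V) : smooth f -> smooth (fun x => f x *: v).
Proof.
have [L cL LE] := scalel_linearE v => sf.
rewrite (_ : (fun x => _) = fun x => L (f x)); first exact: smooth_linear.
by apply/funext => x; rewrite LE.
Qed.

Lemma pd_scale V s (f : 'rV[R]_n -> R) (v : V) : smooth f ->
  pd s (fun x => f x *: v) = fun x => pd s f x *: v.
Proof.
have [L cL LE] := scalel_linearE v => sf.
rewrite (_ : (fun x => _) = fun x => L (f x)).
  by rewrite pd_linear//; apply/funext => x; rewrite LE.
by apply/funext => x; rewrite LE.
Qed.

End pd.

Section wave.
Context {n : nat}.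

Definition dotp (z x : 'rV[R]_n) : R := \sum_i z 0 i * x 0 i.

Lemma dotpD z x y : dotp z (x + y) = dotp z x + dotp z y.
Proof. by rewrite /dotp -big_split; apply: eq_bigr => i _; rewrite mxE mulrDr. Qed.

Lemma dotpZ z c x : dotp z (c *: x) = c * dotp z x.
Proof. by rewrite /dotp mulr_sumr; apply: eq_bigr => i _; rewrite mxE mulrCA. Qed.

Lemma dotpZl z c x : dotp (c *: z) x = c * dotp z x.
Proof. by rewrite /dotp mulr_sumr; apply: eq_bigr => i _; rewrite mxE mulrA. Qed.

Lemma dotpDl z z' x : dotp (z + z') x = dotp z x + dotp z' x.
Proof. by rewrite /dotp -big_split; apply: eq_bigr => i _; rewrite mxE mulrDl. Qed.

Lemma dotpNl z x : dotp (- z) x = - dotp z x.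
Proof. by rewrite -scaleN1r dotpZl mulN1r. Qed.

Lemma dotpN z x : dotp z (- x) = - dotp z x.
Proof. by rewrite -[- x]scaleN1r dotpZ mulN1r. Qed.

Lemma dotp_delta z i : dotp z (delta_mx 0 i) = z 0 i.
Proof.
rewrite /dotp (bigD1 i)//= mxE !eqxx mulr1 big1 ?addr0// => j ji.
by rewrite mxE eqxx (negbTE ji) mulr0.
Qed.

Lemma dotp_continuous z : continuous (dotp z).
Proof.
apply: continuous_sum => i _; apply: mulc_continuous; exact: coord_continuous.
Qed.

(** The phase makes the family stable under differentiation: a derivative in direction [i]
    multiplies by [z 0 i] and adds a quarter turn to [th]. *)
Definition wave (z : 'rV[R]_n) (th : R) (x : 'rV[R]_n) : R := cos (dotp z x + th).

Lemma wave_continuous z th : continuous (wave z th).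
Proof.
have c1 : continuous (fun x => dotp z x + th).
  by apply: addf_continuous; [exact: dotp_continuous|exact: cst_continuous].
exact: (comp_continuous c1 (@continuous_cos R)).
Qed.

Lemma is_derive_wave z th i x :
  is_derive x (delta_mx 0 i) (wave z th) (z 0 i * wave z (th + pi / 2) x).
Proof.
have d1 : is_derive (z 0 i *: (0 : R) + (dotp z x + th)) 1 (@cos R)
    (- sin (z 0 i *: (0 : R) + (dotp z x + th))) by exact: is_derive_cos.
have /is_derive_epsP d2 := is_derive_affine d1.
apply/is_derive_epsP => e e0; have [r r0 rP] := d2 e e0; exists r => // h hr.
have := rP h hr; rewrite scaler0 add0r addr0.
rewrite [h *: 1]mulr1 [z 0 i *: h]mulrC.
have -> : h * z 0 i + (dotp z x + th) = dotp z (h *: delta_mx 0 i + x) + th.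
  by rewrite dotpD dotpZ dotp_delta addrA.
rewrite (_ : wave z (th + pi / 2) x = - sin (dotp z x + th))//.
by rewrite /wave addrA cosD cos_pihalf sin_pihalf mulr0 mulr1 sub0r.
Qed.

Lemma partial_wave z th i : partial i (wave z th) = fun x => z 0 i * wave z (th + pi / 2) x.
Proof. by apply/funext => x; apply: partialE; exact: is_derive_wave. Qed.

Lemma wave_smooth z th : smooth (wave z th).
Proof.
apply: (@smooth_coind _ _ [set h | exists c th, h = fun x => c *: wave z th x]).
  move=> _ [c [{}th ->]]; split.
  - by apply: mulc_continuous; exact: wave_continuous.
  - by move=> i x; apply: derivableZ; have [] := is_derive_wave z th i x.
  - move=> i; exists (c * z 0 i), (th + pi / 2); apply/funext => x.
    have [dw _] := is_derive_wave z th i x.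
    by rewrite /partial deriveZ// -scalerA; congr (_ *: _); rewrite -[LHS]/(partial i (wave z th) x) partial_wave.
by exists 1, th; apply/funext => x; rewrite scale1r.
Qed.

Lemma pd_wave z th s :
  pd s (wave z th) = fun x => (\prod_(i <- s) z 0 i) * wave z (th + pi / 2 *+ size s) x.
Proof.
elim: s => [|i s /= ->]; first by apply/funext => x; rewrite big_nil mul1r mulr0n addr0.
apply/funext => x; rewrite big_cons; apply: partialE.
have h := is_deriveZ (\prod_(j <- s) z 0 j) (is_derive_wave z (th + pi / 2 *+ size s) i x).
apply: (is_derive_eq h); rewrite [pi / 2 *+ _.+1]mulrSr addrA.
by rewrite -[LHS]/(_ * (_ * _)) mulrA [_ * z 0 i]mulrC.
Qed.

End wave.

Section operators.
Context {n : nat}.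

(** The multi-index as a word of directions, which makes [partial_mi] an instance of [pd] and opens
    it to induction on sequences. *)
Definition mi_seq k (a : multi_index n k) : seq 'I_n :=
  flatten [seq nseq (a i) i | i <- enum 'I_n].

Lemma partial_miE k (V : normedModType R) (a : multi_index n k) (f : 'rV[R]_n -> V) :
  partial_mi a f = pd (mi_seq a) f.
Proof.
rewrite /partial_mi /mi_seq; elim: (enum 'I_n) => //= i s ->.
by rewrite pd_cat; elim: (nat_of_ord (a i)) => //= m ->.
Qed.

Lemma size_mi_seq k (a : multi_index n k) : size (mi_seq a) = mi_order a.
Proof.
rewrite /mi_order /mi_seq size_flatten /shape -map_comp sumnE big_map.
by rewrite big_enum; apply: eq_bigr => i _; rewrite /= size_nseq.
Qed.

Lemma prod_mi_seq k (a : multi_index n k) (z : 'rV[R]_n) :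
  \prod_(i <- mi_seq a) z 0 i = monomial a z.
Proof.
rewrite /monomial /mi_seq big_flatten big_map big_enum; apply: eq_bigr => i _.
by rewrite big_nseq iter_mulr_1.
Qed.

Variables (l : nat) (U V : innerProductType R) (B : diff_op n l U V).

Lemma op_applyE (f : 'rV[R]_n -> U) x :
  op_apply B f x = \sum_(a : multi_index n l | mi_order a == l) B a (pd (mi_seq a) f x).
Proof. by apply: eq_bigr => a _; rewrite partial_miE. Qed.

Lemma op_apply_continuous f : smooth f -> continuous (op_apply B f).
Proof.
move=> sf; apply: continuous_sum => a _; rewrite partial_miE.
by apply: comp_continuous; [exact/smooth_continuous/smooth_pd|exact: hom_continuous].
Qed.

Lemma op_applyD f g x : smooth f -> smooth g ->
  op_apply B (fun x => f x + g x) x = op_apply B f x + op_apply B g x.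
Proof.
move=> sf sg; rewrite !op_applyE -big_split; apply: eq_bigr => a _ /=.
by rewrite pdD// linearD.
Qed.

Lemma op_apply_sum (I : Type) (r : seq I) (P : pred I) (f : I -> 'rV[R]_n -> U) x :
  (forall i, smooth (f i)) ->
  op_apply B (fun x => \sum_(i <- r | P i) f i x) x = \sum_(i <- r | P i) op_apply B (f i) x.
Proof.
move=> sf; rewrite !op_applyE (eq_bigr _ (fun i _ => op_applyE (f i) x)) exchange_big /=.
by apply: eq_bigr => a _; rewrite pd_sum// linear_sum.
Qed.

Lemma op_applyZ c f x : smooth f ->
  op_apply B (fun x => c *: f x) x = c *: op_apply B f x.
Proof.
move=> sf; rewrite !op_applyE scaler_sumr; apply: eq_bigr => a _ /=.
by rewrite pdZ// linearZ.
Qed.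

(** By homogeneity every term carries exactly [l] derivatives, hence the same shift of the phase,
    and the monomials add up to the symbol. *)
Lemma op_apply_wave z th u x :
  op_apply B (fun x => wave z th x *: u) x = wave z (th + pi / 2 *+ l) x *: symbol B z u.
Proof.
rewrite op_applyE /symbol sum_lfunE scaler_sumr; apply: eq_bigr => a /eqP al.
rewrite pd_scale; last exact: wave_smooth.
by rewrite pd_wave size_mi_seq al prod_mi_seq linearZ scale_lfunE scalerA mulrC.
Qed.

End operators.
End smooth_functions.


(** * Trigonometric polynomials *)

Section trigonometric_polynomials.
Context {R : realType} {n : nat}.
Implicit Types (x y z : 'rV[R]_n).

Definition freq (xi : 'rV[int]_n) : 'rV[R]_n := \row_i (2 * pi * (xi 0 i)%:~R).

Definition trig (s : seq (R * 'rV[int]_n * R)) x : R :=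
  \sum_(p <- s) p.1.1 * wave (freq p.1.2) p.2 x.

Definition is_trig (K : 'rV[R]_n -> R) := exists s, K = trig s.

Lemma freqD xi eta : freq (xi + eta) = freq xi + freq eta.
Proof. by apply/rowP => i; rewrite !mxE intrD mulrDr. Qed.

Lemma freqN xi : freq (- xi) = - freq xi.
Proof. by apply/rowP => i; rewrite !mxE mulrNz mulrN. Qed.

Lemma freq0 : freq 0 = 0.
Proof. by apply/rowP => i; rewrite !mxE mulr0. Qed.

Lemma freq_eq0 xi : (freq xi == 0) = (xi == 0).
Proof.
apply/eqP/eqP => [h|->]; last exact: freq0.
apply/rowP => i; have /rowP/(_ i) := h; rewrite !mxE => /eqP.
by rewrite !mulf_eq0 pnatr_eq0/= gt_eqF ?pi_gt0//= intr_eq0 => /eqP.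
Qed.

Lemma is_trig_cst c : is_trig (fun=> c).
Proof.
exists [:: (c, 0, 0)]; apply/funext => x.
rewrite /trig big_seq1 /= freq0 /wave (_ : dotp 0 x = 0) ?addr0 ?cos0 ?mulr1//.
by rewrite /dotp big1// => i _; rewrite mxE mul0r.
Qed.

Lemma is_trigD K L : is_trig K -> is_trig L -> is_trig (fun x => K x + L x).
Proof.
move=> [s ->] [t ->]; exists (s ++ t); apply/funext => x.
by rewrite /trig big_cat.
Qed.

Lemma is_trig_sum (I : Type) (r : seq I) (K : I -> 'rV[R]_n -> R) :
  (forall i, is_trig (K i)) -> is_trig (fun x => \sum_(i <- r) K i x).
Proof.
move=> tK; elim: r => [|i r ih].
  by rewrite (_ : (fun x => _) = fun=> 0); [exact: is_trig_cst|apply/funext => x; rewrite big_nil].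
rewrite (_ : (fun x => _) = fun x => K i x + \sum_(i <- r) K i x); first exact: is_trigD.
by apply/funext => x; rewrite big_cons.
Qed.

Lemma is_trigM K L : is_trig K -> is_trig L -> is_trig (fun x => K x * L x).
Proof.
move=> [s ->] [t ->].
rewrite (_ : (fun x => _) = fun x => \sum_(p <- s) \sum_(q <- t)
    (p.1.1 * wave (freq p.1.2) p.2 x * (q.1.1 * wave (freq q.1.2) q.2 x))); last first.
  by apply/funext => x; rewrite mulr_suml; apply: eq_bigr => p _; rewrite mulr_sumr.
apply: is_trig_sum => p; apply: is_trig_sum => q.
(* Product-to-sum formula for cosines: frequencies and phases are added and subtracted. *)
exists [:: (p.1.1 * q.1.1 / 2, p.1.2 + q.1.2, p.2 + q.2);
           (p.1.1 * q.1.1 / 2, p.1.2 - q.1.2, p.2 - q.2)].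
apply/funext => x; rewrite /trig !big_cons big_nil addr0 /= freqD freqD freqN.
rewrite /wave !dotpDl dotpNl.
set a := dotp (freq p.1.2) x; set b := dotp (freq q.1.2) x.
have -> : a + b + (p.2 + q.2) = (a + p.2) + (b + q.2) by ring.
have -> : a - b + (p.2 - q.2) = (a + p.2) - (b + q.2) by ring.
by move: (a + p.2) (b + q.2) => A B; rewrite cosB cosD; field.
Qed.

Lemma is_trigX K N : is_trig K -> is_trig (fun x => K x ^+ N).
Proof.
move=> tK; elim: N => [|N ih]; first exact: is_trig_cst.
rewrite (_ : (fun x => _) = fun x => K x * K x ^+ N); first exact: is_trigM.
by apply/funext => x; rewrite exprS.
Qed.

Lemma trig_continuous s : continuous (trig s).
Proof.
by apply: continuous_sum => p _; apply: mulc_continuous; exact: wave_continuous.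
Qed.

Lemma wave_per xi th (i : 'I_n) x :
  wave (freq xi) th (x + delta_mx 0 i) = wave (freq xi) th x.
Proof.
rewrite /wave dotpD dotp_delta mxE.
have -> : dotp (freq xi) x + 2 * pi * (xi 0 i)%:~R + th =
  dotp (freq xi) x + th + pi *+ 2 * (xi 0 i)%:~R by rewrite -mulr_natl; ring.
move: (dotp _ _ + th) => a; case: (xi 0 i) => k.
  by rewrite -[(Posz k)%:~R]/(k%:R) mulr_natr (periodicn (@cosD2pi R)).
rewrite NegzE mulrNz mulrN -[(Posz k.+1)%:~R]/(k.+1%:R) mulr_natr.
by rewrite -[LHS](periodicn (@cosD2pi R) k.+1) subrK.
Qed.

(** Up to a nonzero factor [freq xi 0 i], the wave is a partial derivative of a periodic wave. *)
Lemma wave_integral0 xi th : xi != 0 -> cube_integral (wave (freq xi) th) = 0.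
Proof.
move=> xi0; have [i xii] : exists i, xi 0 i != 0.
  apply/existsP; rewrite -negb_forall; apply: contraNN xi0 => /forallP h.
  by apply/eqP/rowP => i; have /eqP := h i; rewrite mxE.
have := @cube_integral_partial R n i (wave (freq xi) (th - pi / 2)).
rewrite partial_wave subrK cube_integralZ; last exact: wave_continuous.
have c1 : continuous (fun x => freq xi 0 i * wave (freq xi) th x).
  by apply: mulc_continuous; exact: wave_continuous.
have d1 x : derivable (wave (freq xi) (th - pi / 2)) x (delta_mx 0 i).
  by apply: smooth_derivable; exact: wave_smooth.
move=> /(_ d1 c1 (fun x _ => wave_per _ _ i x)).
move=> /eqP; rewrite mulf_eq0 mxE !mulf_eq0 pnatr_eq0/= gt_eqF ?pi_gt0//= intr_eq0.
by rewrite (negbTE xii)/= => /eqP.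
Qed.

Lemma wave_sub z th x y : wave z th (x - y) = wave z (- (dotp z x + th)) y.
Proof.
rewrite /wave -cosN; congr cos.
by rewrite dotpD dotpN; ring.
Qed.

(** Reflection and translation change only the phases. Waves of nonzero frequency integrate to 0 on
    both sides, and for frequency 0 it remains that the cosine is even. *)
Lemma trig_integral_shift s x :
  cube_integral (fun y => trig s (x - y)) = cube_integral (trig s).
Proof.
have cw (p : R * 'rV[int]_n * R) x' : continuous (fun y => p.1.1 * wave (freq p.1.2) p.2 (x' - y)).
  apply: mulc_continuous.
  rewrite (_ : (fun y => _) = wave (freq p.1.2) (- (dotp (freq p.1.2) x' + p.2))).
    exact: wave_continuous.
  by apply/funext => y; rewrite wave_sub.
have cw' (p : R * 'rV[int]_n * R) : continuous (fun y => p.1.1 * wave (freq p.1.2) p.2 y).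
  by apply: mulc_continuous; exact: wave_continuous.
rewrite /trig !cube_integral_sum//; apply: eq_bigr => p _.
rewrite (@cube_integral_ext _ _ _ (fun y => p.1.1 * wave (freq p.1.2) (- (dotp (freq p.1.2) x + p.2)) y)).
  rewrite !cube_integralZ; try exact: wave_continuous.
  congr (_ * _); have [->|xi0] := eqVneq p.1.2 0; last by rewrite !wave_integral0.
  apply: cube_integral_ext => y; rewrite /wave freq0.
  have d0 t : dotp (0 : 'rV[R]_n) t = 0 by rewrite /dotp big1// => i _; rewrite mxE mul0r.
  by rewrite !d0 !add0r cosN.
by move=> y; rewrite wave_sub.
Qed.

End trigonometric_polynomials.

(** * A trigonometric approximate identity *)

Section trigonometric_kernel.
Context {R : realType}.

(** As [a] is interior to the unit interval, [a] and [b] cannot be close modulo 1 without being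
    close: with [e] the minimum of [d], [a] and [1 - a], the distance [|a - b|] stays in
    [[e, 1 - e]], where the cosine is largest at the ends. The bound depends on [a] but not on
    [b]. *)
Lemma cos_gap (a d : R) : 0 < a < 1 -> 0 < d ->
  exists2 c : R, c < 1 & forall b, 0 < b < 1 -> d <= `|a - b| -> cos (2 * pi * (a - b)) <= c.
Proof.
move=> /andP[a0 a1] d0.
pose e := Num.min d (Num.min a (1 - a)).
have e0 : 0 < e by rewrite !lt_min d0 a0 subr_gt0.
have ea : e <= a by rewrite !ge_min lexx orbT.
have ea1 : e <= 1 - a by rewrite !ge_min lexx !orbT.
have ed : e <= d by rewrite !ge_min lexx.
have pi0 : 0 < pi :> R by exact: pi_gt0.
have mono s : e <= s -> s <= 1 / 2 -> cos (2 * pi * s) <= cos (2 * pi * e).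
  move=> es s2; have s1 : pi * s <= pi * (1 / 2) by rewrite ler_pM2l.
  have e1 : pi * e <= pi * s by rewrite ler_pM2l.
  have e2 : 0 < pi * e by rewrite mulr_gt0.
  rewrite leNgt ltr_cos -?leNgt ?in_itv/=; [|apply/andP; split|apply/andP; split]; lra.
exists (cos (2 * pi * e)).
  have e1 : pi * e <= pi * (1 / 2) by rewrite ler_pM2l//; lra.
  have e2 : 0 < pi * e by rewrite mulr_gt0.
  rewrite -[ltRHS]cos0 ltr_cos ?in_itv/=; [|apply/andP; split|apply/andP; split]; lra.
move=> b /andP[b0 b1] dab.
have -> : cos (2 * pi * (a - b)) = cos (2 * pi * `|a - b|).
  by case: (ger0P (a - b)) => _ //; rewrite mulrN cosN.
have s1 : `|a - b| <= 1 - e by rewrite ler_norml; apply/andP; split; lra.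
have [s2|s2] := leP `|a - b| (1 / 2); first by apply: mono => //; exact: le_trans dab.
have -> : cos (2 * pi * `|a - b|) = cos (2 * pi * (1 - `|a - b|)).
  rewrite -[RHS]cosN -[RHS](@cosD2pi R) -mulr_natl; congr cos; ring.
by apply: mono; lra.
Qed.

Context {n : nat}.
Implicit Types (x y z : 'rV[R]_n).

(* Attains its maximum 1 on the integer lattice only, so that its normalized
   powers form an approximate identity. *)
Definition bump_trig x : R :=
  (2 * n + 1)%:R^-1 * (1 + \sum_(i < n) (1 + wave (freq (delta_mx 0 i)) 0 x)).

Lemma wave_deltaE i x : wave (freq (delta_mx 0 i)) 0 x = cos (2 * pi * x 0 i) :> R.
Proof.
rewrite /wave addr0 /dotp (bigD1 i)//= !mxE !eqxx mulr1 big1 ?addr0// => j ji.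
by rewrite !mxE eqxx (negbTE ji) mulr0 mul0r.
Qed.

Lemma bump_trig_trig : is_trig bump_trig.
Proof.
apply: is_trigM; first exact: is_trig_cst.
apply: is_trigD; first exact: is_trig_cst.
apply: is_trig_sum => i; apply: is_trigD; first exact: is_trig_cst.
by exists [:: (1, delta_mx 0 i, 0)]; apply/funext => x; rewrite /trig big_seq1 mul1r.
Qed.

Let n1 : 0 < (2 * n + 1)%:R :> R. Proof. by rewrite ltr0n addn1. Qed.

Lemma bump_trig_ge0 x : 0 <= bump_trig x.
Proof.
rewrite mulr_ge0 ?invr_ge0 ?(ltW n1)// addr_ge0// sumr_ge0// => i _.
by rewrite wave_deltaE -lerBlDl sub0r cos_geN1.
Qed.

Lemma bump_trig0 : bump_trig 0 = 1.
Proof.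
rewrite /bump_trig (eq_bigr (fun=> 2)).
  rewrite sumr_const card_ord -[2 *+ n]mulr_natr -natrM -[1 in X in _ * X]/(1%:R) -natrD addnC.
  by rewrite mulVf// gt_eqF.
by move=> i _; rewrite wave_deltaE mxE mulr0 cos0.
Qed.

Lemma bump_trig_gap x (d : R) : cube x -> 0 < d -> exists2 q : R, 0 <= q < 1 &
  forall y, cube y -> (exists i, d <= `|x 0 i - y 0 i|) -> bump_trig (x - y) <= q.
Proof.
move=> cx d0.
have c_ i : {c : R | c < 1 /\ forall b, 0 < b < 1 -> d <= `|x 0 i - b| ->
    cos (2 * pi * (x 0 i - b)) <= c}.
  by apply: cid; have [c c1 hc] := cos_gap (cx i) d0; exists c.
pose c := \big[Num.max/0]_i sval (c_ i).
have c1 : c < 1 by apply/bigmax_ltP; split => // i _; case: (svalP (c_ i)).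
have c0 : 0 <= c by exact: bigmax_ge_id.
have ci i : sval (c_ i) <= c by exact: le_bigmax.
(* One coordinate at distance at least [d] lowers the sum by at least [1 - c] below its maximum
   [2 n + 1]. *)
exists (1 - (2 * n + 1)%:R^-1 * (1 - c)).
  have n1' : (2 * n + 1)%:R^-1 <= 1 :> R by rewrite invf_le1// ler1n addn1.
  have : 0 < (2 * n + 1)%:R^-1 :> R by rewrite invr_gt0.
  by move: n1'; move: ((2 * n + 1)%:R^-1 : R) => t t1 t0; nra.
move=> y cy [i hi].
rewrite /bump_trig -ler_pdivlMl ?invr_gt0// invrK mulrBr mulr1 mulrA divff ?gt_eqF// mul1r.
rewrite (bigD1 i)//= wave_deltaE.
have h1 : \sum_(j < n | j != i) (1 + wave (freq (delta_mx 0 j)) 0 (x - y)) <= \sum_(j < n | j != i) (2 : R).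
  by apply: ler_sum => j _; rewrite wave_deltaE; have := cos_le1 (2 * pi * (x - y) 0 j); lra.
have h2 : \sum_(j < n | j != i) (2 : R) = (2 * n)%:R - 2.
  have : \sum_(j < n) (2 : R) = (2 * n)%:R by rewrite sumr_const card_ord -[2 *+ n]mulr_natr natrM.
  by rewrite (bigD1 i)//= => <-; ring.
have h3 : cos (2 * pi * (x - y) 0 i) <= c.
  rewrite !mxE (le_trans _ (ci i))//; case: (svalP (c_ i)) => _; apply => //.
rewrite natrD; lra.
Qed.

(** The kernels are the powers of [bump_trig] divided by their integrals [a N]. Far from the centre
    a power is at most [q^N] with [q < 1]. On the other hand [a N] is at least a constant times
    [r^N] for every [r < 1], because [bump_trig > r] on a whole grid cell at the origin. With [r]
    halfway between [q] and 1, the quotient tends to 0. *)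
Lemma trig_kernel : exists K : nat -> 'rV[R]_n -> R,
  [/\ forall N, is_trig (K N), forall N x, 0 <= K N x,
      forall N, cube_integral (K N) = 1 &
      forall x, cube x -> forall d e : R, 0 < d -> 0 < e -> exists N0, forall N, (N0 <= N)%N ->
        forall y, cube y -> (exists i, d <= `|x 0 i - y 0 i|) -> K N (x - y) <= e].
Proof.
have cT : continuous bump_trig.
  by have [s ->] := bump_trig_trig; exact: trig_continuous.
have cTN N : continuous (fun x => bump_trig x ^+ N).
  by have [s ->] := is_trigX N bump_trig_trig; exact: trig_continuous.
pose a N := cube_integral (fun x => bump_trig x ^+ N).
have lower (r : R) : 0 <= r < 1 -> exists2 M : nat, (0 < M)%N & forall N, M%:R^-1 ^+ n * r ^+ N <= a N.
  move=> /andP[r0 r1].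
  have : nbhs (0 : 'rV[R]_n) [set x | r < bump_trig x].
    have := cT 0 [set t | r < t]; apply; apply: open_nbhs_nbhs; split; first exact: open_gt.
    by rewrite /= bump_trig0.
  move=> /nbhs_ballP[e /= e0 eP].
  have [k ke] : exists k : nat, k.+1%:R^-1 < e.
    by have /ltr_add_invr[k] := e0; rewrite add0r; exists k.
  exists k.+1 => // N; rewrite /a (@cube_integral_tile _ _ k.+1)// ler_pM2l; last first.
    by rewrite exprn_gt0// invr_gt0.
  have cc (m : {ffun 'I_n -> 'I_k.+1}) : continuous (fun y => bump_trig (cell m y) ^+ N).
    exact: (comp_continuous (@cell_continuous _ _ _ m) (cTN N)).
  rewrite (bigD1 [ffun=> ord0])//= ler_wpDr//.
    apply: sumr_ge0 => m _; rewrite -(@cube_integral_cst R n 0); apply: le_cube_integral => //.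
      exact: cst_continuous.
    by move=> x _; rewrite exprn_ge0// bump_trig_ge0.
  rewrite -(@cube_integral_cst R n (r ^+ N)); apply: le_cube_integral => //.
    exact: cst_continuous.
  move=> x cx; apply: lerXn2r; rewrite ?nnegrE ?bump_trig_ge0// ltW//.
  apply: eP; split => // i j; rewrite ord1 /ball /= !mxE ffunE /= sub0r normrN add0r.
  have /andP[x0 x1] := cx j.
  rewrite ger0_norm; last by rewrite mulr_ge0 ?invr_ge0 ?(ltW x0).
  by rewrite (le_lt_trans _ ke)// ler_piMr ?invr_ge0 ?(ltW x1).
have a0 N : 0 < a N.
  have [M M0 hM] := lower (1 / 2) ltac:(lra).
  by rewrite (lt_le_trans _ (hM N))// mulr_gt0// exprn_gt0// ?invr_gt0 ?ltr0n//; lra.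
exists (fun N x => (a N)^-1 * bump_trig x ^+ N); split.
- by move=> N; apply: is_trigM; [exact: is_trig_cst|exact: is_trigX bump_trig_trig].
- by move=> N x; rewrite mulr_ge0 ?invr_ge0 ?(ltW (a0 N))// exprn_ge0// bump_trig_ge0.
- by move=> N; rewrite cube_integralZ// -/(a N) mulVf// gt_eqF.
move=> x cx d e d0 e0; have [q /andP[q0 q1] hq] := bump_trig_gap cx d0.
pose r := (1 + q) / 2.
have r0 : 0 < r by rewrite /r; lra.
have [M M0 hM] := lower r ltac:(rewrite /r; lra).
have M0' : 0 < M%:R^-1 ^+ n :> R by rewrite exprn_gt0// invr_gt0 ltr0n.
have : (fun N => (M%:R^-1 ^+ n)^-1 * (q / r) ^+ N) @ \oo --> ((M%:R^-1 ^+ n)^-1 * 0 : R).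
  apply: cvgM; first exact: cvg_cst.
  apply: cvg_expr; rewrite ger0_norm; last by rewrite divr_ge0// ltW.
  by rewrite ltr_pdivrMr// /r; lra.
rewrite mulr0 => /cvgrPdist_lt/(_ e e0)[N0 _ hN0]; exists N0 => N N0N y cy hy.
have := hN0 N N0N; rewrite /= sub0r normrN => /(le_lt_trans (ler_norm _))/ltW; apply: le_trans.
have -> : (M%:R^-1 ^+ n)^-1 * (q / r) ^+ N = (M%:R^-1 ^+ n * r ^+ N)^-1 * q ^+ N.
  move: (M%:R^-1 ^+ n : R) => C; rewrite [(C * _)^-1]invfM expr_div_n -!mulrA; congr (_ * _).
  by rewrite mulrC.
apply: ler_pM; rewrite ?invr_ge0 ?exprn_ge0 ?bump_trig_ge0 ?(ltW (a0 N))//.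
  by rewrite lef_pV2 ?posrE// mulr_gt0// exprn_gt0.
by apply: lerXn2r; rewrite ?nnegrE ?bump_trig_ge0//; exact: hq.
Qed.

End trigonometric_kernel.

(** * Vector-valued integrals and Fourier coefficients *)

Section vector_integrals.
Context {R : realType} {n : nat}.
Implicit Types (U V W : innerProductType R).

Lemma homZ V W (L : 'Hom(V, W)) c v : L (c *: v) = c *: L v.
Proof. exact: linearZ. Qed.

Lemma hom_sum V W (L : 'Hom(V, W)) (I : Type) (r : seq I) (P : pred I) (f : I -> V) :
  L (\sum_(i <- r | P i) f i) = \sum_(i <- r | P i) L (f i).
Proof. exact: linear_sum. Qed.

(** Unfolds to the same integral as [vector_integral] for [cube_measure], which is how the zero mean
    in [quasiconvex] enters. *)
Definition vint V (f : 'rV[R]_n -> V) : V :=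
  \sum_i cube_integral (fun x => co i (f x)) *: bv i.

Lemma co_vint V (f : 'rV[R]_n -> V) i : co i (vint f) = cube_integral (fun x => co i (f x)).
Proof. exact: co_sum. Qed.

Lemma co_inj V (u v : V) : (forall i, co i u = co i v) -> u = v.
Proof. by move=> h; rewrite [LHS]coE [RHS]coE; apply: eq_bigr => i _; rewrite h. Qed.

Lemma co_comp_continuous V (f : 'rV[R]_n -> V) i :
  continuous f -> continuous (fun x => co i (f x)).
Proof. by move=> cf; exact: (comp_continuous cf (@co_continuous _ V i)). Qed.

Lemma vint_linear V W (L : 'Hom(V, W)) (f : 'rV[R]_n -> V) : continuous f ->
  vint (fun x => L (f x)) = L (vint f).
Proof.
move=> cf; apply: co_inj => j; rewrite co_vint /vint hom_sum.
have -> : co j (\sum_i L (cube_integral (fun x => co i (f x)) *: bv i)) =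
    \sum_i cube_integral (fun x => co i (f x)) * co j (L (bv i)).
  by rewrite co_lsum; apply: eq_bigr => i _; rewrite homZ coZ.
transitivity (cube_integral (fun x => \sum_i co j (L (bv i)) * co i (f x))).
  apply: cube_integral_ext => x; rewrite [f x in LHS]coE hom_sum co_lsum.
  by apply: eq_bigr => i _; rewrite homZ coZ mulrC.
rewrite cube_integral_sum => [|i]; last by apply: mulc_continuous; exact: co_comp_continuous.
apply: eq_bigr => i _; rewrite [LHS]cube_integralZ; last exact: co_comp_continuous.
exact: mulrC.
Qed.

Lemma vintD V (f g : 'rV[R]_n -> V) : continuous f -> continuous g ->
  vint (fun x => f x + g x) = vint f + vint g.
Proof.
move=> cf cg; apply: co_inj => i; rewrite coD !co_vint -cube_integralD; try exact: co_comp_continuous.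
by apply: cube_integral_ext => x; rewrite coD.
Qed.

Lemma vintZ V c (f : 'rV[R]_n -> V) : continuous f ->
  vint (fun x => c *: f x) = c *: vint f.
Proof.
move=> cf; apply: co_inj => i; rewrite coZ !co_vint -cube_integralZ; last exact: co_comp_continuous.
by apply: cube_integral_ext => x; rewrite coZ.
Qed.

Lemma vint_sum V (I : Type) (r : seq I) (P : pred I) (f : I -> 'rV[R]_n -> V) :
  (forall i, continuous (f i)) ->
  vint (fun x => \sum_(i <- r | P i) f i x) = \sum_(i <- r | P i) vint (f i).
Proof.
move=> cf; apply: co_inj => j; rewrite co_vint co_lsum.
rewrite (eq_bigr (fun i => cube_integral (fun x => co j (f i x)))); last first.
  by move=> i _; rewrite co_vint.
rewrite -cube_integral_sum => [|i]; last exact: co_comp_continuous.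
by apply: cube_integral_ext => x; rewrite co_lsum.
Qed.

Lemma vint_scale V (f : 'rV[R]_n -> R) (v : V) : continuous f ->
  vint (fun x => f x *: v) = cube_integral f *: v.
Proof.
move=> cf; apply: co_inj => i; rewrite coZ co_vint [RHS]mulrC -cube_integralZ//.
by apply: cube_integral_ext => x; rewrite coZ mulrC.
Qed.

Lemma scale_continuous2 (T : topologicalType) V (f : T -> R) (g : T -> V) :
  continuous f -> continuous g -> continuous (fun x => f x *: g x).
Proof. by move=> cf cg x; apply: cvgZ; [exact: cf|exact: cg]. Qed.

(* A Fourier coefficient; the phase [th] replaces complex exponentials. *)
Definition fcoef V z th (f : 'rV[R]_n -> V) : V := vint (fun y => wave z th y *: f y).

Definition vtrig V (s : seq ('rV[int]_n * R * V)) (x : 'rV[R]_n) : V :=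
  \sum_(p <- s) wave (freq p.1.1) p.1.2 x *: p.2.

Lemma vtrig_smooth V (s : seq ('rV[int]_n * R * V)) : smooth (vtrig s).
Proof. by apply: smooth_sum => p; apply: smooth_scale; exact: wave_smooth. Qed.

Lemma vtrig_per V (s : seq ('rV[int]_n * R * V)) : Defs.periodic (vtrig s).
Proof. by move=> i x; apply: eq_bigr => p _; rewrite wave_per. Qed.

Lemma wave_shiftpi z th (x : 'rV[R]_n) : wave z (th + pi / 2) x = - wave z (th - pi / 2) x.
Proof.
rewrite /wave; move: (dotp z x) => a.
by rewrite -cosDpi; congr cos; field.
Qed.

(* Equal values on opposite faces: no boundary terms when integrating by parts. *)
Definition matched V (f : 'rV[R]_n -> V) :=
  forall i (x : 'rV[R]_n), x 0 i = 0 -> f (x + delta_mx 0 i) = f x.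

(** Integration by parts; its minus sign turns the phase [th + pi / 2] of the differentiated wave
    into [th - pi / 2]. *)
Lemma fcoef_partial V xi th i (f : 'rV[R]_n -> V) : smooth f -> matched f ->
  fcoef (freq xi) th (partial i f) = freq xi 0 i *: fcoef (freq xi) (th - pi / 2) f.
Proof.
move=> sf mf; apply: co_inj => j; rewrite coZ !co_vint.
pose L : {linear V -> R} := coord (vbasis {:V}) j.
have cL : continuous L by exact: (@co_continuous _ V j).
have sg : smooth (fun x => co j (f x)) by exact: (smooth_linear cL sf).
have pg : partial i (fun x => co j (f x)) = fun x => co j (partial i f x).
  exact: (partial_linear i cL sf).
have sw := wave_smooth (freq xi) th.
have cM (z : 'rV[R]_n) t g : continuous g -> continuous (fun x => wave z t x * g x).
  by move=> cg; apply: mulf_continuous => //; exact: wave_continuous.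
have := @cube_integral_partial R n i (fun x => wave (freq xi) th x * co j (f x)).
rewrite partialM// partial_wave pg => /(_ (fun x => smooth_derivable (smoothM sw sg) (x := x))).
have c1 : continuous (fun x => freq xi 0 i * wave (freq xi) (th + pi / 2) x * co j (f x)).
  apply: mulf_continuous; last exact: (smooth_continuous sg).
  by apply: mulc_continuous; exact: wave_continuous.
have c2 : continuous (fun x => wave (freq xi) th x * co j (partial i f x)).
  apply: cM; apply: co_comp_continuous; exact: (smooth_continuous (smooth_partial i sf)).
move=> /(_ (addf_continuous c1 c2)); rewrite cube_integralD//.
move=> /(_ _)/eqP; rewrite addrC addr_eq0 => h.
rewrite (@cube_integral_ext _ _ _ (fun x => wave (freq xi) th x * co j (partial i f x))); last first.
  by move=> x; rewrite coZ.
rewrite [LHS](eqP (h _)); last by move=> x xi0; rewrite wave_per mf.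
rewrite -mulN1r -!cube_integralZ//; last first.
  apply: co_comp_continuous; apply: scale_continuous2; last exact: (smooth_continuous sf).
  exact: wave_continuous.
by apply: cube_integral_ext => x; rewrite coZ wave_shiftpi; ring.
Qed.

Lemma fcoef_pd V xi th s (f : 'rV[R]_n -> V) : smooth f -> (forall s, matched (pd s f)) ->
  fcoef (freq xi) th (pd s f) =
  (\prod_(i <- s) freq xi 0 i) *: fcoef (freq xi) (th - pi / 2 *+ size s) f.
Proof.
move=> sf mf; elim: s th => [|i s ih] th /=.
  by rewrite big_nil scale1r mulr0n subr0.
rewrite (fcoef_partial _ _ _ (smooth_pd s sf) (mf s)).
by rewrite ih scalerA big_cons [pi / 2 *+ _.+1]mulrS opprD addrA.
Qed.

(** Places the coefficients of [A f] in the image of the symbol at the same frequency and, if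
    [A f = 0], those of [f] in its kernel. *)
Lemma fcoef_op k V W (A : diff_op n k V W) xi th (f : 'rV[R]_n -> V) : smooth f ->
  (forall s, matched (pd s f)) ->
  fcoef (freq xi) th (op_apply A f) = symbol A (freq xi) (fcoef (freq xi) (th - pi / 2 *+ k) f).
Proof.
move=> sf mf; rewrite /fcoef.
have cp s : continuous (pd s f) by exact/smooth_continuous/smooth_pd.
have cw (g : 'rV[R]_n -> V) t : continuous g -> continuous (fun y => wave (freq xi) t y *: g y).
  by apply: scale_continuous2; exact: wave_continuous.
transitivity (vint (fun y => \sum_(a : multi_index n k | mi_order a == k)
    A a (wave (freq xi) th y *: pd (mi_seq a) f y))).
  congr vint; apply/funext => y; rewrite op_applyE scaler_sumr.
  by apply: eq_bigr => a _; rewrite linearZ.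
rewrite vint_sum => [|a]; last exact: (comp_continuous (cw _ _ (cp _)) (@hom_continuous _ _ _ (A a))).
rewrite /symbol sum_lfunE; apply: eq_bigr => a /eqP ak.
rewrite vint_linear; last exact: cw.
have := fcoef_pd xi th (mi_seq a) sf mf; rewrite /fcoef => ->.
by rewrite linearZ scale_lfunE prod_mi_seq size_mi_seq ak.
Qed.

End vector_integrals.

Section trigonometric_approximation.
Context {R : realType} {n : nat}.
Implicit Types (U V W : innerProductType R).

Lemma cube_integral_norm_le (h k : 'rV[R]_n -> R) : continuous h -> continuous k ->
  (forall x, cube x -> `|h x| <= k x) -> `|cube_integral h| <= cube_integral k.
Proof.
move=> ch ck hk; rewrite ler_norml; apply/andP; split.
  rewrite -mulN1r -cube_integralZ//; apply: le_cube_integral => //.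
    exact: mulc_continuous.
  by move=> x /hk; rewrite ler_norml mulN1r => /andP[].
by apply: le_cube_integral => // x /hk; rewrite ler_norml => /andP[].
Qed.

Lemma reflect_continuous (T : topologicalType) (K : 'rV[R]_n -> T) (x : 'rV[R]_n) : continuous K ->
  continuous (fun y : 'rV[R]_n => K (x - y)).
Proof.
move=> cK; have -> : (fun y : 'rV[R]_n => K (x - y)) = (fun y => K (-1 *: y + x)).
  by apply/funext => y; rewrite scaleN1r addrC.
have c1 : continuous (fun y : 'rV[R]_n => -1 *: y + x) by exact: affine_continuous.
exact: (comp_continuous c1 cK).
Qed.

Section kernel.
Variable K : nat -> 'rV[R]_n -> R.
Implicit Types x y : 'rV[R]_n.
Hypothesis K_trig : forall N, is_trig (K N).
Hypothesis K_ge0 : forall N x, 0 <= K N x.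
Hypothesis K_int : forall N, cube_integral (K N) = 1.
Hypothesis K_conc : forall x, cube x -> forall d e : R, 0 < d -> 0 < e ->
  exists N0, forall N, (N0 <= N)%N ->
    forall y, cube y -> (exists i, d <= `|x 0 i - y 0 i|) -> K N (x - y) <= e.

Lemma kernel_continuous N : continuous (K N).
Proof. by have [s ->] := K_trig N; exact: trig_continuous. Qed.

Lemma kernel_reflect_continuous N x : continuous (fun y => K N (x - y)).
Proof. exact: (reflect_continuous (@kernel_continuous N)). Qed.

Lemma kernel_reflect_integral N x : cube_integral (fun y => K N (x - y)) = 1.
Proof.
by rewrite -(K_int N); have [s ->] := K_trig N; exact: trig_integral_shift.
Qed.

Lemma kernel_mass N x c : cube_integral (fun y => c * K N (x - y)) = c.
Proof.
by rewrite cube_integralZ ?kernel_reflect_integral ?mulr1//; exact: kernel_reflect_continuous.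
Qed.

Lemma kernel_bound (g : 'rV[R]_n -> R) M N x : continuous g ->
  (forall y, cube y -> `|g y| <= M) ->
  `|cube_integral (fun y => K N (x - y) * g y)| <= M.
Proof.
move=> cg gM; rewrite -[leRHS](kernel_mass N x M); apply: cube_integral_norm_le.
- by apply: mulf_continuous => //; exact: kernel_reflect_continuous.
- by apply: mulc_continuous; exact: kernel_reflect_continuous.
- by move=> y cy; rewrite normrM ger0_norm// mulrC ler_wpM2r// gM.
Qed.

Lemma kernel_approx (g : 'rV[R]_n -> R) x : continuous g -> cube x ->
  (fun N => cube_integral (fun y => K N (x - y) * g y)) @ \oo --> g x.
Proof.
move=> cg cx; apply/cvgrPdist_le => e e0.
have [M [M0 hM]] := continuous_cube_bounded cg.
have hM' y : cube y -> `|g y| <= M.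
  by move=> cy; apply: hM => i; have /andP[/ltW-> /ltW->] := cy i.
have [d d0 hd] : exists2 d : R, 0 < d & forall y : 'rV[R]_n,
    (forall i, `|x 0 i - y 0 i| < d) -> `|g y - g x| <= e / 2.
  have /cvgrPdist_le/(_ (e / 2)) : g @ x --> g x by exact: cg.
  move=> /(_ (divr_gt0 e0 (ltr0Sn R 1)))/nbhs_ballP[d /= d0 hd]; exists d => // y hy.
  by rewrite distrC; apply: hd; split => // i j; rewrite ord1; exact: hy.
have [N0 hN0] := K_conc cx d0 (divr_gt0 e0 (mulr_gt0 (ltr0Sn R 3) M0)).
exists N0 => // N /= N0N.
have ck := @kernel_reflect_continuous N x.
have -> : g x = cube_integral (fun y => g x * K N (x - y)) by rewrite kernel_mass.
rewrite -[X in _ - X]mul1r -mulNr -cube_integralZ; last exact: mulf_continuous.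
rewrite -cube_integralD; [|exact: mulc_continuous|by apply: mulc_continuous; exact: mulf_continuous].
(* The first summand absorbs the points [y] near [x], where [g] varies by at most [e / 2]; the
   second absorbs the others, where the kernel is at most [e / (4 M)] and [g] varies by at most
   [2 M]. *)
have -> : e = cube_integral (fun y => e / 2 * K N (x - y) + e / 2).
  rewrite cube_integralD ?kernel_mass ?cube_integral_cst; [by field|exact: mulc_continuous|exact: cst_continuous].
apply: cube_integral_norm_le.
- apply: addf_continuous; first exact: mulc_continuous.
  by apply: mulc_continuous; exact: mulf_continuous.
- by apply: addf_continuous; [exact: mulc_continuous|exact: cst_continuous].
move=> y cy; have -> : g x * K N (x - y) + -1 * (K N (x - y) * g y) = - (K N (x - y) * (g y - g x)) by ring.
rewrite normrN normrM (ger0_norm (K_ge0 _ _)).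
have [/forallP hy|] := boolP [forall i, `|x 0 i - y 0 i| < d].
  rewrite (le_trans (ler_wpM2l (K_ge0 _ _) (hd y hy)))// mulrC lerDl.
  by rewrite divr_ge0// ltW.
rewrite negb_forall => /existsP[i]; rewrite -leNgt => hi.
have kle := hN0 N N0N y cy (ex_intro _ i hi).
have gle : `|g y - g x| <= 2 * M.
  by rewrite (le_trans (ler_normB _ _))// mulr_natl mulr2n lerD// hM'.
rewrite (le_trans (ler_pM (K_ge0 _ _) (normr_ge0 _) kle gle))//.
have -> : e / (4 * M) * (2 * M) = e / 2 by field; rewrite gt_eqF.
by rewrite lerDr mulr_ge0// divr_ge0// ltW.
Qed.

End kernel.

(** The addition formula, with the sine written as a wave of phase [- pi / 2]. It separates the
    variables in the convolution of a wave with a field. *)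
Lemma wave_subD z th (x y : 'rV[R]_n) : wave z th (x - y) =
  wave z th x * wave z 0 y + wave z (th - pi / 2) x * wave z (- (pi / 2)) y.
Proof.
rewrite /wave dotpD dotpN; move: (dotp z x) (dotp z y) => a b.
by rewrite addr0 addrA !cosBpihalf -cosB; congr cos; ring.
Qed.

(** Convolution with a trigonometric kernel yields a polynomial whose coefficients are multiples of
    Fourier coefficients of [f] at the same frequencies, so any constraint [P] on those multiples is
    inherited. As [f] need not be periodic, the convergence is claimed pointwise in the open cube,
    with a uniform bound. *)
Lemma vtrig_approx V (f : 'rV[R]_n -> V) (P : 'rV[int]_n -> V -> Prop) :
  continuous f -> (forall xi th a, P xi (a *: fcoef (freq xi) th f)) ->
  exists s : nat -> seq ('rV[int]_n * R * V),
  [/\ forall N, {in s N, forall p, P p.1.1 p.2},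
      forall x, cube x -> (fun N => vtrig (s N) x) @ \oo --> f x &
      exists M, forall N x, `|vtrig (s N) x| <= M].
Proof.
move=> cf HP; have [K [Kt K0 K1 Kc]] := @trig_kernel R n.
pose t N := sval (cid (Kt N)).
have tE N : K N = trig (t N) by rewrite /t; case: (cid (Kt N)).
pose s N := flatten [seq [:: (p.1.2, p.2, p.1.1 *: fcoef (freq p.1.2) 0 f);
   (p.1.2, p.2 - pi / 2, p.1.1 *: fcoef (freq p.1.2) (- (pi / 2)) f)] | p <- t N].
have cwf z th : continuous (fun y => wave z th y *: f y).
  by apply: scale_continuous2 => //; exact: wave_continuous.
have sE N x : vtrig (s N) x = vint (fun y => K N (x - y) *: f y).
  rewrite /vtrig /s big_flatten big_map.
  transitivity (vint (fun y => \sum_(p <- t N) (p.1.1 * wave (freq p.1.2) p.2 (x - y)) *: f y)).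
    rewrite vint_sum => [|p]; last first.
      apply: scale_continuous2 => //; apply: mulc_continuous.
      by apply: reflect_continuous; exact: wave_continuous.
    apply: eq_bigr => p _; rewrite big_cons big_seq1 /= /fcoef.
    rewrite -!vintZ//; [|by apply: scale_continuous2; [exact: cst_continuous|]..].
    have cpw th : continuous (fun y => p.1.1 *: (wave (freq p.1.2) th y *: f y)).
      by apply: scale_continuous2; [exact: cst_continuous|].
    have cpw' a th : continuous (fun y => a *: (p.1.1 *: (wave (freq p.1.2) th y *: f y))).
      by apply: scale_continuous2; [exact: cst_continuous|].
    rewrite -vintD//; congr vint; apply/funext => y.
    by rewrite !scalerA -scalerDl wave_subD; congr (_ *: _); ring.
  congr vint; apply/funext => y; rewrite tE /trig scaler_suml.
  by apply: eq_bigr.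
exists s; split.
- move=> N p /flattenP[q /mapP[r _ ->]]; rewrite !inE => /orP[]/eqP -> /=; exact: HP.
- move=> x cx.
  rewrite (_ : (fun N => _) = fun N => \sum_i cube_integral (fun y => K N (x - y) * co i (f y)) *: bv i).
    rewrite [X in _ --> X]coE; apply: cvg_sum => i _; apply: cvgZr_tmp.
    apply: (kernel_approx Kt K0 K1 Kc) => //; exact: co_comp_continuous.
  apply/funext => N; rewrite sE /vint; apply: eq_bigr => i _; congr (_ *: _).
  by apply: cube_integral_ext => y; rewrite coZ.
- have M_ i : {M : R | forall y, cube y -> `|co i (f y)| <= M}.
    apply: cid; have [M [_ hM]] := continuous_cube_bounded (co_comp_continuous (i := i) cf).
    by exists M => y cy; apply: hM => j; have /andP[/ltW-> /ltW->] := cy j.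
  exists (\sum_i sval (M_ i) * `|bv i : V|) => N x.
  rewrite sE /vint (le_trans (ler_norm_sum _ _ _))//; apply: ler_sum => i _.
  rewrite normrZ ler_wpM2r//.
  rewrite (@cube_integral_ext _ _ _ (fun y => K N (x - y) * co i (f y))); last by move=> y; rewrite coZ.
  apply: (kernel_bound Kt K0 K1); first exact: co_comp_continuous.
  by case: (M_ i).
Qed.

End trigonometric_approximation.

(** * Quasiconvexity and test fields *)

Section quasiconvexity.
Context {R : realType} {n : nat}.

Lemma continuous_ball_bounded (V : innerProductType R) (F : V -> R) (r : R) : continuous F ->
  exists2 M : R, 0 < M & forall y, `|y| <= r -> `|F y| <= M.
Proof.
move=> cF.
have /compact_bounded[M [_ hM]] := continuous_compact (continuous_subspaceT cF) (@ball_compact R V r).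
exists (`|M| + 1); first by rewrite ltr_wpDl.
move=> x hx; apply: (hM (`|M| + 1)); first by rewrite ltr_pwDr// ler_norm.
by exists x.
Qed.

Lemma cube_integral_comp_cvg (V : innerProductType R) (F : V -> R) (z : V)
    (f_ : nat -> 'rV[R]_n -> V) (f : 'rV[R]_n -> V) (M : R) :
  continuous F -> (forall N, continuous (f_ N)) -> continuous f ->
  (forall N x, cube x -> `|f_ N x| <= M) -> (forall x, cube x -> (fun N => f_ N x) @ \oo --> f x) ->
  (fun N => cube_integral (fun x => F (z + f_ N x))) @ \oo -->
  cube_integral (fun x => F (z + f x)).
Proof.
move=> cF cf_ cf fM ff; have [M' M'0 hM'] := continuous_ball_bounded (`|z| + M) cF.
have ca (g : 'rV[R]_n -> V) : continuous g -> continuous (fun x => F (z + g x)).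
  move=> cg; apply: (@comp_continuous _ _ _ (fun x => z + g x) F) => //.
  by apply: addf_continuous => //; exact: cst_continuous.
apply: (cube_integral_cvg (M := M')).
- by move=> N; exact: ca.
- exact: ca.
- by move=> N x cx; apply: hM'; rewrite (le_trans (ler_normD _ _))// lerD2l fM.
- move=> x cx; apply: (@cvg_comp _ _ _ (fun N => z + f_ N x) F); last exact: cF.
  by apply: cvgD; [exact: cvg_cst|exact: ff].
Qed.

Lemma pd_vanish (V : normedModType R) (O : set 'rV[R]_n) (f : 'rV[R]_n -> V) s :
  open O -> (forall x, O x -> f x = 0) -> forall x, O x -> pd s f x = 0.
Proof.
move=> oO f0; elim: s => //= i s ih x Ox; apply: partialE; apply/is_derive_epsP => e e0.
have /nbhs_ballP[r /= r0 rO] : nbhs x O by exact: open_nbhs_nbhs.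
exists r => // h hr; rewrite !ih ?subrr ?sub0r ?scaler0 ?oppr0 ?normr0 ?mulr_ge0 ?(ltW e0)//.
apply: rO; rewrite -ball_normE /= opprD addrA addrAC subrr add0r normrN normrZ.
rewrite (le_lt_trans _ hr)// ler_piMr//.
rewrite [leLHS]/Num.norm /= mx_normrE; apply/bigmax_leP; split => // -[a b] _ /=.
by rewrite mxE; case: (_ && _); rewrite ?normr1 ?normr0.
Qed.

Lemma test_field_out (U : innerProductType R) (u : 'rV[R]_n -> U) s x :
  test_field u -> ~ cube x -> pd s u x = 0.
Proof.
move=> [su hu] ncx; apply: (@pd_vanish _ (~` closure [set x | u x != 0])).
- by apply: closed_openC; exact: closed_closure.
- move=> y /= hy; apply/eqP/negPn/negP => uy; apply: hy; exact: subset_closure.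
- by move=> /hu.
Qed.

Lemma test_field_matched (U : innerProductType R) (u : 'rV[R]_n -> U) s :
  test_field u -> matched (pd s u).
Proof.
move=> tu i x xi0; rewrite !(test_field_out _ tu)// => /(_ i).
  by rewrite xi0 ltxx.
by rewrite !mxE !eqxx xi0 add0r ltxx andbF.
Qed.

Lemma periodic_matched (V : innerProductType R) (w : 'rV[R]_n -> V) s :
  smooth w -> Defs.periodic w -> matched (pd s w).
Proof.
move=> sw pw i x _.
have E : (fun x => w (1 *: x + delta_mx 0 i)) = w.
  by apply/funext => y; rewrite scale1r pw.
have := pd_affine s 1 (delta_mx 0 i) sw; rewrite E => /(congr1 (@^~ x)) ->.
by rewrite expr1n !scale1r.
Qed.

Variables (U V W : innerProductType R) (k l : nat) (A : diff_op n k V W) (B : diff_op n l U V).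
Hypothesis l_ge1 : (1 <= l)%N.
Hypothesis exactAB : forall xi : 'rV[R]_n, xi != 0 -> lker (symbol A xi) = limg (symbol B xi).

(** Exactness concerns nonzero frequencies only; at frequency 0 an operator of positive order has
    zero symbol, in accordance with the zero mean of the fields. *)
Lemma symbolB0 : symbol B 0 = 0.
Proof.
rewrite /symbol big1// => a /eqP al.
have [i ai] : exists i, a i != ord0.
  apply/existsP; rewrite -negb_forall; apply/negP => /forallP h.
  move: al; rewrite /mi_order big1 => [l0|i _]; first by have := l_ge1; rewrite -l0.
  by rewrite (eqP (h i)).
rewrite /monomial (bigD1 i)//= mxE expr0n (negbTE (_ : (a i : nat) != 0%N)) ?mul0r ?scale0r//.
Qed.

Lemma symbolAB z u : symbol A z (symbol B z u) = 0.
Proof.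
have [->|z0] := eqVneq z 0; first by rewrite symbolB0 zero_lfunE linear0.
by apply/eqP; rewrite -memv_ker exactAB// memv_img// memvf.
Qed.

Lemma kerA_imB z v : z != 0 -> symbol A z v = 0 -> exists u, v = symbol B z u.
Proof.
move=> z0 /eqP; rewrite -memv_ker exactAB// => /memv_imgP[u _ ->].
by exists u.
Qed.

Definition imB (xi : 'rV[int]_n) (v : V) := exists u, v = symbol B (freq xi) u.

(** Each coefficient [symbol B z u] is replaced by [u], with the phase moved back by the [l] quarter
    turns that [B] will add. *)
Lemma vtrig_potential (s : seq ('rV[int]_n * R * V)) :
  {in s, forall p, imB p.1.1 p.2} -> exists t, vtrig s = op_apply B (vtrig t).
Proof.
elim: s => [_|p s ih hs].
  exists [::]; apply/funext => x; rewrite /vtrig big_nil.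
  rewrite (_ : (fun _ => _) = fun=> 0); last by apply/funext => y; rewrite big_nil.
  by rewrite op_applyE big1// => a _; rewrite pd_cst0 linear0.
have [t tE] : exists t, vtrig s = op_apply B (vtrig t).
  by apply: ih => q qs; apply: hs; rewrite inE qs orbT.
have [u uE] := hs p (mem_head _ _).
exists ((p.1.1, p.1.2 - pi / 2 *+ l, u) :: t); apply/funext => x.
rewrite [LHS]/vtrig big_cons -/(vtrig s x) tE uE.
have -> : vtrig ((p.1.1, p.1.2 - pi / 2 *+ l, u) :: t) =
    fun x => wave (freq p.1.1) (p.1.2 - pi / 2 *+ l) x *: u + vtrig t x.
  by apply/funext => y; rewrite [LHS]/vtrig big_cons.
rewrite op_applyD; [|by apply: smooth_scale; exact: wave_smooth|exact: vtrig_smooth].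
by rewrite op_apply_wave subrK.
Qed.

Lemma vtrig_afree (s : seq ('rV[int]_n * R * V)) x :
  {in s, forall p, imB p.1.1 p.2} -> op_apply A (vtrig s) x = 0.
Proof.
move=> hs; rewrite op_apply_sum => [|p]; last by apply: smooth_scale; exact: wave_smooth.
rewrite big_seq big1// => p /hs[u ->].
by rewrite op_apply_wave symbolAB scaler0.
Qed.

Lemma vtrig_mean (s : seq ('rV[int]_n * R * V)) :
  {in s, forall p, imB p.1.1 p.2} -> vint (vtrig s) = 0.
Proof.
move=> hs; rewrite /vtrig vint_sum => [|p]; last first.
  by apply: scale_continuous2; [exact: wave_continuous|exact: cst_continuous].
rewrite big_seq big1// => p /hs[u uE]; rewrite vint_scale; last exact: wave_continuous.
have [p0|p0] := eqVneq p.1.1 0; last by rewrite wave_integral0// scale0r.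
by rewrite uE p0 freq0 symbolB0 zero_lfunE scaler0.
Qed.

(** The compact support of [u] leaves no boundary terms in the coefficients of [B u], which
    therefore lie in the images of the symbol; this makes every approximating polynomial periodic,
    [A]-free and of mean 0. Bounded pointwise convergence on the open cube suffices for the
    limit. *)
Lemma quasiconvex_test F (u : 'rV[R]_n -> U) z : quasiconvex A F -> test_field u ->
  F z <= cube_integral (fun x => F (z + op_apply B u x)).
Proof.
move=> [cF qF] tu; have su := tu.1.
have cu := op_apply_continuous (B := B) su.
have [|s [sP s_cvg [M sM]]] := vtrig_approx (P := imB) cu.
  move=> xi th a; exists (a *: fcoef (freq xi) (th - pi / 2 *+ l) u).
  by rewrite fcoef_op// ?linearZ// => s; exact: test_field_matched.
have cs N : continuous (vtrig (s N)) by apply: smooth_continuous; exact: vtrig_smooth.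
have := cube_integral_comp_cvg (z := z) cF cs cu (fun N x _ => sM N x) s_cvg.
move=> h; rewrite -(cvg_lim _ h)//.
apply: limr_ge; first by apply/cvg_ex; eexists; exact: h.
apply: nearW => N; apply: qF.
- exact: vtrig_smooth.
- exact: vtrig_per.
- exact: vtrig_mean.
- by move=> x; exact: vtrig_afree.
Qed.

(** Reduces quasiconvexity to fields with a trigonometric potential: a periodic [A]-free field has
    its coefficients in the kernels of the symbol of [A], so its trigonometric approximations have
    the form [B (vtrig t)]. *)
Lemma quasiconvex_of_trig F : continuous F ->
  (forall z t, F z <= cube_integral (fun x => F (z + op_apply B (vtrig t) x))) ->
  quasiconvex A F.
Proof.
move=> cF hF; split => // z w sw pw w0 Aw; have cw := smooth_continuous sw.
have [|s [sP s_cvg [M sM]]] := vtrig_approx (P := imB) cw.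
  move=> xi th a; rewrite /imB.
  (* At frequency 0 the coefficient is a multiple of the mean of [w], which vanishes. *)
  have [->|xi0] := eqVneq xi 0.
    exists 0; rewrite linear0 freq0 /fcoef.
    rewrite (_ : (fun y => _) = fun y => cos th *: w y) ?vintZ//.
      by rewrite [vint w]w0 !scaler0.
    apply/funext => y; rewrite /wave (_ : dotp 0 y = 0) ?add0r//.
    by rewrite /dotp big1// => i _; rewrite mxE mul0r.
  have [||u uE] := @kerA_imB (freq xi) (fcoef (freq xi) th w).
  - by rewrite freq_eq0.
  (* The phase is advanced so that the shift by [k] quarter turns in [fcoef_op] lands on [th]. *)
  - have := @fcoef_op _ _ k V W A xi (th + pi / 2 *+ k) w sw (fun s => periodic_matched s sw pw).
    rewrite addrK => <-; rewrite /fcoef (_ : (fun y => _) = fun=> 0).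
      by rewrite /vint big1// => i _; rewrite (_ : co i 0 = 0) ?cube_integral_cst ?scale0r// /co linear0.
    by apply/funext => y; rewrite Aw scaler0.
  - by exists (a *: u); rewrite uE linearZ.
have cs N : continuous (vtrig (s N)) by apply: smooth_continuous; exact: vtrig_smooth.
have := cube_integral_comp_cvg (z := z) cF cs cw (fun N x _ => sM N x) s_cvg.
move=> h; rewrite -(cvg_lim _ h)//.
apply: limr_ge; first by apply/cvg_ex; eexists; exact: h.
by apply: nearW => N; have [t ->] := vtrig_potential (sP N); exact: hF.
Qed.

End quasiconvexity.

(** * Smooth cutoffs of the cube *)

Section bump.
Context {R : realType}.

(* A family closed under differentiation and containing the flat function
   [exp (- 1 / x)], for [p = 1]. *)
Definition flat (p : {poly R}) (x : R) : R := if 0 < x then p.[x^-1] * expR (- x^-1) else 0.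

(** Chain rule with [t = 1 / x]: the derivative is [- t^2] times that of [p(t) exp (- t)]. *)
Definition dflat (p : {poly R}) : {poly R} := 'X^2 * (p - p^`()).

Lemma poly_expR_bound (p : {poly R}) :
  exists2 C : R, 0 < C & forall t, 0 <= t -> `|p.[t] * expR (- t)| <= C.
Proof.
have mono k : exists2 C : R, 0 < C & forall t, 0 <= t -> `|t ^+ k * expR (- t)| <= C.
  exists (k.+1`!%:R); first by rewrite ltr0n fact_gt0.
  move=> t t0; rewrite ger0_norm ?mulr_ge0 ?exprn_ge0 ?expR_ge0//.
  rewrite expRN ler_pdivrMr ?expR_gt0//.
  case: k => [|k].
    by rewrite expr0 mul1r (le_trans _ (expR_ge1Dx t))// lerDl.
  have := expR_ge1Dxn k t0; rewrite -(ler_pM2l (_ : 0 < k.+1`!%:R)) ?ltr0n ?fact_gt0//.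
  rewrite mulrDr mulrCA divff ?mulr1 ?pnatr_eq0 -?lt0n ?fact_gt0// => h.
  have h1 : t ^+ k.+1 <= k.+1`!%:R * expR t by rewrite (le_trans _ h)// ler_wpDl ?mulr1.
  rewrite (le_trans h1)// ler_wpM2r ?expR_ge0// ler_nat factS leq_pmull//.
have C_ i : {C : R | 0 < C & forall t, 0 <= t -> `|t ^+ i * expR (- t)| <= C}.
  by apply: cid2; exact: mono.
exists (1 + \sum_(i < size p) `|p`_i| * s2val (C_ i)).
  rewrite ltr_pwDl// sumr_ge0// => i _; rewrite mulr_ge0//; apply/ltW/(s2valP (C_ i)).
move=> t t0; rewrite horner_coef mulr_suml (le_trans (ler_norm_sum _ _ _))//.
rewrite ler_wpDl// ler_sum// => i _; rewrite -mulrA normrM ler_wpM2l//.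
exact: (s2valP' (C_ i)).
Qed.

Lemma is_derive_flat p (x : R) : is_derive x 1 (flat p) (flat (dflat p) x).
Proof.
have [x0|x0|->] := ltrgt0P x.
- have dE : is_derive (x^-1) 1 (fun t : R => p.[t] * expR (- t))
      (p^`().[x^-1] * expR (- x^-1) - p.[x^-1] * expR (- x^-1)).
    have de : is_derive (x^-1) 1 (fun t : R => expR (- t)) (- expR (- x^-1)).
      have h := is_derive1_comp (is_derive_expR (- x^-1)) (is_deriveNid (x^-1) 1).
      by apply: (is_derive_eq h); rewrite mulrN1.
    apply: (is_derive_eq (is_deriveM (is_derive_poly p (x^-1)) de)).
    by rewrite scalerN addrC -[LHS]/(_ * _ - _ * _) [expR _ * _]mulrC.
  have dV : is_derive x 1 (fun y : R => y^-1) (- x ^- 2).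
    have h := @is_deriveV R id x 1 1 (lt0r_neq0 x0) (is_derive_id x 1).
    by apply: (is_derive_eq h); rewrite [_ *: _]mulr1.
  have h := is_derive1_comp dE dV.
  apply: (@near_eq_is_derive _ _ _ ((fun t : R => p.[t] * expR (- t)) \o (fun y : R => y^-1))).
    near=> y; rewrite /= /flat ifT//; near: y; exact: lt_nbhsr.
  apply: (is_derive_eq h); rewrite /flat x0 /dflat !hornerE exprVn; ring.
- apply: (@near_eq_is_derive _ _ _ (fun=> 0)).
    near=> y; rewrite /flat ifF//; apply/negbTE; rewrite -leNgt ltW//.
    by near: y; exact: lt_nbhsl.
  by rewrite /flat ltNge (ltW x0)/=; exact: is_derive_cst.
(* The factor [t^2] with [t = 1 / h] yields [|flat p h| <= C h^2], so the derivative at 0 is 0. *)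
- have [C C0 hC] := poly_expR_bound ('X^2 * p).
  rewrite [flat (dflat p) 0]/flat ltxx; apply/is_derive_epsP => e e0.
  exists (e / C); first exact: divr_gt0.
  move=> h hr; rewrite addr0 [h *: 1]mulr1 scaler0 subr0 {2}/flat ltxx subr0.
  rewrite /flat; case: ifPn => h0; last by rewrite normr0 mulr_ge0 ?(ltW e0).
  have := hC h^-1 ltac:(rewrite invr_ge0 ltW//).
  rewrite !hornerE -mulrA normrM => hh.
  have h2 : 0 < h ^+ 2 by rewrite exprn_gt0.
  move: hh; rewrite ger0_norm ?exprn_ge0 ?invr_ge0 ?(ltW h0)// exprVn ler_pdivrMl// => hh.
  rewrite (le_trans hh)// expr2 -mulrA (ger0_norm (ltW h0)) mulrC ler_pM2r//.
  by move: hr; rewrite (ger0_norm (ltW h0)) ltr_pdivlMr// => /ltW.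
Unshelve. all: by end_near. Qed.

Lemma flat_continuous p : continuous (flat p).
Proof.
move=> x; apply/differentiable_continuous; rewrite -derivable1_diffP.
by have [] := is_derive_flat p x.
Qed.

Lemma flat1_ge0 x : 0 <= flat 1 x.
Proof. by rewrite /flat; case: ifP => // _; rewrite hornerE mul1r expR_ge0. Qed.

Lemma flat1_le1 x : flat 1 x <= 1.
Proof.
rewrite /flat; case: ifPn => // x0; rewrite hornerE mul1r expR_le1.
by rewrite oppr_le0 invr_ge0 ltW.
Qed.

Context {n : nat}.

Lemma flat_coord_smooth p (i : 'I_n) (c b : R) :
  smooth (fun x : 'rV[R]_n => flat p (c * x 0 i + b)).
Proof.
have dF q (x : 'rV[R]_n) j : is_derive x (delta_mx 0 j) (fun x : 'rV[R]_n => flat q (c * x 0 i + b))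
    ((c * (j == i)%:R) * flat (dflat q) (c * x 0 i + b)).
  have d1 : is_derive ((c * (j == i)%:R) *: (0 : R) + (c * x 0 i + b)) 1 (flat q)
    (flat (dflat q) ((c * (j == i)%:R) *: (0 : R) + (c * x 0 i + b))) by exact: is_derive_flat.
  have /is_derive_epsP d2 := is_derive_affine d1.
  apply/is_derive_epsP => e e0; have [r r0 rP] := d2 e e0; exists r => // h hr.
  have := rP h hr; rewrite scaler0 add0r addr0 [h *: 1]mulr1.
  rewrite [(c * (j == i)%:R) *: h]mulrC.
  have -> // : h * (c * (j == i)%:R) + (c * x 0 i + b) = c * (h *: delta_mx 0 j + x) 0 i + b.
  by rewrite !mxE eqxx /= [i == j]eq_sym; ring.
apply: (@smooth_coind _ _ _ [set f | exists a p, f = fun x : 'rV[R]_n => a * flat p (c * x 0 i + b)]).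
  move=> _ [a [q ->]]; split.
  - apply: mulc_continuous.
    have c1 : continuous (fun x : 'rV[R]_n => c * x 0 i + b).
      apply: addf_continuous; last exact: cst_continuous.
      by apply: mulc_continuous; exact: coord_continuous.
    exact: (comp_continuous c1 (@flat_continuous q)).
  - by move=> j x; apply: derivableZ; have [] := dF q x j.
  - move=> j; exists (a * (c * (j == i)%:R)), (dflat q); apply/funext => x.
    apply: partialE; apply: (is_derive_eq (is_deriveZ a (dF q x j))).
    by rewrite -[LHS]/(_ * (_ * _)) mulrA.
by exists 1, p; apply/funext => x; rewrite mul1r.
Qed.

Lemma smooth_prod (I : Type) (r : seq I) (f : I -> 'rV[R]_n -> R) :
  (forall i, smooth (f i)) -> smooth (fun x => \prod_(i <- r) f i x).
Proof.
move=> sf; elim: r => [|i r ih].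
  rewrite (_ : (fun x => _) = fun=> 1); first exact: smooth_cst.
  by apply/funext => x; rewrite big_nil.
rewrite (_ : (fun x => _) = fun x => f i x * \prod_(i <- r) f i x).
  exact: (smoothM (sf i) ih).
by apply/funext => x; rewrite big_cons.
Qed.

(** Nonzero only if every coordinate lies between [1 / (j + 1)] and [1 - 1 / (j + 1)]. At a point of
    the open cube the arguments of [flat 1] tend to infinity with [j], so the product tends to 1. *)
Definition cutoff (j : nat) (x : 'rV[R]_n) : R :=
  \prod_(i < n) (flat 1 (j.+1%:R * x 0 i - 1) * flat 1 (- j.+1%:R * x 0 i + (j.+1%:R - 1))).

Lemma cutoff_smooth j : smooth (cutoff j).
Proof. by apply: smooth_prod => i; apply: smoothM; exact: flat_coord_smooth. Qed.

Lemma cutoff_ge0 j x : 0 <= cutoff j x.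
Proof. by apply: prodr_ge0 => i _; rewrite mulr_ge0// flat1_ge0. Qed.

Lemma cutoff_le1 j x : cutoff j x <= 1.
Proof.
by apply: prodr_ile1 => i _; rewrite mulr_ge0 ?flat1_ge0//= mulr_ile1// ?flat1_ge0// flat1_le1.
Qed.

Lemma inv_between (J x : R) : 0 < J -> 0 < J * x - 1 -> 0 < - J * x + (J - 1) ->
  J^-1 <= x <= 1 - J^-1.
Proof.
move=> J0 h1 h2; apply/andP; split.
  by rewrite -[J^-1]mulr1 ler_pdivrMl// ltW// -subr_gt0.
rewrite lerBrDl -lerBrDr -[J^-1]mulr1 ler_pdivrMl// mulrBr mulr1 -subr_ge0 ltW//.
by apply: (lt_le_trans h2); rewrite le_eqVlt; apply/orP; left; apply/eqP; ring.
Qed.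

Lemma cutoff_support j : closure [set x | cutoff j x != 0] `<=` @cube R n.
Proof.
pose C := [set x : 'rV[R]_n | forall i, j.+1%:R^-1 <= x 0 i <= 1 - j.+1%:R^-1].
have j0 : 0 < j.+1%:R :> R by rewrite ltr0n.
have j1 : 0 < j.+1%:R^-1 :> R by rewrite invr_gt0.
have CE : C = \bigcap_(i in [set: 'I_n]) ((fun x : 'rV[R]_n => x 0 i) @^-1` `[j.+1%:R^-1, 1 - j.+1%:R^-1]).
  apply/seteqP; split => x h i; first by move=> _; rewrite /= in_itv/=.
  by have := h i I; rewrite /= in_itv.
have clC : closed C.
  rewrite CE; apply: closed_bigI => i _; apply: preimage_closed; last exact: itv_closed.
  by move=> x _; exact: coord_continuous.
apply: (@subset_trans _ C); last first.
  by move=> x Cx i; have := Cx i; move: (j.+1%:R^-1 : R) j1 => d d0 /andP[h1 h2]; apply/andP; split; lra.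
rewrite [X in _ `<=` X]((closure_id C).1 clC); apply: closure_subset.
move=> x /= hx i; move: hx; rewrite /cutoff (bigD1 i)//= mulf_eq0 negb_or => /andP[+ _].
rewrite mulf_eq0 negb_or /flat => /andP[].
case: ifPn => [h1 _|]; last by rewrite eqxx.
case: ifPn => [h2 _|]; last by rewrite eqxx.
exact: inv_between.
Qed.

Lemma flat1_cvg (a b : R) : 0 < a -> (fun j : nat => flat 1 (a * j.+1%:R + b)) @ \oo --> (1 : R).
Proof.
move=> a0; apply/cvgrPdist_le => e e0; near=> j.
have hj : e^-1 <= a * j.+1%:R + b.
  have : (e^-1 - b) / a <= j%:R by near: j; exact: nbhs_infty_ger.
  rewrite ler_pdivrMr// -natr1 mulrDr mulr1 => h; move: a0 h; lra.
have y0 : 0 < a * j.+1%:R + b by rewrite (lt_le_trans _ hj)// invr_gt0.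
rewrite ger0_norm ?subr_ge0 ?flat1_le1//.
rewrite /flat y0 hornerE mul1r.
have h1 : (a * j.+1%:R + b)^-1 <= e by rewrite -[leRHS]invrK lef_pV2// ?posrE// invr_gt0.
rewrite lerBlDr -lerBlDl (le_trans _ (expR_ge1Dx _))//.
by rewrite lerD2l lerN2.
Unshelve. all: by end_near. Qed.

Lemma cutoff_cvg x : cube x -> (fun j => cutoff j x) @ \oo --> (1 : R).
Proof.
move=> cx; rewrite -[X in _ --> X](_ : \prod_(i < n) (1 * 1 : R) = 1); last first.
  by rewrite big1// => i _; rewrite mulr1.
rewrite /cutoff; apply: cvg_big; first by move=> [u v]; exact: mul_continuous.
move=> i _; have /andP[x0 x1] := cx i; apply: cvgM.
  rewrite (_ : (fun j => _) = fun j : nat => flat 1 (x 0 i * j.+1%:R + -1)).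
    exact: flat1_cvg.
  by apply/funext => j; rewrite mulrC.
rewrite (_ : (fun j => _) = fun j : nat => flat 1 ((1 - x 0 i) * j.+1%:R + -1)).
  by apply: flat1_cvg; rewrite subr_gt0.
by apply/funext => j; congr (flat 1 _); ring.
Qed.

End bump.

(** * Oscillating fields multiplied by a cutoff *)

Section test_fields.
Context {R : realType} {n : nat}.
Implicit Types (U V : innerProductType R).

Definition bounded_derivatives (chi : 'rV[R]_n -> R) := smooth chi /\
  forall s, exists M : R, forall x, `|pd s chi x| <= M.

Lemma compact_support_bounded (chi : 'rV[R]_n -> R) : smooth chi ->
  closure [set x | chi x != 0] `<=` @cube R n -> bounded_derivatives chi.
Proof.
move=> sc hc; split => // s.
have [M [M0 hM]] := continuous_cube_bounded (smooth_continuous (smooth_pd s sc)).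
exists M => x; have [cx|ncx] := pselect (cube x).
  by apply: hM => i; have /andP[/ltW-> /ltW->] := cx i.
rewrite (@pd_vanish _ _ _ (~` closure [set x | chi x != 0])) ?normr0 ?(ltW M0)//.
- by apply: closed_openC; exact: closed_closure.
- by move=> y /= hy; apply/eqP/negPn/negP => uy; apply: hy; exact: subset_closure.
- by move=> /hc.
Qed.

Lemma bounded_derivatives_partial i chi :
  bounded_derivatives chi -> bounded_derivatives (partial i chi).
Proof.
move=> [sc hc]; split; first exact: smooth_partial.
by move=> s; have [M hM] := hc (s ++ [:: i]); exists M => x; have := hM x; rewrite pd_cat.
Qed.

Lemma wave_le1 (z : 'rV[R]_n) th x : `|wave z th x| <= 1.
Proof. exact: cos_max. Qed.

(** A derivative of the wave gains a factor [N], a derivative of [chi] gains none; all terms but the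
    one that differentiates the wave every time are thus a power of [N] smaller. The induction runs
    over all [chi], since [chi] gets replaced by its derivatives. *)
Lemma pd_cut_wave z s : forall chi, bounded_derivatives chi -> forall th : R,
  exists2 C : R, 0 <= C & forall N : nat, (0 < N)%N -> forall x : 'rV[R]_n,
  `|pd s (fun x => chi x * wave (N%:R *: z) th x) x -
    N%:R ^+ size s * ((\prod_(i <- s) z 0 i) * (chi x * wave (N%:R *: z) (th + pi / 2 *+ size s) x))|
   * N%:R <= C * N%:R ^+ size s.
Proof.
elim/last_ind: s => [|s i ih] chi hchi th.
  exists 0 => // N N0 x; rewrite /= big_nil mulr0n addr0 expr0 !mul1r subrr normr0 mul0r.
  by rewrite mul0r.
have [sc bc] := hchi; have hchi' := bounded_derivatives_partial i hchi.
have [C1 C10 hC1] := ih _ hchi' th.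
have [C2 C20 hC2] := ih _ hchi (th + pi / 2).
have [M hM] := hchi'.2 [::].
set P := \prod_(j <- s) z 0 j in hC1 hC2 *.
have M0 : 0 <= M by rewrite (le_trans _ (hM 0)).
(* If the innermost derivative falls on [chi], its error and its main term are bounded by [C1] and
   [|P| M]; if it falls on the wave, the error is bounded by [|z 0 i| C2]. *)
exists (C1 + `|P| * M + `|z 0 i| * C2); first by rewrite !addr_ge0 ?mulr_ge0.
move=> N N0 x; set w := wave (N%:R *: z).
have sw t : smooth (w t) by exact: wave_smooth.
have N1 : 1 <= N%:R :> R by rewrite ler1n.
have N0' : 0 < N%:R :> R by rewrite ltr0n.
set a := pd s (fun x => partial i chi x * w th x) x.
set b := pd s (fun x => chi x * w (th + pi / 2) x) x.
have -> : pd (rcons s i) (fun x => chi x * w th x) x = a + (N%:R * z 0 i) * b.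
  rewrite -cats1 pd_cat /= (partialM i sc (sw th)) partial_wave.
  have -> : (fun x => partial i chi x * w th x + chi x * ((N%:R *: z) 0 i * wave (N%:R *: z) (th + pi / 2) x)) =
      (fun x => partial i chi x * w th x + (N%:R * z 0 i) *: (chi x * w (th + pi / 2) x)).
    by apply/funext => y; rewrite mxE -[_ *: (_ * _)]/(_ * (_ * _)); congr (_ + _); rewrite mulrCA.
  have s1 := smoothM (smooth_partial i sc) (sw th).
  have s2 := smoothM sc (sw (th + pi / 2)).
  by rewrite (pdD s s1 (smoothZ _ s2)) (pdZ s _ s2).
rewrite size_rcons -cats1 big_cat big_seq1 /= -/P.
have -> : th + pi / 2 *+ (size s).+1 = th + pi / 2 + pi / 2 *+ size s.
  by rewrite [pi / 2 *+ _.+1]mulrS addrA.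
have h1 := hC1 N N0 x; have h2 := hC2 N N0 x.
rewrite -/w -/a in h1; rewrite -/w -/b in h2.
set X := w (th + pi / 2 + pi / 2 *+ size s) x in h2 *.
set Y := w (th + pi / 2 *+ size s) x in h1.
set K := N%:R ^+ size s in h1 h2 *.
have K0 : 0 <= K by rewrite exprn_ge0.
rewrite exprS -/K.
have -> : a + N%:R * z 0 i * b - N%:R * K * (P * z 0 i * (chi x * X)) =
  a + N%:R * z 0 i * (b - K * (P * (chi x * X))) by ring.
have ha : `|a| * N%:R <= (C1 + `|P| * M) * (N%:R * K).
  have ha1 : `|a| <= `|a - K * (P * (partial i chi x * Y))| + K * (`|P| * M).
    rewrite -{1}(subrK (K * (P * (partial i chi x * Y))) a) (le_trans (ler_normD _ _))// lerD2l.
    rewrite normrM ger0_norm// ler_wpM2l// normrM ler_wpM2l// normrM.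
    by rewrite -[M]mulr1 ler_pM//; [exact: hM|exact: wave_le1].
  rewrite (le_trans (ler_wpM2r (ltW N0') ha1))// mulrDl mulrDl lerD//.
    by rewrite (le_trans h1)// ler_wpM2l// ler_peMl.
  by rewrite [leLHS](_ : _ = `|P| * M * (N%:R * K))//; ring.
rewrite (le_trans (ler_wpM2r (ltW N0') (ler_normD _ _)))// mulrDl [leRHS]mulrDl lerD//.
rewrite !normrM (ger0_norm (ltW N0')).
rewrite [leLHS](_ : _ = N%:R * `|z 0 i| * (`|b - K * (P * (chi x * X))| * N%:R)); last by ring.
rewrite (le_trans (ler_wpM2l (mulr_ge0 (ltW N0') (normr_ge0 _)) h2))//.
by rewrite [leLHS](_ : _ = `|z 0 i| * C2 * (N%:R * K))//; ring.
Qed.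

Variables (U V : innerProductType R) (l : nat) (B : diff_op n l U V).

(* With [v = vtrig t], this is [chi x * N^-l v (N x)]: as N grows, derivatives
   falling on [chi] become negligible in order l. *)
Definition cut_field (chi : 'rV[R]_n -> R) (N : nat) (t : seq ('rV[int]_n * R * U)) x : U :=
  \sum_(p <- t) (N%:R ^- l * (chi x * wave (N%:R *: freq p.1.1) p.1.2 x)) *: p.2.

Lemma cut_field_smooth chi N t : smooth chi -> smooth (cut_field chi N t).
Proof.
move=> sc; apply: smooth_sum => p; apply: smooth_scale; apply: (@smoothZ _ _ R).
exact: (smoothM sc (wave_smooth _ _)).
Qed.

Lemma cut_field_op chi t : bounded_derivatives chi -> exists2 C : R, 0 <= C &
  forall N, (0 < N)%N -> forall x,
  `|op_apply B (cut_field chi N t) x - chi x *: op_apply B (vtrig t) (N%:R *: x)| <= C / N%:R.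
Proof.
move=> hchi; have [sc _] := hchi.
elim: t => [|p t [C C0 ih]].
  exists 0 => // N N0 x; rewrite mul0r normr_le0 subr_eq0; apply/eqP.
  have op0 (f : 'rV[R]_n -> U) y : (f = fun=> 0) -> op_apply B f y = 0.
    by move=> ->; rewrite op_applyE big1// => a _; rewrite pd_cst0 linear0.
  rewrite !op0 ?scaler0//; apply/funext => y; first by rewrite /vtrig big_nil.
  by rewrite /cut_field big_nil.
pose z : 'rV[R]_n := freq p.1.1.
have cex (a : multi_index n l) : exists c : R, 0 <= c /\
    forall N : nat, (0 < N)%N -> forall x : 'rV[R]_n,
    `|pd (mi_seq a) (fun x => chi x * wave (N%:R *: z) p.1.2 x) x -
    N%:R ^+ size (mi_seq a) * ((\prod_(i <- mi_seq a) z 0 i) *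
      (chi x * wave (N%:R *: z) (p.1.2 + pi / 2 *+ size (mi_seq a)) x))|
   * N%:R <= c * N%:R ^+ size (mi_seq a).
  by have [c c0 hc] := pd_cut_wave z (mi_seq a) hchi p.1.2; exists c.
have [c cP] := choice cex.
exists (C + \sum_(a : multi_index n l | mi_order a == l) c a * `|B a p.2|).
  by rewrite addr_ge0// sumr_ge0// => a _; rewrite mulr_ge0//; have [] := cP a.
move=> N N0 x; have N0' : 0 < N%:R :> R by rewrite ltr0n.
pose g x := chi x * wave (N%:R *: z) p.1.2 x.
have sg : smooth g by exact: (smoothM sc (wave_smooth _ _)).
have sg' : smooth (fun x => N%:R ^- l *: g x) by exact: (smoothZ _ sg).
have -> : cut_field chi N (p :: t) = fun x => (N%:R ^- l *: g x) *: p.2 + cut_field chi N t x.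
  by apply/funext => y; rewrite [LHS]/cut_field big_cons.
have -> : vtrig (p :: t) = fun x => wave z p.1.2 x *: p.2 + vtrig t x.
  by apply/funext => y; rewrite [LHS]/vtrig big_cons.
rewrite (op_applyD B x (smooth_scale p.2 sg') (cut_field_smooth N t sc)).
rewrite (op_applyD B _ (smooth_scale p.2 (wave_smooth z p.1.2)) (vtrig_smooth t)).
rewrite op_apply_wave scalerDr opprD addrACA addrC [leRHS]mulrDl.
rewrite (le_trans (ler_normD _ _))// lerD ?ih//.
rewrite op_applyE /symbol sum_lfunE !scaler_sumr -sumrB (le_trans (ler_norm_sum _ _ _))//.
rewrite mulr_suml; apply: ler_sum => a /eqP al.
rewrite (pd_scale (mi_seq a) p.2 sg') (pdZ (mi_seq a) _ sg) homZ scale_lfunE !scalerA -scalerBl normrZ [leRHS]mulrAC ler_wpM2r//.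
have := (cP a).2 N N0 x; rewrite size_mi_seq al prod_mi_seq -/g => h.
rewrite ler_pdivlMr// -(ler_pM2r (exprn_gt0 l N0')).
apply: le_trans h; rewrite mulrAC ler_wpM2r ?(ltW N0')//.
rewrite -[X in _ * X](ger0_norm (exprn_ge0 l (ltW N0'))) -normrM.
rewrite le_eqVlt; apply/orP; left; apply/eqP; congr (`|_|).
have wE : wave z (p.1.2 + pi / 2 *+ l) (N%:R *: x) = wave (N%:R *: z) (p.1.2 + pi / 2 *+ l) x.
  by rewrite /wave dotpZ dotpZl.
rewrite wE mulrBl -[N%:R ^- l *: _]/(_ * _) mulrAC mulVf ?mul1r ?expf_neq0 ?gt_eqF//.
by congr (_ - _); ring.
Qed.

Lemma cut_field_test chi N t : smooth chi -> closure [set x | chi x != 0] `<=` @cube R n ->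
  test_field (cut_field chi N t).
Proof.
move=> sc hc; split; first exact: cut_field_smooth.
apply: subset_trans hc; apply: closure_subset => x /=; apply: contra => /eqP c0.
by rewrite /cut_field big1// => p _; rewrite c0 mul0r mulr0 scale0r.
Qed.

End test_fields.

(** * From compactly supported to periodic fields *)

Section tiling.
Context {R : realType} {n : nat}.

Lemma comp_shift_continuous (T : topologicalType) (V : innerProductType R) (F : V -> R) z
    (f : T -> V) : continuous F -> continuous f -> continuous (fun x => F (z + f x)).
Proof.
move=> cF cf; have c1 : continuous (fun x => z + f x).
  by apply: addf_continuous => //; exact: cst_continuous.
exact: (comp_continuous c1 cF).
Qed.

Lemma half_bound (a b c e : R) : 0 <= c -> 2 * (b + 1) * c <= a * e -> b * c <= e / 2 * a.
Proof. by nra. Qed.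

Lemma half_bound2 (b m e : R) : 0 <= b -> 0 <= m -> 0 <= e ->
  b * m * e <= e / 2 * (2 * (b + 1) * (m + 1)).
Proof.
move=> b0 m0 e0; have : 0 <= (b + m + 1) * e by rewrite mulr_ge0// !addr_ge0.
by nra.
Qed.

Lemma periodic_shift (V : innerProductType R) (f : 'rV[R]_n -> V) (m : 'I_n -> nat) y :
  Defs.periodic f -> f (y + \row_i (m i)%:R) = f y.
Proof.
move=> pf; have shift1 i k x : f (x + k%:R *: delta_mx 0 i) = f x.
  elim: k => [|k ih]; first by rewrite scale0r addr0.
  by rewrite -natr1 scalerDl scale1r addrA pf.
have -> : \row_i (m i)%:R = \sum_i ((m i)%:R : R) *: delta_mx 0 i :> 'rV[R]_n.
  apply/rowP => j; rewrite mxE summxE (bigD1 j)//= !mxE !eqxx mulr1 big1 ?addr0// => i ij.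
  by rewrite !mxE eq_sym (negbTE ij) andbF mulr0.
by elim/big_rec : _ => [|i x _ ih]; rewrite ?addr0// addrCA addrC shift1.
Qed.

Lemma scale_cell N (m : {ffun 'I_n -> 'I_N}) (y : 'rV[R]_n) : (0 < N)%N ->
  N%:R *: cell m y = y + \row_i (m i)%:R.
Proof.
move=> N0; apply/rowP => i; rewrite !mxE mulrA mulfV ?mul1r; first by rewrite addrC.
by rewrite pnatr_eq0 -lt0n.
Qed.

Lemma cube_integral_mean_const N (c : R) : (0 < N)%N ->
  (N%:R^-1 ^+ n * \sum_(m : {ffun 'I_n -> 'I_N}) c) = c.
Proof.
move=> N0; rewrite sumr_const card_ffun !card_ord -[c *+ _]mulr_natr natrX.
rewrite mulrCA -exprMn mulVf ?expr1n ?mulr1//.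
by rewrite pnatr_eq0 -lt0n.
Qed.

Lemma cube_integral_periodic (V : innerProductType R) (F : V -> R) (f : 'rV[R]_n -> V) N :
  (0 < N)%N -> continuous F -> continuous f -> Defs.periodic f ->
  cube_integral (fun x => F (f (N%:R *: x))) = cube_integral (fun x => F (f x)).
Proof.
move=> N0 cF cf pf.
have c1 : continuous (fun x : 'rV[R]_n => N%:R *: x + 0) by exact: affine_continuous.
have c2 : continuous (fun x : 'rV[R]_n => F (f (N%:R *: x))).
  have -> : (fun x : 'rV[R]_n => F (f (N%:R *: x))) = (fun x => F (f (N%:R *: x + 0))).
    by apply/funext => x; rewrite addr0.
  exact: (comp_continuous (comp_continuous c1 cf) cF).
rewrite (cube_integral_tile N0 c2).
rewrite (eq_bigr (fun=> cube_integral (fun x => F (f x)))) ?cube_integral_mean_const//.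
move=> m _; apply: cube_integral_ext => y; rewrite scale_cell//.
by rewrite (periodic_shift (fun i => m i)).
Qed.

Variables (U V W : innerProductType R) (l : nat) (B : diff_op n l U V).

Definition lipschitz_with (F : V -> R) (L : R) := forall y y', `|F y - F y'| <= L * `|y - y'|.

Lemma lipschitz_with_continuous F L : lipschitz_with F L -> continuous F.
Proof.
move=> hF x; apply/cvgrPdist_le => e e0.
have L0 : 0 < `|L| + 1 by rewrite ltr_wpDl.
near=> y; rewrite (le_trans (hF _ _))//.
have h : `|x - y| <= e / (`|L| + 1) by near: y; apply: cvgr_dist_le => //; exact: divr_gt0.
rewrite (le_trans (ler_wpM2r (normr_ge0 _) (ler_norm L)))//.
rewrite (le_trans (ler_wpM2l (normr_ge0 L) h))// mulrCA ler_piMr ?(ltW e0)//.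
by rewrite ler_pdivrMr// mul1r lerDl.
Unshelve. all: by end_near. Qed.

Lemma op_vtrig (t : seq ('rV[int]_n * R * U)) : exists s : seq ('rV[int]_n * R * V),
  op_apply B (vtrig t) = vtrig s.
Proof.
exists [seq (p.1.1, p.1.2 + pi / 2 *+ l, symbol B (freq p.1.1) p.2) | p <- t].
apply/funext => x; rewrite op_apply_sum => [|p]; last first.
  by apply: smooth_scale; exact: wave_smooth.
by rewrite /vtrig big_map; apply: eq_bigr => p _; rewrite op_apply_wave.
Qed.

Lemma vtrig_bounded (s : seq ('rV[int]_n * R * V)) : exists2 M : R, 0 <= M & forall x, `|vtrig s x| <= M.
Proof.
exists (\sum_(p <- s) `|p.2|); first by rewrite sumr_ge0.
move=> x; rewrite (le_trans (ler_norm_sum _ _ _))// ler_sum// => p _.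
by rewrite normrZ ler_piMl// wave_le1.
Qed.

(** The field [B v], with [v] periodic, is imitated by the test field [cutoff j] times
    [N^-l v(N x)]. By periodicity the integral of [G (z + B v (N x))] does not depend on [N], and
    since [G] is Lipschitz the replacement costs a term of order [1 / N] and one proportional to the
    integral of [1 - cutoff j]. *)
Lemma lipschitz_trig_of_test (G : V -> R) (L : R) : lipschitz_with G L ->
  (forall z (u : 'rV[R]_n -> U), test_field u -> G z <= cube_integral (fun x => G (z + op_apply B u x))) ->
  forall z t, G z <= cube_integral (fun x => G (z + op_apply B (vtrig t) x)).
Proof.
move=> lG hG z t; have cG := lipschitz_with_continuous lG.
have [s sE] := op_vtrig t; rewrite sE.
have [M M0 hM] := vtrig_bounded s.
have cs : continuous (vtrig s) by exact: smooth_continuous (vtrig_smooth s).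
have L0 : 0 <= `|L| by [].
have lG' y y' : `|G y - G y'| <= `|L| * `|y - y'|.
  by rewrite (le_trans (lG _ _))// ler_wpM2r// ler_norm.
set I := cube_integral _.
have step j N : (0 < N)%N -> exists2 C : R, 0 <= C & forall N, (0 < N)%N ->
    G z <= I + `|L| * (C / N%:R + M * cube_integral (fun x : 'rV[R]_n => 1 - cutoff j x)).
  move=> _.
  have bc := compact_support_bounded (cutoff_smooth j) (@cutoff_support R n j).
  have cc : continuous (@cutoff R n j) by exact: smooth_continuous (cutoff_smooth j).
  have [C C0 hC] := cut_field_op B t bc; exists C => // {}N N0.
  set u := cut_field l (cutoff j) N t.
  have tu : test_field u by apply: cut_field_test; [exact: cutoff_smooth|exact: cutoff_support].
  have cu : continuous (op_apply B u) by exact: op_apply_continuous tu.1.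
  have c1c : continuous (fun x : 'rV[R]_n => 1 - cutoff j x).
    have -> : (fun x : 'rV[R]_n => 1 - cutoff j x) = (fun x => 1 + -1 * cutoff j x).
      by apply/funext => x; rewrite mulN1r.
    by apply: addf_continuous; [exact: cst_continuous|exact: mulc_continuous].
  have c1 : continuous (fun x : 'rV[R]_n => G (z + op_apply B u x)).
    exact: comp_shift_continuous.
  have cG2 : continuous (fun y : V => G (z + y)).
    by apply: (@comp_shift_continuous _ _ _ _ id) => //; move=> y; exact: cvg_id.
  have caff : continuous (fun x : 'rV[R]_n => N%:R *: x + 0) by exact: affine_continuous.
  have c2 : continuous (fun x : 'rV[R]_n => G (z + vtrig s (N%:R *: x))).
    have -> : (fun x : 'rV[R]_n => G (z + vtrig s (N%:R *: x))) = (fun x => G (z + vtrig s (N%:R *: x + 0))).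
      by apply/funext => x; rewrite addr0.
    exact: (comp_continuous (comp_continuous caff cs) cG2).
  have c3 : continuous (fun x : 'rV[R]_n => `|L| * (C / N%:R + M * (1 - cutoff j x))).
    apply: mulc_continuous; apply: addf_continuous; first exact: cst_continuous.
    exact: mulc_continuous.
  have E : I + `|L| * (C / N%:R + M * cube_integral (fun x : 'rV[R]_n => 1 - cutoff j x)) =
     cube_integral (fun x => G (z + vtrig s (N%:R *: x)) + `|L| * (C / N%:R + M * (1 - cutoff j x))).
    have cM : continuous (fun x : 'rV[R]_n => M * (1 - cutoff j x)) by exact: mulc_continuous.
    have cCM : continuous (fun x : 'rV[R]_n => C / N%:R + M * (1 - cutoff j x)).
      by apply: addf_continuous => //; exact: cst_continuous.
    rewrite (cube_integralD c2 c3) (cube_integralZ _ cCM).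
    have cC : continuous (fun _ : 'rV[R]_n => C / N%:R) by exact: cst_continuous.
    rewrite (cube_integralD cC cM) cube_integral_cst (cube_integralZ _ c1c).
    congr (_ + _); rewrite /I; symmetry.
    exact: (cube_integral_periodic N0 cG2 cs (vtrig_per s)).
  rewrite (le_trans (hG z u tu))// E; apply: le_cube_integral => //.
    exact: addf_continuous.
  move=> x _; rewrite -lerBlDl (le_trans (ler_norm _))// (le_trans (lG' _ _))// ler_wpM2l//.
  rewrite opprD addrACA subrr add0r.
  have -> : op_apply B u x - vtrig s (N%:R *: x) =
      (op_apply B u x - cutoff j x *: vtrig s (N%:R *: x)) + - ((1 - cutoff j x) *: vtrig s (N%:R *: x)).
    by rewrite scalerBl scale1r opprB addrA subrK.
  rewrite (le_trans (ler_normD _ _))// lerD//; first by rewrite -sE hC.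
  rewrite normrN normrZ mulrC ler_pM// ger0_norm ?subr_ge0 ?cutoff_le1//.
have ccv : (fun j => cube_integral (fun x : 'rV[R]_n => 1 - cutoff j x)) @ \oo --> (0 : R).
  rewrite -[X in _ --> X](@cube_integral_cst R n 0); apply: (cube_integral_cvg (M := 1)).
  - move=> j; have cc : continuous (@cutoff R n j) by exact: smooth_continuous (cutoff_smooth j).
    have -> : (fun x : 'rV[R]_n => 1 - cutoff j x) = (fun x => 1 + -1 * cutoff j x).
      by apply/funext => x; rewrite mulN1r.
    by apply: addf_continuous; [exact: cst_continuous|exact: mulc_continuous].
  - exact: cst_continuous.
  - move=> j x _; rewrite ger0_norm ?subr_ge0 ?cutoff_le1//.
    by rewrite lerBlDr lerDl cutoff_ge0.
  - move=> x cx; rewrite -(subrr (1 : R)); apply: cvgB; first exact: cvg_cst.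
    exact: cutoff_cvg.
apply/ler_addgt0Pr => e e0.
have e1 : 0 < e / (2 * (`|L| + 1) * (M + 1)).
  by rewrite divr_gt0// !mulr_gt0// ltr_wpDl.
(* [j] is fixed before [N], because the constant [C] depends on the cutoff. *)
have /cvgrPdist_le/(_ _ e1)[j _ hj] := ccv.
have := hj j (leqnn j); rewrite /= sub0r normrN => {}hj.
have [C C0 hC] := step j 1%N isT.
have [N hN] : exists N : nat, 2 * (`|L| + 1) * C / e <= N.+1%:R.
  have : 0 <= 2 * (`|L| + 1) * C / e by rewrite divr_ge0 ?(ltW e0)// !mulr_ge0 ?addr_ge0.
  move=> /truncn_itv/andP[_ h]; exists (Num.truncn (2 * (`|L| + 1) * C / e)).
  exact: ltW.
rewrite (le_trans (hC N.+1 isT))// lerD2l.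
have N0 : 0 < N.+1%:R :> R by rewrite ltr0n.
have h1 : `|L| * (C / N.+1%:R) <= e / 2.
  rewrite mulrA ler_pdivrMr//.
  move: hN; rewrite ler_pdivrMr// => hN; exact: half_bound C0 hN.
have h2 : `|L| * (M * cube_integral (fun x : 'rV[R]_n => 1 - cutoff j x)) <= e / 2.
  have h := le_trans (ler_norm _) hj.
  have h3 : `|L| * M * cube_integral (fun x : 'rV[R]_n => 1 - cutoff j x) <= `|L| * M * (e / (2 * (`|L| + 1) * (M + 1))).
    by rewrite ler_wpM2l// mulr_ge0.
  rewrite mulrA (le_trans h3)// mulrA ler_pdivrMr ?mulr_gt0 ?ltr_wpDl//.
  exact: half_bound2 (ltW e0).
by rewrite mulrDr [leRHS]splitr lerD.
Qed.

End tiling.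

Section uniform_continuity.
Context {R : realType}.

(** Only [x] is confined to [K], so the estimate also reaches neighbours just outside the compact
    set. *)
Lemma compact_uniformly_continuous (T V : normedModType R) (K : set T) (f : T -> V) (e : R) :
  compact K -> continuous f -> 0 < e ->
  exists2 d : R, 0 < d & forall x y, K x -> `|x - y| < d -> `|f x - f y| <= e.
Proof.
move=> /compact_near_coveringP cK cf e0.
have := cK R (0^'+) (fun d x => forall y, `|x - y| < d -> `|f x - f y| <= e).
have H : forall x, K x -> \forall x' \near x & d \near (0:R)^'+, forall y, `|x' - y| < d -> `|f x' - f y| <= e.
  move=> x _.
  have /cvgrPdist_le/(_ (e / 2) (divr_gt0 e0 (ltr0Sn R 1)))/nbhs_ballP[r /= r0 hr] := cf x.
  exists (ball x (r / 2), [set d | 0 < d < r / 2]).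
    split => /=; first by apply: nbhsx_ballx; exact: divr_gt0.
    by near=> d; apply/andP; split; near: d; [exact: nbhs_right_gt|apply: nbhs_right_lt; exact: divr_gt0].
  move=> [x' d] /= [bx' /andP[d0 dr]] y xy.
  have h1 : `|f x - f x'| <= e / 2.
    by apply: hr; apply: le_ball bx'; rewrite ler_pdivrMr// ler_peMr ?(ltW r0)// ler1n.
  have h2 : `|f x - f y| <= e / 2.
    apply: hr; rewrite -ball_normE /= -(subrKA x') (le_lt_trans (ler_normD _ _))//.
    rewrite (splitr r) ltrD// ?(lt_trans xy)//.
    by move: bx'; rewrite -ball_normE.
  rewrite -(subrKA (f x)) (le_trans (ler_normD _ _))// (splitr e) lerD//.
  by rewrite distrC.
move=> /(_ _ H) => hn.
have [d [d0 hd]] : exists d : R, 0 < d /\ K `<=` (fun x => forall y, `|x - y| < d -> `|f x - f y| <= e).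
  have : \forall d \near (0:R)^'+, 0 < d /\ K `<=` (fun x => forall y, `|x - y| < d -> `|f x - f y| <= e).
    by near=> d; split; near: d; [exact: nbhs_right_gt|exact: hn].
  by move=> /filter_ex.
by exists d => // x y Kx; exact: hd.
Unshelve. all: by end_near. Qed.

End uniform_continuity.

(** * Different test fields on the cells of a grid *)

Section tile_fields.
Context {R : realType} {n : nat}.
Variables (U V W : innerProductType R) (l : nat) (B : diff_op n l U V).

Lemma test_field0 : test_field (fun _ : 'rV[R]_n => 0 : U).
Proof.
split; first exact: smooth_cst.
have -> : [set x : 'rV[R]_n | (fun=> 0 : U) x != 0] = set0.
  by apply/seteqP; split => x //=; rewrite eqxx.
by rewrite closure0.
Qed.

Lemma op_apply0 x : op_apply B (fun _ : 'rV[R]_n => 0 : U) x = 0.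
Proof. by rewrite op_applyE big1// => a _; rewrite pd_cst0 linear0. Qed.

Section tile.
Variables (N : nat) (u_ : {ffun 'I_n -> 'I_N} -> 'rV[R]_n -> U).
Hypothesis N_gt0 : (0 < N)%N.
Hypothesis u_test : forall m, test_field (u_ m).

Let off (m : {ffun 'I_n -> 'I_N}) : 'rV[R]_n := - \row_i (m i)%:R.

(* The scaling [N^-l] leaves derivatives of order l unchanged on each cell. *)
Definition tile (x : 'rV[R]_n) : U := N%:R ^- l *: \sum_m u_ m (N%:R *: x + off m).

Let sm m : smooth (fun x => u_ m (N%:R *: x + off m)).
Proof. exact: smooth_affine (u_test m).1. Qed.

Lemma tile_smooth : smooth tile.
Proof. by apply: smoothZ; exact: smooth_sum. Qed.

Lemma tile_pd s x : pd s tile x =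
  (N%:R ^- l * N%:R ^+ size s) *: \sum_m pd s (u_ m) (N%:R *: x + off m).
Proof.
rewrite (pdZ s _ (smooth_sum _ _ sm)) (pd_sum _ _ _ sm) -scalerA.
congr (_ *: _); rewrite scaler_sumr; apply: eq_bigr => m _.
by rewrite (pd_affine _ _ _ (u_test m).1).
Qed.

Lemma off_cell m m' (y : 'rV[R]_n) : cube y -> m' != m -> ~ cube (N%:R *: cell m y + off m').
Proof.
move=> cy mm' h; have [i mi] : exists i, m' i != m i.
  apply/existsP; rewrite -negb_forall; apply: contraNN mm' => /forallP e.
  by apply/eqP/ffunP => i; apply/eqP.
have /andP[] := h i; have /andP[] := cy i; rewrite scale_cell// !mxE.
case: (ltngtP (m i) (m' i)) => hm; last by move/eqP: mi => []; apply/val_inj.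
  have : (m i).+1%:R <= (m' i)%:R :> R by rewrite ler_nat.
  rewrite -natr1; lra.
have : (m' i).+1%:R <= (m i)%:R :> R by rewrite ler_nat.
rewrite -natr1; lra.
Qed.

Lemma tile_pd_cell s m y : cube y ->
  pd s tile (cell m y) = (N%:R ^- l * N%:R ^+ size s) *: pd s (u_ m) y.
Proof.
move=> cy; rewrite tile_pd (bigD1 m)//= big1 => [|m' mm']; last first.
  by rewrite (test_field_out _ (u_test m'))//; exact: off_cell.
by rewrite addr0 scale_cell// addrK.
Qed.

Lemma tile_op_cell m y : cube y -> op_apply B tile (cell m y) = op_apply B (u_ m) y.
Proof.
move=> cy; rewrite !op_applyE; apply: eq_bigr => a /eqP al.
rewrite tile_pd_cell// size_mi_seq al mulVf ?scale1r//.
by rewrite expf_neq0// pnatr_eq0 -lt0n.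
Qed.

Lemma tile_test : test_field tile.
Proof.
split; first exact: tile_smooth.
pose C := \bigcup_(m in [set: {ffun 'I_n -> 'I_N}])
   ((fun x => N%:R *: x + off m) @^-1` closure [set x | u_ m x != 0]).
have clC : closed C.
  apply: closed_bigcup; first exact: finite_finset.
  move=> m _; apply: preimage_closed; last exact: closed_closure.
  by move=> x _; exact: affine_continuous.
apply: (@subset_trans _ C).
  rewrite [X in _ `<=` X]((closure_id C).1 clC); apply: closure_subset => x /=.
  apply: contraNP => nC; apply/eqP; rewrite /tile big1 ?scaler0// => m _.
  by apply/eqP/negPn/negP => um; apply: nC; exists m => //=; exact: subset_closure.
move=> x [m _ /= hx] i; have /(_ i) := (u_test m).2 _ hx; rewrite !mxE.
have N0' : 0 < N%:R :> R by rewrite ltr0n.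
have m0 : 0 <= (m i)%:R :> R by rewrite ler0n.
have m1 : (m i).+1%:R <= N%:R :> R by rewrite ler_nat.
rewrite -natr1 in m1; move=> /andP[h1 h2]; apply/andP; split.
  by rewrite -(ltr_pM2l N0') mulr0; lra.
by rewrite -(ltr_pM2l N0') mulr1; lra.
Qed.

End tile.

Lemma tile_integral N (u_ : {ffun 'I_n -> 'I_N} -> 'rV[R]_n -> U) (F : V -> R)
    (f : 'rV[R]_n -> V) :
  (0 < N)%N -> (forall m, test_field (u_ m)) -> continuous F -> continuous f ->
  cube_integral (fun x => F (f x + op_apply B (tile u_) x)) =
  N%:R^-1 ^+ n * \sum_m cube_integral (fun y => F (f (cell m y) + op_apply B (u_ m) y)).
Proof.
move=> N0 tu cF cf.
have ct := op_apply_continuous (B := B) (tile_smooth tu).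
have cft : continuous (fun x => F (f x + op_apply B (tile u_) x)).
  exact: (comp_continuous (addf_continuous cf ct) cF).
rewrite (cube_integral_tile N0 cft); congr (_ * _); apply: eq_bigr => m _.
have ccell : continuous (@cell R n N m) by exact: cell_continuous.
apply: eq_cube_integral.
- exact: (comp_continuous ccell cft).
- have cu := op_apply_continuous (B := B) (tu m).1.
  exact: (comp_continuous (addf_continuous (comp_continuous ccell cf) cu) cF).
- by move=> y cy; rewrite (tile_op_cell N0).
Qed.

End tile_fields.

(** * Quasiconvex envelopes *)

Lemma quarter_bound (R : realType) (b e : R) : 0 <= e -> b * e <= e / 4 * (4 * (b + 1)).
Proof. by nra. Qed.

Section envelope.
Context {R : realType} {n : nat}.
Variables (U V W : innerProductType R) (l : nat) (B : diff_op n l U V).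
Implicit Types (F : V -> R) (z : V).

Definition field_integral F z (u : 'rV[R]_n -> U) : R :=
  cube_integral (fun x => F (z + op_apply B u x)).

Definition field_values F z : set R := [set field_integral F z u | u in @test_field R n U].

(** The infimum is taken in the reals and is a default value if the set is not bounded below; hence
    the hypotheses [has_lbound] from here on. *)
Definition envelope F z : R := inf (field_values F z).

Lemma field_integral0 F z : field_integral F z (fun=> 0) = F z.
Proof.
rewrite /field_integral (@cube_integral_ext _ _ _ (fun=> F z)) ?cube_integral_cst// => x.
by rewrite op_apply0 addr0.
Qed.

Lemma field_continuous F z u : continuous F -> test_field u ->
  continuous (fun x => F (z + op_apply B u x)).
Proof. by move=> cF tu; apply: comp_shift_continuous => //; exact: op_apply_continuous tu.1. Qed.

Lemma field_values_neq0 F z : field_values F z !=set0.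
Proof. by exists (F z); exists (fun=> 0); [exact: test_field0|exact: field_integral0]. Qed.

Lemma envelope_ge F z c : (forall u, test_field u -> c <= field_integral F z u) -> c <= envelope F z.
Proof.
move=> hc; apply: lb_le_inf; first exact: field_values_neq0.
by move=> _ [u tu <-]; exact: hc.
Qed.

Section lipschitz.
Variables (F : V -> R) (L : R).
Hypothesis lF : lipschitz_with F L.

Let cF : continuous F. Proof. exact: lipschitz_with_continuous lF. Qed.

Lemma field_integral_lipschitz u z z' : test_field u ->
  field_integral F z u <= field_integral F z' u + L * `|z - z'|.
Proof.
move=> tu; rewrite -[X in _ + X](@cube_integral_cst R n).
have c1 : continuous (fun _ : 'rV[R]_n => L * `|z - z'|) by exact: cst_continuous.
rewrite /field_integral -(cube_integralD (field_continuous (z := z') cF tu) c1).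
apply: le_cube_integral.
- exact: field_continuous.
- exact: (addf_continuous (field_continuous (z := z') cF tu) c1).
move=> x _; rewrite -lerBlDl (le_trans (ler_norm _))// (le_trans (lF _ _))//.
by rewrite opprD addrACA subrr addr0.
Qed.

Variable z0 : V.
Hypothesis lb0 : has_lbound (field_values F z0).

(** Moving the base point changes every field integral by at most [L] times the displacement, so a
    lower bound at one point gives lower bounds at all points. *)
Lemma field_values_lbound z : has_lbound (field_values F z).
Proof.
have [c hc] := lb0; exists (c - L * `|z0 - z|) => _ [u tu <-].
rewrite lerBlDr (le_trans _ (field_integral_lipschitz z0 z tu))//.
by apply: hc; exists u.
Qed.

Lemma envelope_le z u : test_field u -> envelope F z <= field_integral F z u.
Proof. by move=> tu; apply: ge_inf; [exact: field_values_lbound|exists u]. Qed.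

Lemma envelope_le_self z : envelope F z <= F z.
Proof. by rewrite -[leRHS]field_integral0; apply: envelope_le; exact: test_field0. Qed.

Lemma envelope_adherent z e : 0 < e -> exists2 u, test_field u & field_integral F z u < envelope F z + e.
Proof.
move=> e0; have [||_ [u tu <-] hu] := @inf_adherent R (field_values F z) e => //.
  by split; [exact: field_values_neq0|exact: field_values_lbound].
by exists u.
Qed.

Lemma envelope_lipschitz : lipschitz_with (envelope F) L.
Proof.
have H z z' : envelope F z <= envelope F z' + L * `|z - z'|.
  rewrite -lerBlDr; apply: envelope_ge => u tu; rewrite lerBlDr.
  by rewrite (le_trans (envelope_le z tu))// field_integral_lipschitz.
move=> z z'; rewrite ler_norml; apply/andP; split.
  by rewrite lerNl opprB lerBlDl distrC H.
by rewrite lerBlDl H.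
Qed.

(* Near-optimal fields for the values of [B u] at the corners of a fine grid are
   tiled into its cells. *)
Lemma envelope_test z u : test_field u ->
  envelope F z <= cube_integral (fun x => envelope F (z + op_apply B u x)).
Proof.
move=> tu; apply/ler_addgt0Pr => e e0.
set f := op_apply B u; have cf : continuous f by exact: op_apply_continuous tu.1.
have L0 : 0 <= `|L| by [].
have lF' y y' : `|F y - F y'| <= `|L| * `|y - y'|.
  by rewrite (le_trans (lF _ _))// ler_wpM2r// ler_norm.
have lE' y y' : `|envelope F y - envelope F y'| <= `|L| * `|y - y'|.
  by rewrite (le_trans (envelope_lipschitz _ _))// ler_wpM2r// ler_norm.
(* [d] is the oscillation of [f] allowed on a cell. Replacing [f] by its value at the corner costs
   [e / 4] in the integral of [F] and [e / 4] in that of the envelope; the near-optimal fields cost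
   another [e / 4]. *)
pose d := e / (4 * (`|L| + 1)).
have d0 : 0 < d by rewrite divr_gt0// mulr_gt0// ltr_wpDl.
have Ld : `|L| * d <= e / 4.
  by rewrite /d mulrA ler_pdivrMr ?mulr_gt0 ?ltr_wpDl//; exact: quarter_bound (ltW e0).
have cK : compact [set v : 'rV[R]_n | forall i, v ord0 i \in `[(0 : R), 1]].
  apply: (@rV_compact _  _ (fun=> `[(0 : R), 1]%classic)).
  by move=> _; apply: segment_compact.
have [r r0 hr] := compact_uniformly_continuous cK cf d0.
have [k kr] : exists k : nat, k.+1%:R^-1 < r.
  by have /ltr_add_invr[k] := r0; rewrite add0r; exists k.
pose N := k.+1.
have osc m y : cube y -> `|f (@cell R n N m 0) - f (cell m y)| <= d.
  move=> cy; apply: hr => [i|].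
    rewrite in_itv /= mxE mxE addr0 mulr_ge0//= ler_pdivrMl// mulr1 ler_nat.
    exact: ltnW.
  rewrite [cell m y]cellE opprD addrCA subrr addr0 normrN normrZ ger0_norm ?invr_ge0//.
  rewrite (le_lt_trans _ kr)// ler_piMr ?invr_ge0//.
  rewrite [leLHS]/Num.norm /= mx_normrE; apply/bigmax_leP; split => // -[a b] _ /=.
  by rewrite ord1; have /andP[y0 y1] := cy b; rewrite ger0_norm ?ltW.
have u_ m : {v | test_field v & field_integral F (z + f (@cell R n N m 0)) v < envelope F (z + f (cell m 0)) + e / 4}.
  by apply: cid2; apply: envelope_adherent; rewrite divr_gt0.
pose v m := s2val (u_ m).
have tv m : test_field (v m) by exact: (s2valP (u_ m)).
have hv m : field_integral F (z + f (@cell R n N m 0)) (v m) < envelope F (z + f (cell m 0)) + e / 4.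
  exact: (s2valP' (u_ m)).
pose w x := u x + tile l v x.
have tt : test_field (tile l v) by exact: tile_test.
have tw : test_field w.
  split; first exact: smoothD tu.1 tt.1.
  have h : [set x | w x != 0] `<=` [set x | u x != 0] `|` [set x | tile l v x != 0].
    move=> x /=; rewrite /w; have [->|ux] := eqVneq (u x) 0; last by left.
    by rewrite add0r; right.
  apply: subset_trans (closure_subset h) _; rewrite closureU => x [].
    exact: tu.2.
  exact: tt.2.
have wE x : op_apply B w x = f x + op_apply B (tile l v) x.
  exact: (op_applyD B x tu.1 tt.1).
rewrite (le_trans (envelope_le z tw))//.
have cFz : continuous (fun y => F (z + y)).
  by apply: (@comp_shift_continuous _ _ _ _ _ id) => // y; exact: cvg_id.
rewrite /field_integral (@cube_integral_ext _ _ _ (fun x => F (z + (f x + op_apply B (tile l v) x)))); last first.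
  by move=> x; rewrite wE.
rewrite (@tile_integral _ _ U V l B N v (fun y => F (z + y)) f)//.
have N0 : (0 < N)%N by [].
have cE : continuous (envelope F) := lipschitz_with_continuous envelope_lipschitz.
have cEz : continuous (fun x => envelope F (z + f x)) by exact: comp_shift_continuous.
rewrite (cube_integral_tile N0 cEz).
rewrite -[X in _ + X](@cube_integral_mean_const R n N)// -mulrDr -big_split /=.
rewrite ler_pM2l; last by rewrite exprn_gt0// invr_gt0 ltr0n.
apply: ler_sum => m _.
have ccell : continuous (@cell R n N m) by exact: cell_continuous.
have cfc : continuous (fun y => f (cell m y)) by exact: (comp_continuous ccell cf).
have cov := op_apply_continuous (B := B) (tv m).1.
have c1 : continuous (fun y => F (z + (f (cell m y) + op_apply B (v m) y))).
  exact: (comp_continuous (addf_continuous cfc cov) cFz).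
have cc (c : R) : continuous (fun _ : 'rV[R]_n => c) by exact: cst_continuous.
have s1 : cube_integral (fun y => F (z + (f (cell m y) + op_apply B (v m) y))) <=
    field_integral F (z + f (cell m 0)) (v m) + e / 4.
  rewrite -[X in _ + X](@cube_integral_cst R n) /field_integral.
  have c2 := field_continuous (z := (z + f (cell m 0))) cF (tv m).
  rewrite -(cube_integralD c2 (cc _)); apply: le_cube_integral => //.
    exact: (addf_continuous c2 (cc _)).
  move=> y cy; rewrite -lerBlDl (le_trans (ler_norm _))// (le_trans (lF' _ _))//.
  rewrite (le_trans _ Ld)// ler_wpM2l// addrA opprD addrACA subrr addr0.
  by rewrite opprD addrACA subrr add0r distrC osc.
have s2 : envelope F (z + f (cell m 0)) <= cube_integral (fun y => envelope F (z + f (cell m y))) + e / 4.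
  have c3 : continuous (fun y => envelope F (z + f (cell m y))) by exact: comp_shift_continuous.
  have -> : cube_integral (fun y => envelope F (z + f (cell m y))) + e / 4 =
      cube_integral (fun y => envelope F (z + f (cell m y)) + e / 4).
    by rewrite (cube_integralD c3 (cc (e / 4))) cube_integral_cst.
  rewrite -[leLHS](@cube_integral_cst R n).
  apply: (le_cube_integral (cc _) (addf_continuous c3 (cc (e / 4)))).
  move=> y cy; rewrite -lerBlDl (le_trans (ler_norm _))// (le_trans (lE' _ _))//.
  rewrite (le_trans _ Ld)// ler_wpM2l// opprD addrACA subrr add0r osc//.
have := hv m; lra.
Qed.

End lipschitz.

Lemma envelope_quasiconvex k (A : diff_op n k V W) F L z0 :
  (forall xi : 'rV[R]_n, xi != 0 -> lker (symbol A xi) = limg (symbol B xi)) ->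
  lipschitz_with F L -> has_lbound (field_values F z0) -> quasiconvex A (envelope F).
Proof.
move=> AB lF lb; have lE := envelope_lipschitz lF lb.
have H := quasiconvex_of_trig AB (lipschitz_with_continuous lE).
apply: H; apply: (lipschitz_trig_of_test lE) => z u tu; exact: (envelope_test lF lb z tu).
Qed.

(** Dividing a test field by [t] gives a test field, whence one inequality for every [t > 0]; the
    opposite one is the same inequality for [s^-1]. *)
Lemma envelope_homogeneous F L z0 (s : R) z : lipschitz_with F L ->
  has_lbound (field_values F z0) -> (forall s y, 0 < s -> F (s *: y) = s * F y) -> 0 < s ->
  envelope F (s *: z) = s * envelope F z.
Proof.
move=> lF lb hF s0; have cF := lipschitz_with_continuous lF.
have H t y : 0 < t -> t * envelope F y <= envelope F (t *: y).
  move=> t0; apply: envelope_ge => u tu.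
  have tu' : test_field (fun x => t^-1 *: u x).
    split; first exact: smoothZ tu.1.
    apply: subset_trans (closure_subset _) tu.2 => x /=; apply: contra => /eqP ->.
    by rewrite scaler0.
  have -> : field_integral F (t *: y) u = t * field_integral F y (fun x => t^-1 *: u x).
    rewrite /field_integral -(cube_integralZ t (field_continuous (z := y) cF tu')).
    apply: cube_integral_ext => x.
    rewrite (op_applyZ B t^-1 x tu.1) -hF// scalerDr scalerA mulfV ?scale1r//.
    by rewrite gt_eqF.
  by rewrite ler_pM2l//; exact: (envelope_le lF lb).
apply/eqP; rewrite eq_le H// andbT.
have := H s^-1 (s *: z); rewrite invr_gt0 scalerA mulVf ?gt_eqF// scale1r => /(_ s0).
by rewrite ler_pdivrMl.
Qed.

Lemma envelope_perturb F G L L' z0 z0' (C : R) z : lipschitz_with F L -> lipschitz_with G L' ->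
  has_lbound (field_values F z0) -> has_lbound (field_values G z0') ->
  (forall y, `|F y - G y| <= C) -> `|envelope F z - envelope G z| <= C.
Proof.
move=> lF lG bF bG FG.
have cF := lipschitz_with_continuous lF; have cG := lipschitz_with_continuous lG.
have H F1 F2 u : continuous F1 -> continuous F2 -> (forall y, `|F1 y - F2 y| <= C) -> test_field u ->
    field_integral F1 z u <= field_integral F2 z u + C.
  move=> c1 c2 h tu; rewrite -[C in _ + C](@cube_integral_cst R n).
  have cc : continuous (fun _ : 'rV[R]_n => C) by exact: cst_continuous.
  have f2 := field_continuous (z := z) c2 tu.
  rewrite /field_integral -(cube_integralD f2 cc); apply: le_cube_integral.
  - exact: field_continuous.
  - exact: (addf_continuous f2 cc).
  - by move=> x _; rewrite -lerBlDl (le_trans (ler_norm _)).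
rewrite ler_norml; apply/andP; split.
  rewrite lerBrDr addrC -lerBrDr opprK.
  rewrite -lerBlDr; apply: envelope_ge => u tu; rewrite lerBlDr.
  by rewrite (le_trans (envelope_le lG bG z tu))// H// => y; rewrite distrC.
rewrite lerBlDl -lerBlDr; apply: envelope_ge => u tu; rewrite lerBlDr.
by rewrite (le_trans (envelope_le lF bF z tu))// H.
Qed.

Lemma field_values_lbound_perturb F G (C : R) z : continuous F -> continuous G ->
  (forall y, `|F y - G y| <= C) -> has_lbound (field_values F z) -> has_lbound (field_values G z).
Proof.
move=> cF cG FG [c hc]; exists (c - C) => _ [u tu <-]; rewrite lerBlDr.
have cc : continuous (fun _ : 'rV[R]_n => C) by exact: cst_continuous.
have f2 := field_continuous (z := z) cG tu.
apply: le_trans (_ : field_integral F z u <= _); first by apply: hc; exists u.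
rewrite -[C in _ + C](@cube_integral_cst R n) /field_integral -(cube_integralD f2 cc).
apply: le_cube_integral; [exact: field_continuous|exact: (addf_continuous f2 cc)|].
by move=> x _; rewrite -lerBlDl (le_trans (ler_norm _)).
Qed.

End envelope.

(** * Recession functions *)

Section recession.
Context {R : realType}.
Variable V : innerProductType R.
Implicit Types (F h : V -> R) (N : set V).

Lemma uniform_pinftyP N (f : R -> V -> R) h :
  {uniform N, f @ +oo --> h} <->
  forall e : R, 0 < e -> exists T : R, forall t, T < t -> forall y, N y -> `|h y - f t y| < e.
Proof.
split=> [cf e e0|H].
  have : nbhs (h : {uniform` N -> R}) [set g | forall y, N y -> `|h y - g y| < e].
    apply/uniform_nbhs; exists [set xy | ball xy.1 e xy.2]; split.
      by rewrite -entourage_ballE; exists e.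
    by move=> g hg y Ny; exact: hg.
  by move=> /cf[T [_ hT]]; exists T => t Tt; exact: hT.
move=> A /uniform_nbhs[E [+ EA]]; rewrite -entourage_ballE => -[e /= e0 eE].
have [T hT] := H e e0; exists T; split; first exact: num_real.
by move=> t Tt; apply: EA => y Ny; apply: eE; exact: hT.
Qed.

(** A form of membership in [H_space] without limits: [F - h] is [o(|y|)] at infinity, uniformly in
    the direction. Closure properties are easier to prove here; the next lemmas give both
    implications. *)
Definition recession_of F h :=
  [/\ continuous h, forall s y, 0 < s -> h (s *: y) = s * h y &
      forall e : R, 0 < e -> exists C : R, forall y, `|F y - h y| <= e * `|y| + C].

Lemma homogeneous_bound h : continuous h -> (forall s y, 0 < s -> h (s *: y) = s * h y) ->
  exists2 M : R, 0 < M & forall y, `|h y| <= M * `|y|.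
Proof.
move=> ch hh; have [M M0 hM] := continuous_ball_bounded 1 ch; exists M => // y.
have [->|y0] := eqVneq y 0.
  have := hh 2 0 ltac:(by []); rewrite scaler0 => h0.
  have -> : h 0 = 0 by move: h0; lra.
  by rewrite !normr0 mulr0.
have ny : 0 < `|y| by rewrite normr_gt0.
have -> : h y = `|y| * h (`|y|^-1 *: y).
  by rewrite -hh// scalerA mulfV ?scale1r ?gt_eqF.
rewrite normrM normr_id mulrC ler_pM2r// hM// normrZ normfV normr_id.
by rewrite mulVf ?gt_eqF.
Qed.

Lemma H_space_recession F : H_space F -> recession_of F (rec_fun F).
Proof.
move=> [cF [c hc] uF]; set h := rec_fun F.
have unif (z : V) : exists2 N : set V, nbhs z N & forall e : R, 0 < e ->
    exists T : R, forall t, T < t -> forall y, N y -> `|h y - F (t *: y) / t| < e.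
  by have [N zN /uniform_pinftyP hN] := uF z; exists N.
have ptw z e : 0 < e -> exists T : R, forall t, T < t -> `|h z - F (t *: z) / t| < e.
  move=> e0; have [N zN /(_ e e0)[T hT]] := unif z; exists T => t Tt; apply: hT => //.
  exact: nbhs_singleton.
have hh s y : 0 < s -> h (s *: y) = s * h y.
  move=> s0; apply/eqP; rewrite -subr_eq0 -normr_eq0 eq_le normr_ge0 andbT.
  apply/ler_addgt0Pr => e e0; rewrite add0r.
  have [T1 hT1] := ptw (s *: y) (e / 2) (divr_gt0 e0 (ltr0Sn _ 1)).
  have e1 : 0 < e / 2 / s by rewrite !divr_gt0.
  have [T2 hT2] := ptw y (e / 2 / s) e1.
  pose t := Num.max (Num.max T1 (T2 / s)) 0 + 1.
  have t1 : T1 < t by rewrite ltr_pwDr// !le_max lexx.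
  have t2 : T2 / s < t by rewrite ltr_pwDr// !le_max lexx orbT.
  have t0 : 0 < t by rewrite ltr_pwDr// !le_max lexx orbT.
  have h1 := hT1 t t1; have h2 := hT2 (t * s) ltac:(by rewrite -ltr_pdivrMr).
  have -> : h (s *: y) - s * h y = (h (s *: y) - F (t *: (s *: y)) / t) - s * (h y - F ((t * s) *: y) / (t * s)).
    have [tn sn] : t != 0 /\ s != 0 by rewrite !gt_eqF.
    by rewrite scalerA; field; rewrite ?tn ?sn.
  rewrite (le_trans (ler_normB _ _))// (splitr e) lerD ?(ltW h1)//.
  rewrite normrM (gtr0_norm s0) -ler_pdivlMl// [leRHS]mulrC; exact: ltW.
have ch : continuous h.
  move=> z; apply/cvgrPdist_le => e e0.
  have [N zN /(_ (e / 3) (divr_gt0 e0 (ltr0Sn _ 2)))[T hT]] := unif z.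
  pose t := Num.max T 0 + 1.
  have tT : T < t by rewrite ltr_pwDr// !le_max lexx.
  have t0 : 0 < t by rewrite ltr_pwDr// !le_max lexx orbT.
  have cFt : continuous (fun y => t^-1 * F (t *: y + 0)).
    apply: mulc_continuous; apply: comp_continuous => //; exact: affine_continuous.
  have /cvgrPdist_le/(_ (e / 3) (divr_gt0 e0 (ltr0Sn _ 2))) := cFt z.
  move=> hF; near=> y.
  have Ny : N y by near: y.
  have h1 := hT t tT z (nbhs_singleton zN); have h2 := hT t tT y Ny.
  have h3 : `|t^-1 * F (t *: z + 0) - t^-1 * F (t *: y + 0)| <= e / 3 by near: y.
  rewrite !addr0 in h3.
  have -> : h z - h y = (h z - F (t *: z) / t) + (t^-1 * F (t *: z) - t^-1 * F (t *: y)) - (h y - F (t *: y) / t) by ring.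
  rewrite (le_trans (ler_normB _ _))//.
  rewrite (le_trans (lerD (ler_normD _ _) (lexx _)))//.
  by have := lerD (lerD (ltW h1) h3) (ltW h2); lra.
split => // e e0.
(* Local uniformity becomes uniformity on the unit ball by compactness; the estimate is then used
   with [t = |y|] at the point [y / |y|]. *)
have /compact_near_coveringP/(_ R (+oo%R) (fun t y => `|h y - F (t *: y) / t| <= e)) := @ball_compact R V 1.
have H : forall x : V, `|x| <= 1 -> \forall x' \near x & t \near +oo, `|h x' - F (t *: x') / t| <= e.
  move=> x _; have [N xN /(_ e e0)[T hT]] := unif x.
  exists (N, [set t | T < t]); first by split => //=; exists T; split; [exact: num_real|].
  by move=> [x' t] /= [Nx Tt]; apply: ltW; exact: hT.
move=> /(_ _ H)[T0 [_ hT0]].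
pose T := Num.max T0 0 + 1.
have TT : T0 < T by rewrite ltr_pwDr// !le_max lexx.
have Tp : 0 < T by rewrite ltr_pwDr// !le_max lexx orbT.
have [M1 M10 hM1] := continuous_ball_bounded T cF.
have [M2 M20 hM2] := continuous_ball_bounded T ch.
exists (M1 + M2) => y; have [yT|yT] := leP `|y| T.
  rewrite (le_trans (ler_normB _ _))// ler_wpDl ?mulr_ge0 ?(ltW e0)// lerD ?hM1 ?hM2//.
have ny : 0 < `|y| by rewrite (lt_trans Tp).
have := hT0 `|y| (lt_trans TT yT) (`|y|^-1 *: y).
rewrite /= normrZ normfV normr_id mulVf ?gt_eqF// scalerA mulfV ?gt_eqF// scale1r => /(_ (lexx _)).
rewrite (_ : h y = `|y| * h (`|y|^-1 *: y)); last first.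
  by rewrite -hh// scalerA mulfV ?scale1r ?gt_eqF.
move=> h1; rewrite ler_wpDr ?addr_ge0 ?(ltW M10) ?(ltW M20)//.
have -> : F y - `|y| * h (`|y|^-1 *: y) = - (`|y| * (h (`|y|^-1 *: y) - F y / `|y|)).
  by field; rewrite gt_eqF.
by rewrite normrN normrM normr_id mulrC ler_pM2r.
Unshelve. all: by end_near. Qed.

Lemma recession_H_space F h : continuous F -> recession_of F h -> H_space F /\ rec_fun F = h.
Proof.
move=> cF [ch hh Fh].
have unif (z : V) (r e : R) : 0 < e -> exists T : R, forall t, T < t -> forall y, `|y| <= r ->
    `|h y - F (t *: y) / t| < e.
  move=> e0; have r0 : 0 < `|r| + 1 by rewrite ltr_wpDl.
  have e1 : 0 < e / (2 * (`|r| + 1)) by rewrite divr_gt0// mulr_gt0.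
  have [C hC] := Fh _ e1.
  exists (Num.max (2 * `|C| / e) 0 + 1) => t tT y yr.
  have t1 : 2 * `|C| / e < t by rewrite (lt_trans _ tT)// ltr_pwDr// !le_max lexx.
  have t0 : 0 < t by rewrite (lt_trans _ tT)// ltr_pwDr// !le_max lexx orbT.
  have -> : h y - F (t *: y) / t = - (F (t *: y) - h (t *: y)) / t.
    by rewrite hh//; field; rewrite gt_eqF.
  rewrite normrM normrN normfV (gtr0_norm t0) ltr_pdivrMr// (le_lt_trans (hC _))//.
  rewrite normrZ (gtr0_norm t0).
  have h1 : e / (2 * (`|r| + 1)) * (t * `|y|) <= e / 2 * t.
    rewrite mulrCA mulrC ler_wpM2r ?(ltW t0)// mulrAC ler_pdivrMr ?mulr_gt0//.
    have : `|y| <= `|r| + 1 by rewrite (le_trans yr)// ler_wpDr// ler_norm.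
    by move=> /(ler_wpM2l (ltW e0)); rewrite mulrDr; lra.
  have h2 : C < e / 2 * t.
    rewrite (le_lt_trans (ler_norm _))//; move: t1; rewrite ltr_pdivrMr//; lra.
  by lra.
have rE : rec_fun F = h.
  apply/funext => z; apply/cvg_lim => //; apply/cvgrPdist_lt => e e0.
  have [T hT] := unif z `|z| e e0; exists T; split; first exact: num_real.
  by move=> t Tt; exact: hT.
split => //; split => //.
  have [C1 hC1] := Fh 1 ltr01; have [M M0 hM] := homogeneous_bound ch hh.
  exists (1 + M + `|C1|) => z.
  have -> : F z = (F z - h z) + h z by rewrite subrK.
  rewrite (le_trans (ler_normD _ _))//.
  have h1 := hC1 z; have h2 := hM z; have h3 := ler_norm C1.
  have h4 : 0 <= `|C1| * `|z| by rewrite mulr_ge0.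
  have : 0 <= M by exact: ltW.
  by rewrite mulrDr mulr1 !mulrDl; lra.
move=> z; exists (ball z 1); first exact: nbhsx_ballx.
rewrite rE; apply/uniform_pinftyP => e e0.
have [T hT] := unif z (`|z| + 1) e e0; exists T => t Tt y zy; apply: hT => //.
rewrite -(subrK z y) addrC (le_trans (ler_normD _ _))// lerD2l.
by move: zy; rewrite -ball_normE /= distrC => /ltW.
Qed.

End recession.

(** * Fields with prescribed integrals *)

Section separation.
Context {R : realType} {m : nat}.
Variables (C : set 'rV[R]_m) (L : 'rV[R]_m).
Hypothesis C_mid : forall x y, C x -> C y -> C (2^-1 *: (x + y)).

Let sq (x : 'rV[R]_m) := dotp (x - L) (x - L).

Lemma dotp_diag_ge0 (x : 'rV[R]_m) : 0 <= dotp x x.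
Proof. by apply: sumr_ge0 => i _; rewrite -expr2 sqr_ge0. Qed.

Lemma entry_le_dotp (x : 'rV[R]_m) i : x 0 i ^+ 2 <= dotp x x.
Proof.
by rewrite /dotp (bigD1 i)//= -expr2 lerDl sumr_ge0// => j _; rewrite -expr2 sqr_ge0.
Qed.

(** Midpoints alone reach arbitrarily short steps from [x] towards [y], which is all that a first
    variation needs. *)
Lemma midpoint_dyadic k x y : C x -> C y -> C (x + 2^-1 ^+ k *: (y - x)).
Proof.
move=> Cx Cy; elim: k => [|k ih]; first by rewrite expr0 scale1r addrC subrK.
have := C_mid Cx ih; congr C; rewrite exprS; set s := _ ^+ k.
by apply/rowP => i; rewrite !mxE; field.
Qed.

Let sq_continuous : continuous sq.
Proof.
apply: continuous_sum => i _.
have c1 : continuous (fun x : 'rV[R]_m => (x - L) 0 i).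
  have -> : (fun x : 'rV[R]_m => (x - L) 0 i) = (fun x => x 0 i + - L 0 i).
    by apply/funext => x; rewrite !mxE.
  have c2 : continuous (fun _ : 'rV[R]_m => - L 0 i) by exact: cst_continuous.
  exact: (addf_continuous (@coord_continuous _ _ _ 0 i) c2).
exact: (mulf_continuous c1 c1).
Qed.

Lemma quadratic_gap (a b s d : R) : 0 < s -> 0 <= b -> s * (b + 1) < a ->
  d <= d - 2 * s * a + s ^+ 2 * b -> False.
Proof. by nra. Qed.

(* The difference between [L] and the point of the closure of [C] closest to it
   would be a separating functional. *)
Lemma midpoint_approx : C !=set0 ->
  (forall lam e, 0 < e -> exists2 c, C c & dotp lam c <= dotp lam L + e) ->
  forall e : R, 0 < e -> exists2 c, C c & forall i, `|c 0 i - L 0 i| <= e.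
Proof.
move=> [c0 Cc0] hC e e0.
pose K := [set x | sq x <= sq c0] `&` closure C.
have cK : compact K.
  apply: compact_closedI; last exact: closed_closure.
  apply: bounded_closed_compact.
    exists (`|L| + (sq c0 + 1)); split; first exact: num_real.
    move=> M LM x /= xc; apply: le_trans (ltW LM).
    rewrite -(subrK L x) addrC (le_trans (ler_normD _ _))// lerD2l.
    rewrite [leLHS]/Num.norm /= mx_normrE; apply/bigmax_leP; split => [|[i j] _] /=.
      by rewrite addr_ge0// dotp_diag_ge0.
    rewrite ord1; have := le_trans (entry_le_dotp (x - L) j) xc.
    rewrite -(real_normK (num_real _)); set a := `|_|; move=> h.
    have : 0 <= (a - 1) ^+ 2 by exact: sqr_ge0.
    have a0 : 0 <= a by exact: normr_ge0.
    by nra.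
  have -> : [set x | sq x <= sq c0] = sq @^-1` [set y | y <= sq c0] by [].
  by apply: preimage_closed; [move=> x _; exact: sq_continuous|exact: closed_le].
have Kc0 : K c0 by split => /=; [exact: lexx|exact: subset_closure].
have [p Kp hp] := compact_EVT_min (ex_intro _ c0 Kc0) cK (continuous_subspaceT sq_continuous).
have pcl : closure C p by move: Kp; rewrite inE => -[].
have pc0 : sq p <= sq c0 by move: Kp; rewrite inE => -[].
have pmin x : closure C x -> sq p <= sq x.
  move=> cx; have [xc|/ltW xc] := leP (sq x) (sq c0); last exact: le_trans xc.
  by apply: hp; rewrite inE.
have variation c : C c -> 0 <= dotp (p - L) (c - p).
  move=> Cc; rewrite leNgt; apply/negP => hneg.
  set b := dotp (c - p) (c - p); have b0 : 0 <= b by exact: dotp_diag_ge0.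
  (* A dyadic step short enough for the linear gain to outweigh the quadratic term [s^2 b]. *)
  have [k hk] : exists k : nat, 2^-1 ^+ k * (b + 1) < - dotp (p - L) (c - p).
    have h1 : (0 : R) < - dotp (p - L) (c - p) / (b + 1) by rewrite divr_gt0 ?oppr_gt0// ltr_wpDl.
    have /cvgrPdist_lt/(_ _ h1)[k _ /(_ k (leqnn k))] := @cvg_expr R 2^-1 ltac:(by rewrite ger0_norm ?invr_ge0// invf_lt1// ltr1n).
    by rewrite sub0r normrN ger0_norm ?exprn_ge0 ?invr_ge0// ltr_pdivlMr ?ltr_wpDl// => hk; exists k.
  set s := 2^-1 ^+ k in hk; have s0 : 0 < s by rewrite exprn_gt0// invr_gt0.
  (* [p] lies in the closure only. Points [x] of [C] near [p] are sent by the continuous map [g] to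
     points of [C] near the desired one. *)
  have cl : closure C (p + s *: (c - p)).
    move=> A nA; pose g (x : 'rV[R]_m) := (1 - s) *: x + s *: c.
    have cg : continuous g by exact: affine_continuous.
    have gE x : g x = x + s *: (c - x).
      by rewrite /g scalerBl scale1r scalerBr addrA addrAC.
    rewrite -gE in nA; have [x [Cx Ax]] := pcl _ (cg p _ nA).
    by exists (g x); split => //; rewrite gE; exact: midpoint_dyadic.
  have := pmin _ cl; set d := sq p.
  have -> : sq (p + s *: (c - p)) = d - 2 * s * - dotp (p - L) (c - p) + s ^+ 2 * b.
    rewrite /d /b /sq /dotp mulrN opprK !mulr_sumr -!big_split /=; apply: eq_bigr => i _.
    by rewrite !mxE; ring.
  exact: quadratic_gap.
have sqp0 : sq p = 0.
  apply/eqP; rewrite eq_le dotp_diag_ge0 andbT leNgt; apply/negP => d0.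
  have [c Cc hc] := hC (p - L) (sq p / 2) (divr_gt0 d0 (ltr0Sn R 1)).
  have h := variation c Cc.
  have E : dotp (p - L) c - dotp (p - L) L = dotp (p - L) (c - p) + sq p.
    rewrite /sq /dotp -sumrB -big_split /=; apply: eq_bigr => i _.
    by rewrite !mxE; ring.
  by move: E hc h d0; lra.
have pL : p = L.
  apply/rowP => i; apply/eqP; rewrite -subr_eq0 -sqrf_eq0 eq_le sqr_ge0 andbT.
  by rewrite -[leRHS]sqp0 (le_trans _ (entry_le_dotp (p - L) i))// !mxE.
have [c [Cc bc]] := pcl _ (nbhsx_ballx p e e0).
exists c => // i; move: bc; rewrite pL -ball_normE /= => /ltW h.
apply: le_trans h; rewrite -[_ - _]opprK normrN opprB.
have -> : L 0 i - c 0 i = (L - c) 0 i by rewrite !mxE.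
exact: norm_entry_le.
Qed.

End separation.

Section field_approximation.
Context {R : realType}.

(** On each cell a derivative of order [|a|] is scaled by [N^(|a| - l)], which is at most [1 / N]
    for the orders up to [l - 1] in this norm. *)
Lemma tile_sobolev n (U : innerProductType R) l (u : 'rV[R]_n -> U) N :
  (0 < N)%N -> (1 <= l)%N -> test_field u ->
  sobolev_norm l.-1 (tile l (fun _ : {ffun 'I_n -> 'I_N} => u)) <= N%:R^-1 * sobolev_norm l.-1 u.
Proof.
move=> N0 l0 tu; rewrite /sobolev_norm mulr_sumr; apply: ler_sum => a al.
have tt : test_field (tile l (fun _ : {ffun 'I_n -> 'I_N} => u)) by exact: tile_test.
have cn (f : 'rV[R]_n -> U) : continuous f -> continuous (fun x => `|f x|).
  by move=> cf; apply: (comp_continuous cf); exact: norm_continuous.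
have csu := cn _ (smooth_continuous (smooth_pd (mi_seq a) tu.1)).
have cst := cn _ (smooth_continuous (smooth_pd (mi_seq a) tt.1)).
rewrite !partial_miE (cube_integral_tile N0 cst).
rewrite (eq_bigr (fun=> N%:R ^- l * N%:R ^+ mi_order a * cube_integral (fun x => `|pd (mi_seq a) u x|))).
  rewrite cube_integral_mean_const// ler_wpM2r//.
    rewrite -(@cube_integral_cst R n 0); apply: le_cube_integral => //.
    exact: cst_continuous.
  have N1 : 0 < N%:R :> R by rewrite ltr0n.
  rewrite -[l in N%:R ^- l](prednK l0) exprS invfM -mulrA ler_piMr ?invr_ge0 ?(ltW N1)//.
  by rewrite ler_pdivrMl ?exprn_gt0// mulr1 ler_weXn2l// ler1n.
move=> m _; rewrite -(cube_integralZ _ csu).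
apply: eq_cube_integral.
- exact: (comp_continuous (@cell_continuous _ _ _ m) cst).
- exact: mulc_continuous.
by move=> y cy; rewrite tile_pd_cell// normrZ size_mi_seq ger0_norm.
Qed.

Context {n : nat}.
Variables (U V : innerProductType R) (l : nat) (B : diff_op n l U V).
Hypothesis l_ge1 : (1 <= l)%N.

Lemma field_integral_tile F z N (u_ : {ffun 'I_n -> 'I_N} -> 'rV[R]_n -> U) :
  (0 < N)%N -> (forall m, test_field (u_ m)) -> continuous F ->
  field_integral B F z (tile l u_) = N%:R^-1 ^+ n * \sum_m field_integral B F z (u_ m).
Proof.
move=> N0 tu cF; have cz : continuous (fun _ : 'rV[R]_n => z) by exact: cst_continuous.
exact: (tile_integral B N0 tu cF cz).
Qed.

Lemma field_small z u (e : R) : test_field u -> 0 < e -> exists u',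
  [/\ test_field u', sobolev_norm l.-1 u' <= e &
      forall F : V -> R, continuous F -> field_integral B F z u' = field_integral B F z u].
Proof.
move=> tu e0; set s := sobolev_norm l.-1 u.
have [N hN] : exists N : nat, `|s| / e <= N.+1%:R.
  have : 0 <= `|s| / e by rewrite divr_ge0 ?(ltW e0).
  by move=> /truncn_itv/andP[_ h]; exists (Num.truncn (`|s| / e)); exact: ltW.
exists (tile l (fun _ : {ffun 'I_n -> 'I_N.+1} => u)); split; first exact: tile_test.
  rewrite (le_trans (tile_sobolev _ _ tu))// -/s mulrC ler_pdivrMr// (le_trans (ler_norm _))//.
  by move: hN; rewrite ler_pdivrMr// mulrC.
by move=> F cF; rewrite field_integral_tile// cube_integral_mean_const.
Qed.

(** On the grid of mesh [1 / 2], the cells in one half of the cube receive copies of [u], those in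
    the other half copies of [u']. *)
Lemma field_mid z u u' : test_field u -> test_field u' -> exists2 w,
  test_field w & forall F : V -> R, continuous F ->
    field_integral B F z w = 2^-1 * (field_integral B F z u + field_integral B F z u').
Proof.
(* In dimension 0 no multi-index has the order [l >= 1], so [B] sends every field to 0. *)
move=> tu tu'; have [n0|n0] := posnP n.
  have E F w : field_integral B F z w = F z.
    rewrite /field_integral (@cube_integral_ext _ _ _ (fun=> F z)) ?cube_integral_cst// => x.
    rewrite /op_apply big1 ?addr0// => a /eqP al; exfalso.
    move: al l_ge1; rewrite /mi_order big1 => [<-//|i _].
    by have := leq_ltn_trans (leq0n i) (ltn_ord i); rewrite [X in (_ < X)%N]n0.
  by exists u => // F _; rewrite !E; lra.
pose i0 := Ordinal n0.
pose u_ (m : {ffun 'I_n -> 'I_2}) := if m i0 == ord0 then u else u'.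
have tu_ m : test_field (u_ m) by rewrite /u_; case: ifP.
exists (tile l u_) => [|F cF]; first exact: tile_test.
rewrite field_integral_tile//; set S := \sum_m _.
(* Reflecting the grid exchanges the cells of [u] and of [u']; this evaluates [S + S] without
   counting cells. *)
pose flip (m : {ffun 'I_n -> 'I_2}) := [ffun i => rev_ord (m i)].
have flipK : involutive flip by move=> m; apply/ffunP => i; rewrite !ffunE rev_ordK.
have : S + S = \sum_(m : {ffun 'I_n -> 'I_2}) (field_integral B F z u + field_integral B F z u').
  rewrite {2}/S (reindex_inj (inv_inj flipK)) -big_split /=; apply: eq_bigr => m _.
  rewrite /u_ ffunE; case: (m i0) => -[|[|//]] h; rewrite -!val_eqE /=; first by [].
  by rewrite addrC.
move=> /(congr1 (fun y => 2^-1 ^+ n * y)); rewrite cube_integral_mean_const// => <-.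
by rewrite mulrDr; lra.
Qed.

(** A functional [lam] of the vector of integrals is the integral of one function, the combination
    of the [Phi i]; this is why the envelopes of linear combinations decide about separation. *)
Lemma field_approx m (Phi : 'I_m -> V -> R) (L : 'rV[R]_m) z :
  (forall i, continuous (Phi i)) ->
  (forall lam : 'rV[R]_m, let F := fun y => \sum_i lam 0 i * Phi i y in
     has_lbound (field_values B F z) -> envelope B F z <= dotp lam L) ->
  forall e : R, 0 < e -> exists u, [/\ test_field u, sobolev_norm l.-1 u <= e &
    forall i, `|field_integral B (Phi i) z u - L 0 i| <= e].
Proof.
move=> cP H e e0.
pose v u : 'rV[R]_m := \row_i field_integral B (Phi i) z u.
pose C := [set v u | u in @test_field R n U].
have fc i u : test_field u -> continuous (fun x => Phi i (z + op_apply B u x)).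
  by move=> tu; exact: field_continuous.
have dotE (lam : 'rV[R]_m) u : test_field u ->
    dotp lam (v u) = field_integral B (fun y => \sum_i lam 0 i * Phi i y) z u.
  move=> tu; rewrite /field_integral cube_integral_sum => [|i]; last first.
    exact: (mulc_continuous (fc i u tu)).
  by apply: eq_bigr => i _; rewrite mxE -(cube_integralZ _ (fc i u tu)).
have [|||_ [u tu <-] hu] := @midpoint_approx R m C L _ _ _ e e0.
- move=> _ _ [u tu <-] [u' tu' <-]; have [w tw hw] := field_mid z tu tu'.
  by exists w => //; apply/rowP => i; rewrite !mxE hw.
- by exists (v (fun=> 0)); exists (fun=> 0) => //; exact: test_field0.
- move=> lam d d0; pose F y := \sum_i lam 0 i * Phi i y.
  have [lb|nlb] := pselect (has_lbound (field_values B F z)).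
    have [||_ [u tu <-] hu] := @inf_adherent R (field_values B F z) d => //.
      by split => //; exact: field_values_neq0.
    exists (v u); [by exists u|rewrite dotE//].
    by rewrite (le_trans (ltW hu))// lerD2r; exact: H.
  (* Without a lower bound some field already falls below the required value. *)
  have [u tu hu] : exists2 u, test_field u & field_integral B F z u <= dotp lam L + d.
    apply: contrapT => h; apply: nlb; exists (dotp lam L + d) => _ [u tu <-].
    by rewrite leNgt; apply/negP => /ltW hu; apply: h; exists u.
  by exists (v u); [exists u|rewrite dotE].
have [u' [tu' su' hu']] := field_small z tu e0.
exists u'; split => // i; rewrite hu'//.
by have := hu i; rewrite mxE.
Qed.

End field_approximation.

(** * Tame functions and their density in [H_space] *)

Section tame_functions.
Context {R : realType}.
Variable V : innerProductType R.
Implicit Types (F G h : V -> R) (y : V).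

(** Stable under linear combinations, minima and, by [tame_envelope], under finite envelopes, while
    contained in [H_space]: quasiconvex envelopes of such functions are admissible in the hypotheses
    of the theorem. *)
Definition tame F := exists h L C, [/\ lipschitz_with F L, lipschitz_with h L,
  forall s y, 0 < s -> h (s *: y) = s * h y & forall y, `|F y - h y| <= C].

Lemma lipschitz_with_le F L L' : L <= L' -> lipschitz_with F L -> lipschitz_with F L'.
Proof. by move=> LL' lF y y'; rewrite (le_trans (lF _ _))// ler_wpM2r. Qed.

Lemma lipschitz_withD F G L L' : lipschitz_with F L -> lipschitz_with G L' ->
  lipschitz_with (fun y => F y + G y) (L + L').
Proof.
by move=> lF lG y y'; rewrite opprD addrACA (le_trans (ler_normD _ _))// mulrDl lerD.
Qed.

Lemma lipschitz_withZ F L c : lipschitz_with F L -> lipschitz_with (fun y => c * F y) (`|c| * L).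
Proof. by move=> lF y y'; rewrite -mulrBr normrM -mulrA ler_wpM2l. Qed.

Lemma min_dist (a a' b b' d : R) : `|a - a'| <= d -> `|b - b'| <= d ->
  `|Num.min a b - Num.min a' b'| <= d.
Proof.
by rewrite !ler_norml; case: (leP a b); case: (leP a' b'); lra.
Qed.

Lemma lipschitz_with_min F G L : lipschitz_with F L -> lipschitz_with G L ->
  lipschitz_with (fun y => Num.min (F y) (G y)) L.
Proof. by move=> lF lG y y'; exact: min_dist. Qed.

Lemma tame_min F G : tame F -> tame G -> tame (fun y => Num.min (F y) (G y)).
Proof.
move=> [h [L [C [lF lh hh Fh]]]] [h' [L' [C' [lG lh' hh' Gh']]]].
exists (fun y => Num.min (h y) (h' y)), (Num.max L L'), (Num.max C C').
have L1 : L <= Num.max L L' by rewrite le_max lexx.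
have L2 : L' <= Num.max L L' by rewrite le_max lexx orbT.
split.
- exact: lipschitz_with_min (lipschitz_with_le L1 lF) (lipschitz_with_le L2 lG).
- exact: lipschitz_with_min (lipschitz_with_le L1 lh) (lipschitz_with_le L2 lh').
- by move=> s y s0; rewrite hh// hh'// minr_pMr// ltW.
- by move=> y; apply: min_dist; rewrite le_max ?Fh ?Gh' ?orbT.
Qed.

Lemma tameD F G : tame F -> tame G -> tame (fun y => F y + G y).
Proof.
move=> [h [L [C [lF lh hh Fh]]]] [h' [L' [C' [lG lh' hh' Gh']]]].
exists (fun y => h y + h' y), (L + L'), (C + C'); split.
- exact: lipschitz_withD.
- exact: lipschitz_withD.
- by move=> s y s0; rewrite hh// hh'// mulrDr.
- by move=> y; rewrite opprD addrACA (le_trans (ler_normD _ _))// lerD.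
Qed.

Lemma tameZ F c : tame F -> tame (fun y => c * F y).
Proof.
move=> [h [L [C [lF lh hh Fh]]]]; exists (fun y => c * h y), (`|c| * L), (`|c| * C); split.
- exact: lipschitz_withZ.
- exact: lipschitz_withZ.
- by move=> s y s0; rewrite hh// mulrCA.
- by move=> y; rewrite -mulrBr normrM ler_wpM2l.
Qed.

Lemma tame_cst c : tame (fun=> c).
Proof.
exists (fun=> 0), 0, `|c|; split => [y y'|y y'|s y _|y]; rewrite ?subrr ?normr0 ?mul0r ?mulr0//.
by rewrite subr0.
Qed.

Lemma tame_sum (I : Type) (r : seq I) (F : I -> V -> R) : (forall i, tame (F i)) ->
  tame (fun y => \sum_(i <- r) F i y).
Proof.
move=> tF; elim: r => [|i r ih].
  by rewrite (_ : (fun _ => _) = (fun=> 0)); [exact: tame_cst|apply/funext => y; rewrite big_nil].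
rewrite (_ : (fun _ => _) = (fun y => F i y + \sum_(i <- r) F i y)); first exact: tameD.
by apply/funext => y; rewrite big_cons.
Qed.

Lemma lipschitz_with_norm : lipschitz_with (fun y : V => `|y|) 1.
Proof. by move=> y y'; rewrite mul1r; exact: ler_dist_dist. Qed.

Lemma tame_norm : tame (fun y => `|y|).
Proof.
exists (fun y => `|y|), 1, 0; split; try exact: lipschitz_with_norm.
- by move=> s y s0; rewrite normrZ gtr0_norm.
- by move=> y; rewrite subrr normr0.
Qed.

Lemma tame_cone (q : V) : tame (fun y => `|y - (1 + `|y|) *: q|).
Proof.
(* One identity for two purposes: [c = c'] gives the Lipschitz bound, and [y = y'] with [c = 1],
   [c' = 0] the distance [|q|] to the homogeneous function. *)
have diff c c' y y' : (y - (c + `|y|) *: q) - (y' - (c' + `|y'|) *: q) =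
    (y - y') + (c' - c + (`|y'| - `|y|)) *: q.
  rewrite opprD opprK addrACA; congr (_ + _).
  by rewrite addrC -scalerBl opprD addrACA.
have lip c : lipschitz_with (fun y => `|y - (c + `|y|) *: q|) (1 + `|q|).
  move=> y y'; rewrite (le_trans (ler_dist_dist _ _))// diff subrr add0r.
  rewrite (le_trans (ler_normD _ _))// mulrDl mul1r lerD2l normrZ mulrC ler_wpM2l//.
  by rewrite distrC ler_dist_dist.
exists (fun y => `|y - (0 + `|y|) *: q|), (1 + `|q|), `|q|; split => //.
  move=> s y s0; rewrite !add0r normrZ (gtr0_norm s0) -scalerA -scalerBr normrZ.
  by rewrite (gtr0_norm s0).
move=> y; rewrite (le_trans (ler_dist_dist _ _))// diff !subrr add0r addr0 sub0r scaleN1r.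
by rewrite normrN.
Qed.

Definition rational_point (r : 'rV[rat]_(\dim {:V})) : V := of_row (map_mx ratr r).

Lemma rational_point_dense y d : 0 < d -> exists r, `|y - rational_point r| < d.
Proof.
move=> d0.
have /cvgrPdist_lt/(_ _ d0)/nbhs_ballP[e /= e0 he] := @of_row_continuous R V (\row_i co i y).
have app i : exists x : rat, `|co i y - ratr x| < e by exact: rat_approx.
have [r hr] := choice app.
exists (\row_i r i); rewrite -{1}(of_row_co y); apply: he.
by split => // i j; rewrite ord1 !mxE; exact: hr.
Qed.

(* In the variable [x = y / (1 + |y|)] of the unit ball, this is [1 + |y|] times
   the minimum of [K] and of the cones [c + K |x - q|], for rational data (c, q). *)
Definition min_cone (K : R) (s : seq (rat * 'rV[rat]_(\dim {:V}))) : V -> R :=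
  foldr (fun p F y => Num.min
    (ratr p.1 * (1 + `|y|) + K * `|y - (1 + `|y|) *: rational_point p.2|) (F y))
    (fun y => K * (1 + `|y|)) s.

Lemma min_cone_tame K s : tame (min_cone K s).
Proof.
have t1 c : tame (fun y => c * (1 + `|y|)).
  by apply: tameZ; apply: tameD; [exact: tame_cst|exact: tame_norm].
elim: s => //= p s ih; apply: tame_min => //.
by apply: tameD => //; apply: tameZ; exact: tame_cone.
Qed.

Lemma min_cone_le K s p y : p \in s ->
  min_cone K s y <= ratr p.1 * (1 + `|y|) + K * `|y - (1 + `|y|) *: rational_point p.2|.
Proof.
elim: s => //= p' s ih; rewrite inE => /orP[/eqP<-|/ih h]; first by rewrite ge_min lexx.
by rewrite ge_min h orbT.
Qed.

Lemma min_cone_ge K s y c : c <= K * (1 + `|y|) ->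
  (forall p, p \in s ->
     c <= ratr p.1 * (1 + `|y|) + K * `|y - (1 + `|y|) *: rational_point p.2|) ->
  c <= min_cone K s y.
Proof.
move=> cK; elim: s => //= p s ih hp; rewrite le_min hp ?mem_head//= ih// => p' p's.
by apply: hp; rewrite inE p's orbT.
Qed.

End tame_functions.

Section density.
Context {R : realType}.
Variable V : innerProductType R.

Lemma one_norm_gt0 (y : V) : 0 < 1 + `|y|.
Proof. by rewrite ltr_pwDl. Qed.

Lemma cone_upper (gx gq c e K u : R) : `|gx - gq| <= e / 4 -> `|gq + e / 4 - c| < e / 8 ->
  K * u <= e / 4 -> 0 < e -> c + K * u <= gx + e.
Proof. rewrite ler_norml ltr_norml => /andP[? ?] /andP[? ?] ? ?; lra. Qed.

Lemma cone_lower_near (gx gq c e k : R) : `|gx - gq| <= e / 4 -> `|gq + e / 4 - c| < e / 8 ->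
  0 <= k -> 0 < e -> gx - e <= c + k.
Proof. rewrite ler_norml ltr_norml => /andP[? ?] /andP[? ?] ? ?; lra. Qed.

Lemma cone_lower_far (gx gq c e K u d M : R) : `|gx| <= M -> `|gq| <= M ->
  `|gq + e / 4 - c| < e / 8 -> 2 * M <= K * d -> 0 <= K -> d <= u -> 0 < e -> gx - e <= c + K * u.
Proof.
rewrite !ler_norml ltr_norml => /andP[? ?] /andP[? ?] /andP[? ?] ? K0 du ?.
by have := ler_wpM2l K0 du; lra.
Qed.

(** Steep cones are placed at finitely many rational vertices [q], at rational heights close to
    [g q + e / 4]. Within distance [d] of its vertex a cone stays above [g - e] because [g] varies
    little; beyond, because [2 M <= K d]. From above, each point of the unit ball is within [r] of a
    vertex, and [K r <= e / 4]. The constant [K >= M] does not spoil the minimum. *)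
Lemma min_cone_approx (g : V -> R) (e : R) : continuous g -> 0 < e -> exists (K : nat) s,
  forall y : V, `|(1 + `|y|) * g ((1 + `|y|)^-1 *: y) - min_cone K%:R s y| <= e * (1 + `|y|).
Proof.
move=> cg e0; have e4 : 0 < e / 4 by exact: divr_gt0.
have cK : compact [set v : V | `|v| <= 1] by exact: ball_compact.
have [d d0 hd] := compact_uniformly_continuous cK cg e4.
have [M M0 hM] := continuous_ball_bounded 2 cg.
have [K [K1 KM Kd]] : exists K : nat, [/\ (0 < K)%N, M <= K%:R & 2 * M <= K%:R * d].
  have : 0 <= M + 2 * M / d by rewrite addr_ge0 ?divr_ge0 ?mulr_ge0 ?(ltW d0) ?(ltW M0).
  move=> /truncn_itv/andP[_ h]; exists (Num.truncn (M + 2 * M / d)).+1; split => //.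
    by rewrite (le_trans _ (ltW h))// lerDl divr_ge0 ?mulr_ge0 ?(ltW d0) ?(ltW M0).
  rewrite -ler_pdivrMr// (le_trans _ (ltW h))// lerDr; exact: ltW.
have K0 : 0 < K%:R :> R by rewrite ltr0n.
pose r := Num.min (Num.min d 1) (e / 4 / K%:R).
have r0 : 0 < r by rewrite !lt_min d0 ltr01 divr_gt0.
have rd : r <= d by rewrite !ge_min lexx.
have r1 : r <= 1 by rewrite !ge_min lexx orbT.
have rK : K%:R * r <= e / 4 by rewrite mulrC -ler_pdivlMr// !ge_min lexx orbT.
(* As [r <= 1], vertices of norm at most 2 suffice to cover the unit ball, and [M] bounds [g]
   there. *)
pose Q := [set q : 'rV[rat]_(\dim {:V}) | `|rational_point q : V| <= 2].
move: (cK); rewrite compact_cover => cvK.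
have [|x x1|D DQ hD] := cvK _ Q (fun q => ball (rational_point q : V) r).
- by move=> q _; exact: ball_open.
- have [q hq] := rational_point_dense x r0; exists q; last first.
    by rewrite -ball_normE /= distrC.
  rewrite /Q /= -(subrK x (rational_point q)) (le_trans (ler_normD _ _))//.
  by rewrite distrC [leRHS](_ : 2 = 1 + 1)// lerD// (le_trans (ltW hq)).
have app q : exists c : rat, `|g (rational_point q) + e / 4 - ratr c| < e / 8.
  by apply: rat_approx; exact: divr_gt0.
have [c hc] := choice app.
exists K, [seq (c q, q) | q <- finmap.enum_fset D] => y.
have y0 := one_norm_gt0 y; set m := 1 + `|y| in y0 *; set x := m^-1 *: y.
have x1 : `|x| <= 1 by rewrite normrZ normfV gtr0_norm// ler_pdivrMl// mulr1 ler_wpDl.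
have gx : `|g x| <= M by apply: hM; rewrite (le_trans x1)// ler1n.
have scale q : ratr (c q) * m + K%:R * `|y - m *: rational_point q| =
    m * (ratr (c q) + K%:R * `|x - rational_point q|).
  rewrite [RHS]mulrDr [m * ratr _]mulrC; congr (_ + _); rewrite mulrCA -[in RHS](gtr0_norm y0) -normrZ scalerBr.
  by rewrite /x scalerA mulfV ?gt_eqF// scale1r.
rewrite ler_distlC; apply/andP; split.
  rewrite [e * m]mulrC -mulrBr; apply: min_cone_ge.
    rewrite -/m [leRHS]mulrC ler_pM2l// (le_trans _ KM)//.
    by rewrite (le_trans _ (le_trans (ler_norm _) gx))// gerBl ltW.
  move=> _ /mapP[q qD ->] /=; rewrite -/m scale ler_pM2l//.
  have [xq|xq] := ltP `|x - rational_point q| d.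
    by apply: (cone_lower_near (hd _ _ x1 xq) (hc q)); rewrite ?mulr_ge0 ?(ltW K0).
  apply: (cone_lower_far gx _ (hc q) Kd (ltW K0) xq e0).
  by apply: hM; have := DQ q qD; rewrite inE.
have [q qD xq] := hD x x1.
have h : (c q, q) \in [seq (c q, q) | q <- finmap.enum_fset D] by apply/mapP; exists q.
rewrite (le_trans (min_cone_le _ _ h))//= -/m scale [e * m]mulrC -mulrDr ler_pM2l//.
have xr : `|x - rational_point q| < r by rewrite distrC; move: xq; rewrite -ball_normE.
apply: (cone_upper (hd _ _ x1 (lt_le_trans xr rd)) (hc q)) => //.
by rewrite (le_trans _ rK)// ler_pM2l// ltW.
Qed.

Lemma scaled_remainder_le (a c e b d : R) : `|b| <= e / 2 * (a * d^-1) + c -> 0 < d ->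
  a = 1 - d -> d * (2 * (`|c| + 1)) <= e -> 0 < e -> `|d * b| <= e.
Proof.
move=> hb d0 ad dc e0; rewrite ad in hb; rewrite normrM (gtr0_norm d0).
have := ler_wpM2l (ltW d0) hb => h; apply: le_trans h _; rewrite mulrDr.
have -> : d * (e / 2 * ((1 - d) * d^-1)) = e / 2 * (1 - d) by field; rewrite gt_eqF.
have : d * c <= d * `|c| by rewrite ler_wpM2l ?ler_norm ?ltW.
have : 0 <= e * d by rewrite mulr_ge0 ?ltW.
by lra.
Qed.

(* [F y = (1 + |y|) g (y / (1 + |y|))] where [g] is continuous up to the unit
   sphere, on which it coincides with the recession function of [F]. *)
Lemma H_space_tame_approx (F : V -> R) (e : R) : H_space F -> 0 < e -> exists (K : nat) s,
  forall y : V, `|F y - min_cone K%:R s y| <= e * (1 + `|y|).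
Proof.
move=> HF e0; have [ch hh Fh] := H_space_recession HF; set h := rec_fun F in ch hh Fh.
have [cF _ _] := HF.
pose f y := F y - h y.
have cf : continuous f by move=> y; apply: cvgB; [exact: cF|exact: ch].
(* The remainder [F - h] in the variable of the unit ball. It grows more slowly than [|y|], and the
   factor [1 - |x|] equals [1 / (1 + |y|)]; so the extension by 0 is continuous at the sphere. *)
pose r (x : V) := if `|x| < 1 then (1 - `|x|) * f ((1 - `|x|)^-1 *: x) else 0.
have cr : continuous r.
  move=> x0; have [x1|x1] := ltP `|x0| 1.
    have n1 : (fun x : V => 1 - `|x|) @ x0 --> 1 - `|x0|.
      by apply: cvgB; [exact: cvg_cst|exact: norm_continuous].
    have nz : 1 - `|x0| != 0 by rewrite subr_eq0 gt_eqF.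
    have rE : r x0 = (1 - `|x0|) * f ((1 - `|x0|)^-1 *: x0) by rewrite /r x1.
    change (r @ x0 --> r x0); rewrite rE.
    have near_in : \forall x \near x0, `|x| < 1.
      by have /cvgr_lt := @norm_continuous _ _ x0; apply.
    apply: (@cvg_trans _ ((fun x : V => (1 - `|x|) * f ((1 - `|x|)^-1 *: x)) @ x0)).
      apply: near_eq_cvg; near=> x; rewrite /r ifT//; near: x; exact: near_in.
    apply: cvgM => //; apply: (@cvg_comp _ _ _ (fun x : V => (1 - `|x|)^-1 *: x) f); last exact: cf.
    by apply: cvgZ => //; exact: cvgV.
  have rE : r x0 = 0 by rewrite /r ltNge x1.
  change (r @ x0 --> r x0); rewrite rE.
  apply/cvgrPdist_le => d d0; have [C hC] := Fh (d / 2) (divr_gt0 d0 (ltr0Sn R 1)).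
  have C0 : 0 < 2 * (`|C| + 1) by rewrite mulr_gt0// ltr_wpDl.
  have near_in : \forall x \near x0, 1 - d / (2 * (`|C| + 1)) < `|x|.
    have /cvgr_gt := @norm_continuous _ _ x0; apply.
    by rewrite (lt_le_trans _ x1)// ltrBlDr ltrDl divr_gt0.
  near=> x; rewrite sub0r normrN /r; case: ifPn => xl; last by rewrite normr0 ltW.
  have xn : 1 - d / (2 * (`|C| + 1)) < `|x| by near: x; exact: near_in.
  have xp : 0 < 1 - `|x| by rewrite subr_gt0.
  apply: (@scaled_remainder_le `|x| C d _ (1 - `|x|)) => //.
  - have := hC ((1 - `|x|)^-1 *: x).
    by rewrite normrZ normfV (gtr0_norm xp) [_^-1 * _]mulrC.
  - by rewrite subKr.
  - rewrite -ler_pdivlMr//; lra.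
have cg : continuous (fun x => h x + r x) by exact: addf_continuous.
have [K [s hs]] := min_cone_approx cg e0; exists K, s => y.
have y0 := one_norm_gt0 y; set m := 1 + `|y| in y0 *.
suff E : F y = m * (h (m^-1 *: y) + r (m^-1 *: y)) by rewrite E; exact: hs.
have E1 : 1 - `|m^-1 *: y| = m^-1.
  rewrite normrZ normfV gtr0_norm//; have -> : `|y| = m - 1 by rewrite addrC addKr.
  by field; rewrite gt_eqF.
have E2 : `|m^-1 *: y| < 1 by rewrite -subr_gt0 E1 invr_gt0.
rewrite /r E2 E1 invrK scalerA mulfV ?gt_eqF// scale1r hh ?invr_gt0// /f.
by field; rewrite gt_eqF.
Unshelve. all: by end_near. Qed.

End density.

Section H_space_closure.
Context {R : realType}.
Variable V : innerProductType R.
Implicit Types (F G h : V -> R).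

Lemma recession_ofD F G h h' : recession_of F h -> recession_of G h' ->
  recession_of (fun y => F y + G y) (fun y => h y + h' y).
Proof.
move=> [ch hh Fh] [ch' hh' Gh']; split; first exact: addf_continuous.
  by move=> s y s0; rewrite hh// hh'// mulrDr.
move=> e e0; have e2 : 0 < e / 2 by exact: divr_gt0.
have [C hC] := Fh _ e2; have [C' hC'] := Gh' _ e2; exists (C + C') => y.
rewrite opprD addrACA (le_trans (ler_normD _ _))// (le_trans (lerD (hC y) (hC' y)))//.
by rewrite addrACA -mulrDl -splitr.
Qed.

Lemma recession_ofZ F h c : recession_of F h -> recession_of (fun y => c * F y) (fun y => c * h y).
Proof.
move=> [ch hh Fh]; split; first exact: mulc_continuous.
  by move=> s y s0; rewrite hh// mulrCA.
move=> e e0; have c0 : 0 < `|c| + 1 by rewrite ltr_wpDl.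
have [C hC] := Fh (e / (`|c| + 1)) (divr_gt0 e0 c0); exists (`|c| * C) => y.
rewrite -mulrBr normrM (le_trans (ler_wpM2l (normr_ge0 c) (hC y)))// mulrDr lerD2r mulrA.
by rewrite ler_wpM2r// mulrCA ler_piMr ?(ltW e0)// ler_pdivrMr// mul1r lerDl.
Qed.

Lemma tame_continuous F : tame F -> continuous F.
Proof. by move=> [h [L [C [lF _ _ _]]]]; exact: lipschitz_with_continuous lF. Qed.

Lemma tame_H_space F : tame F -> H_space F.
Proof.
move=> [h [L [C [lF lh hh Fh]]]].
have [] // := @recession_H_space R V F h (lipschitz_with_continuous lF).
split => //; first exact: lipschitz_with_continuous lh.
move=> e e0; exists C => y; rewrite (le_trans (Fh y))// lerDr mulr_ge0//; exact: ltW.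
Qed.

Lemma H_spaceD F G : H_space F -> H_space G ->
  H_space (fun y => F y + G y) /\ rec_fun (fun y => F y + G y) = (fun y => rec_fun F y + rec_fun G y).
Proof.
move=> HF HG; have [cF _ _] := HF; have [cG _ _] := HG.
apply: recession_H_space; first exact: addf_continuous.
by apply: recession_ofD; exact: H_space_recession.
Qed.

Lemma H_spaceZ F c : H_space F ->
  H_space (fun y => c * F y) /\ rec_fun (fun y => c * F y) = (fun y => c * rec_fun F y).
Proof.
move=> HF; have [cF _ _] := HF; apply: recession_H_space; first exact: mulc_continuous.
by apply: recession_ofZ; exact: H_space_recession.
Qed.

Lemma H_space_le F G y : H_space F -> H_space G -> (forall y, F y <= G y) -> rec_fun F y <= rec_fun G y.
Proof.
move=> HF HG FG.
have [_ hh1 h1] := H_space_recession HF; have [_ hh2 h2] := H_space_recession HG.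
apply/ler_addgt0Pr => e e0.
have e1 : 0 < e / (4 * (`|y| + 1)) by rewrite divr_gt0// mulr_gt0// ltr_wpDl.
have [C1 hC1] := h1 _ e1; have [C2 hC2] := h2 _ e1.
pose s := 2 * (`|C1| + `|C2|) / e + 1.
have s0 : 0 < s by rewrite ltr_wpDl// divr_ge0 ?(ltW e0)// mulr_ge0// addr_ge0.
have := hC1 (s *: y); have := hC2 (s *: y); rewrite hh1// hh2// !normrZ (gtr0_norm s0).
rewrite !ler_norml => /andP[_ a2] /andP[a1 _].
have h : e / (4 * (`|y| + 1)) * (s * `|y|) <= e / 4 * s.
  rewrite mulrCA mulrC ler_wpM2r ?(ltW s0)// mulrAC ler_pdivrMr ?mulr_gt0 ?ltr_wpDl//.
  have : 0 <= e * `|y| by rewrite mulr_ge0 ?(ltW e0).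
  have : 0 <= e by exact: ltW.
  by nra.
have hC : C1 + C2 <= s * (e / 2).
  rewrite (_ : s * (e / 2) = `|C1| + `|C2| + e / 2); last by rewrite /s; field; rewrite gt_eqF.
  have := ler_norm C1; have := ler_norm C2; lra.
rewrite -(ler_pM2l s0); have := FG (s *: y); lra.
Qed.

End H_space_closure.

Lemma approx_bound (R : realType) (a b p q d nu N i e : R) : `|a - b| <= d * (1 + nu) ->
  `|nu - N| <= i -> i <= 1 -> i <= e / 2 -> `|p - q| <= d * (1 + N) -> `|b - q| <= i -> 0 <= d ->
  d * (3 + 2 * N) = e / 2 -> `|p - a| <= e.
Proof.
move=> ab /ler_normlP[_ nuN] i1 ie pq bq d0 dN.
have h : d * nu <= d * (N + 1) by rewrite ler_wpM2l//; lra.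
rewrite !ler_norml in ab pq bq *; move: ab pq bq => /andP[? ?] /andP[? ?] /andP[? ?].
by apply/andP; split; lra.
Qed.

(** * Construction of the generating sequence *)

Section young_sequence.
Context {R : realType} {n : nat}.
Variables (U V : innerProductType R) (l : nat) (B : diff_op n l U V).
Hypothesis l_ge1 : (1 <= l)%N.
Variables (z : V) (Lf : (V -> R) -> R).
Hypothesis LfD : forall F G : V -> R, H_space F -> H_space G -> Lf (fun y => F y + G y) = Lf F + Lf G.
Hypothesis LfZ : forall (F : V -> R) c, H_space F -> Lf (fun y => c * F y) = c * Lf F.
Hypothesis Lf_le : forall F G : V -> R, H_space F -> H_space G -> (forall y, F y <= G y) -> Lf F <= Lf G.
Hypothesis Lf1 : Lf (fun=> 1) = 1.
Hypothesis Lf_env : forall F : V -> R, tame F -> has_lbound (field_values B F z) -> envelope B F z <= Lf F.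

Let Lf_sum (I : Type) (r : seq I) (c : I -> R) (F : I -> V -> R) : (forall i, tame (F i)) ->
  Lf (fun y => \sum_(i <- r) c i * F i y) = \sum_(i <- r) c i * Lf (F i).
Proof.
move=> tF; elim: r => [|i r ih].
  rewrite big_nil (_ : (fun _ => _) = (fun y => 0 * `|y|)); last first.
    by apply/funext => y; rewrite big_nil mul0r.
  by rewrite (LfZ 0 (tame_H_space (@tame_norm _ V))) mul0r.
rewrite big_cons -ih -(LfZ (c i) (tame_H_space (tF i))).
rewrite (_ : (fun _ => _) = (fun y => c i * F i y + \sum_(i <- r) c i * F i y)).
  rewrite LfD//; apply: tame_H_space; first exact: tameZ.
  by apply: tame_sum => j; exact: tameZ.
by apply/funext => y; rewrite big_cons.
Qed.

Let weight e : tame (fun y : V => e * (1 + `|y|)).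
Proof. by apply: tameZ; apply: tameD; [exact: tame_cst|exact: tame_norm]. Qed.

Let Lf_weight e : Lf (fun y => e * (1 + `|y|)) = e * (1 + Lf (fun y => `|y|)).
Proof.
have H1 : H_space (fun _ : V => 1) by apply: tame_H_space; exact: tame_cst.
have H2 := tame_H_space (@tame_norm _ V).
by rewrite (LfZ e (H_spaceD H1 H2).1) LfD// Lf1.
Qed.

Let Lf_close F G e : H_space F -> H_space G -> (forall y, `|F y - G y| <= e * (1 + `|y|)) ->
  `|Lf F - Lf G| <= e * (1 + Lf (fun y => `|y|)).
Proof.
have H F1 G1 : H_space F1 -> H_space G1 -> (forall y, `|F1 y - G1 y| <= e * (1 + `|y|)) ->
    Lf F1 <= Lf G1 + e * (1 + Lf (fun y => `|y|)).
  move=> HF HG FG; have Hw := tame_H_space (weight e).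
  rewrite -Lf_weight -LfD//; apply: Lf_le => //; first exact: (H_spaceD HG Hw).1.
  by move=> y; rewrite -lerBlDl (le_trans (ler_norm _)).
move=> HF HG FG; rewrite ler_distl lerBlDr !H//.
by move=> y; rewrite distrC.
Qed.

(** An enumeration of all functions [min_cone] with natural [K]. Index 0 is reserved for the norm,
    whose integrals control the weight [1 + |y|] in the approximation errors. *)
Let Psi (j : nat) : V -> R :=
  if j is i.+1 then
    if unpickle i is Some (K, s) then min_cone (K : nat)%:R s else fun y => `|y|
  else fun y => `|y|.

Let Psi_tame j : tame (Psi j).
Proof.
case: j => [|i /=]; first exact: tame_norm.
by case: unpickle => [[K s]|]; [exact: min_cone_tame|exact: tame_norm].
Qed.

Let field_close F G e u : continuous F -> continuous G -> test_field u ->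
  (forall y, `|F y - G y| <= e * (1 + `|y|)) ->
  `|field_integral B F z u - field_integral B G z u| <=
    e * (1 + field_integral B (fun y => `|y|) z u).
Proof.
move=> cF cG tu FG.
have cn : continuous (fun y : V => `|y|) by exact: norm_continuous.
have cw : continuous (fun y : V => e * (1 + `|y|)) := tame_continuous (weight e).
have H F1 G1 : continuous F1 -> continuous G1 -> (forall y, `|F1 y - G1 y| <= e * (1 + `|y|)) ->
    field_integral B F1 z u <= field_integral B G1 z u + e * (1 + field_integral B (fun y => `|y|) z u).
  move=> c1 c2 h.
  have i1 := field_continuous (B := B) (z := z) c1 tu.
  have i2 := field_continuous (B := B) (z := z) c2 tu.
  have i3 := field_continuous (B := B) (z := z) cn tu.
  have iw := field_continuous (B := B) (z := z) cw tu.
  have ic : continuous (fun _ : 'rV[R]_n => 1 : R) by exact: cst_continuous.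
  have -> : e * (1 + field_integral B (fun y => `|y|) z u) = field_integral B (fun y => e * (1 + `|y|)) z u.
    rewrite /field_integral (cube_integralZ e (addf_continuous ic i3)).
    by rewrite (cube_integralD ic i3) cube_integral_cst.
  rewrite /field_integral -(cube_integralD i2 iw); apply: (le_cube_integral i1 (addf_continuous i2 iw)).
  by move=> x _; rewrite -lerBlDl (le_trans (ler_norm _)).
rewrite ler_distl lerBlDr !H//.
by move=> y; rewrite distrC.
Qed.

(** The [m]-th field reproduces [Lf] up to [1 / (m + 1)] on the first [m + 1] functions of the
    enumeration. Each [Psi j] is thus treated from index [j] on, and density in the weighted norm
    extends the convergence to all of [H_space]. *)
Lemma young_sequence : exists u : nat -> 'rV[R]_n -> U,
  [/\ forall j, test_field (u j), sobolev_norm l.-1 (u j) @[j --> \oo] --> (0 : R) &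
      forall Phi : V -> R, H_space Phi -> field_integral B Phi z (u j) @[j --> \oo] --> Lf Phi].
Proof.
have step m : exists u, [/\ test_field u, sobolev_norm l.-1 u <= m.+1%:R^-1 &
    forall i : 'I_m.+1, `|field_integral B (Psi i) z u - Lf (Psi i)| <= m.+1%:R^-1].
  have m0 : 0 < m.+1%:R^-1 :> R by rewrite invr_gt0.
  have [i|lam|u [tu su hu]] := @field_approx R n U V l B l_ge1 m.+1 (fun i => Psi i) (\row_i Lf (Psi i)) z _ _ _ m0.
  - exact: tame_continuous (Psi_tame i).
  - move=> F lb; have -> : dotp lam (\row_i Lf (Psi i)) = Lf F.
      by rewrite /F Lf_sum// /dotp; apply: eq_bigr => i _; rewrite mxE.
    by apply: Lf_env lb; apply: tame_sum => i; apply: tameZ.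
  - by exists u; split => // i; have := hu i; rewrite mxE.
have [u hu] := choice step.
have inv0 : (fun m : nat => m.+1%:R^-1 : R) @ \oo --> (0 : R).
  by apply: cvg_trans (@cvg_harmonic R); exact: cvg_id.
exists u; split => [j||Phi HPhi]; first by have [] := hu j.
  apply: (squeeze_cvgr (f := fun=> 0) (h := fun m : nat => m.+1%:R^-1 : R)) => //; last exact: cvg_cst.
  apply: nearW => m; have [tu su _] := hu m; rewrite su andbT /sobolev_norm sumr_ge0// => a _.
  have cp : continuous (fun x => `|partial_mi a (u m) x|).
    rewrite partial_miE; have := smooth_continuous (smooth_pd (mi_seq a) tu.1) => c1.
    by apply: (comp_continuous c1); exact: norm_continuous.
  rewrite -(@cube_integral_cst R n 0); apply: le_cube_integral => //; exact: cst_continuous.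
set N := Lf (fun y => `|y|).
have N0 : 0 <= N.
  have H0 : H_space (fun y : V => 0 * `|y|) by apply: tame_H_space; apply: tameZ; exact: tame_norm.
  have := LfZ 0 (tame_H_space (@tame_norm _ V)); rewrite mul0r => <-.
  by apply: Lf_le => //; [apply: tame_H_space; exact: tame_norm|move=> y; rewrite mul0r].
apply/cvgrPdist_le => e e0.
(* Once the integrals of the norm are at most [N + 1], replacing [Phi] by a minimum of cones costs
   [d (2 + N)] for the fields and [d (1 + N)] for [Lf], together [e / 2]. *)
have d0 : 0 < e / (2 * (3 + 2 * N)) by rewrite divr_gt0// mulr_gt0// ltr_wpDr ?mulr_ge0.
set d := _ / _ in d0.
have dE : d * (3 + 2 * N) = e / 2 by rewrite /d; field; lra.
have [K [s Ks]] := H_space_tame_approx HPhi d0.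
pose j := (pickle (K, s)).+1.
have PsiE : Psi j = min_cone K%:R s by rewrite /Psi /j pickleK.
have := inv0 => /cvgrPdist_le/(_ (e / 2) (divr_gt0 e0 (ltr0Sn R 1)))[m0 _ hm0].
exists (maxn m0 j) => // m /=; rewrite geq_max => /andP[m0m jm].
have := hm0 m m0m; rewrite sub0r normrN ger0_norm ?invr_ge0// => me.
have [tu _ hm] := hu m.
have hn : `|field_integral B (fun y => `|y|) z (u m) - N| <= m.+1%:R^-1 := hm ord0.
have hj : `|field_integral B (Psi j) z (u m) - Lf (Psi j)| <= m.+1%:R^-1.
  exact: (hm (Ordinal (jm : (j < m.+1)%N))).
rewrite PsiE in hj.
have cP : continuous Phi by case: HPhi.
have cM := tame_continuous (min_cone_tame K%:R s).
have f1 := field_close cP cM tu Ks.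
have f2 := Lf_close HPhi (tame_H_space (min_cone_tame K%:R s)) Ks.
have m1 : m.+1%:R^-1 <= 1 :> R by rewrite invf_le1// ler1n.
exact: (approx_bound f1 hn m1 me f2 hj (ltW d0) dE).
Qed.

End young_sequence.

(** * Regularization of Lipschitz quasiconvex functions *)

Section averaging.
Context {R : realType}.

Lemma unit_integral_cube (g : R -> R) : continuous g ->
  unit_integral g = cube_integral (fun y : 'rV[R]_1 => g (y 0 0)).
Proof.
move=> cg; rewrite cube_integralS; last first.
  by apply: (comp_continuous _ cg); exact: coord_continuous.
apply: unit_integral_ext => x; rewrite -[LHS](@cube_integral_cst R 0).
by apply: cube_integral_ext => y; rewrite -[0 in RHS]/(ord0) consv0.
Qed.

Lemma cube_integral_dist n (f g : 'rV[R]_n -> R) (c : R) : continuous f -> continuous g ->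
  (forall x, cube x -> `|f x - g x| <= c) -> `|cube_integral f - cube_integral g| <= c.
Proof.
have H (f1 g1 : 'rV[R]_n -> R) : continuous f1 -> continuous g1 ->
    (forall x, cube x -> `|f1 x - g1 x| <= c) -> cube_integral f1 <= cube_integral g1 + c.
  move=> cf cg fg; have c1 : continuous (fun _ : 'rV[R]_n => c) by exact: cst_continuous.
  rewrite -[X in _ + X](@cube_integral_cst R n) -(cube_integralD cg c1).
  apply: (le_cube_integral cf (addf_continuous cg c1)) => x cx.
  by rewrite -lerBlDl (le_trans (ler_norm _))// fg.
move=> cf cg fg; rewrite ler_distl lerBlDr !H//.
by move=> x cx; rewrite distrC fg.
Qed.

Lemma unit_integral_dist (f g : R -> R) (c : R) : continuous f -> continuous g ->
  (forall s, 0 <= s <= 1 -> `|f s - g s| <= c) -> `|unit_integral f - unit_integral g| <= c.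
Proof.
move=> cf cg fg; rewrite !unit_integral_cube//.
have cc : continuous (fun y : 'rV[R]_1 => y 0 0) by exact: coord_continuous.
apply: (cube_integral_dist (comp_continuous cc cf) (comp_continuous cc cg)).
by move=> y /(_ 0)/andP[y0 y1]; rewrite fg// !ltW.
Qed.

Lemma le_unit_integral (f g : R -> R) : continuous f -> continuous g ->
  (forall s, f s <= g s) -> unit_integral f <= unit_integral g.
Proof.
move=> cf cg fg; rewrite !unit_integral_cube//.
have cc : continuous (fun y : 'rV[R]_1 => y 0 0) by exact: coord_continuous.
exact: (le_cube_integral (comp_continuous cc cf) (comp_continuous cc cg)).
Qed.

Lemma unit_integral_cst (c : R) : unit_integral (fun=> c) = c.
Proof. by rewrite unit_integral_cube ?cube_integral_cst//; exact: cst_continuous. Qed.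

Lemma unit_integral_lin (f g : R -> R) c : continuous f -> continuous g ->
  unit_integral (fun s => f s + c * g s) = unit_integral f + c * unit_integral g.
Proof.
move=> cf cg.
have cc : continuous (fun y : 'rV[R]_1 => y 0 0) by exact: coord_continuous.
have c1 := mulc_continuous (c := c) (comp_continuous cc cg).
have c2 : continuous (fun s => f s + c * g s) by apply: addf_continuous => //; exact: mulc_continuous.
rewrite !unit_integral_cube// (cube_integralD (comp_continuous cc cf) c1).
by rewrite (cube_integralZ c (comp_continuous cc cg)).
Qed.

Lemma second_order (s i1 i0 f1 f0 a b : R) : `|i1 - f1| <= a * `|s| -> `|i0 - f0| <= a * `|s| ->
  0 <= b -> `|s * (i1 - i0) - s * (f1 - f0)| <= (2 * a + b) * s ^+ 2.
Proof.
move=> h1 h0 b0; rewrite -mulrBr normrM -(real_normK (num_real s)).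
have h : `|i1 - i0 - (f1 - f0)| <= 2 * (a * `|s|).
  have -> : i1 - i0 - (f1 - f0) = (i1 - f1) - (i0 - f0) by ring.
  by rewrite (le_trans (ler_normB _ _))//; lra.
rewrite (le_trans (ler_wpM2l (normr_ge0 s) h))//.
have : 0 <= b * `|s| ^+ 2 by rewrite mulr_ge0.
by nra.
Qed.

(** Both sides are [P (1 + s) - P s - P 1 + P 0] for a primitive [P]. The difference of two averages
    over unit intervals becomes one over intervals of length [|s|], where [f] is nearly constant. *)
Lemma unit_integral_difference (f : R -> R) s : continuous f ->
  unit_integral (fun r => f (1 * r + s)) - unit_integral (fun r => f (1 * r + 0)) =
  s * (unit_integral (fun r => f (s * r + 1)) - unit_integral (fun r => f (s * r + 0))).
Proof.
move=> cf; pose A := 3 * (`|s| + 1) + 1.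
have [P hP] := primitive_exists (- A) A cf.
have aff (a b : R) : `|a| <= `|s| + 1 -> `|b| <= `|s| + 1 ->
    a * unit_integral (fun r => f (a * r + b)) = P (a + b) - P b.
  move=> ha hb; have cfa : continuous (fun r => f (a * r + b)).
    by apply: (comp_continuous _ cf); exact: affine_continuous.
  have c0 : continuous (fun _ : R => 0 : R) by exact: cst_continuous.
  rewrite -[LHS]add0r -[X in X + _]unit_integral_cst -(unit_integral_lin a c0 cfa).
  rewrite (_ : P (a + b) - P b = P (a * 1 + b) - P (a * 0 + b)); last first.
    by rewrite mulr1 mulr0 add0r.
  apply: (@unit_integral_FTC _ _ (fun r => P (a * r + b))).
    by apply: addf_continuous => //; exact: mulc_continuous.
  move=> x /andP[x1 x2]; rewrite add0r; apply: is_derive_affine; apply: hP.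
  rewrite -ltr_norml (le_lt_trans (ler_normD _ _))// normrM.
  have : `|a| * `|x| <= `|a| * 2 by rewrite ler_wpM2l// ler_norml; apply/andP; split; lra.
  by rewrite /A; lra.
have s1 : `|s| <= `|s| + 1 by rewrite lerDl.
have s2 : `|1 : R| <= `|s| + 1 by rewrite normr1 lerDr.
have s3 : `|0 : R| <= `|s| + 1 by rewrite normr0 addr_ge0.
have := aff 1 s s2 s1; have := aff 1 0 s2 s3; have := aff s 1 s1 s2; have := aff s 0 s1 s3.
rewrite !addr0 [1 + s]addrC mulrBr => -> -> /esym h1 /esym h2.
by rewrite -[LHS]mul1r mulrBr -h1 -h2; ring.
Qed.

Variable V : innerProductType R.
Implicit Types (F G : V -> R) (e : V).

Definition avg e F y : R := unit_integral (fun s => F (y + s *: e)).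

Lemma line_continuous F y e : continuous F -> continuous (fun s : R => F (y + s *: e)).
Proof.
move=> cF; apply: comp_shift_continuous => //; exact: scalel_continuous.
Qed.

Lemma avg_lipschitz F L e : lipschitz_with F L -> lipschitz_with (avg e F) L.
Proof.
move=> lF y y'; have cF := lipschitz_with_continuous lF.
apply: unit_integral_dist => [||s _]; try exact: line_continuous.
by rewrite (le_trans (lF _ _))// opprD addrACA subrr addr0.
Qed.

Lemma avg_close F L e y : lipschitz_with F L -> `|avg e F y - F y| <= L * `|e|.
Proof.
move=> lF; have cF := lipschitz_with_continuous lF.
rewrite -[F y]unit_integral_cst; apply: unit_integral_dist => [||s /andP[s0 s1]].
- exact: line_continuous.
- exact: cst_continuous.
rewrite (le_trans (lF _ _))// addrAC subrr add0r normrZ (ger0_norm s0) mulrCA ler_piMl//.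
by have := lF e 0; rewrite subr0; exact: le_trans.
Qed.

(** [avg e F] is an average of translates of [F], each of them quasiconvex; Fubini on the cube of
    dimension [n + 1] exchanges this average with the integral over the field. *)
Lemma avg_quasiconvex n k (W : innerProductType R) (A : diff_op n k V W) F L e :
  lipschitz_with F L -> quasiconvex A F -> quasiconvex A (avg e F).
Proof.
move=> lF [cF qF]; have la := avg_lipschitz e lF.
split; first exact: (lipschitz_with_continuous la).
move=> z w sw pw w0 Aw; have cw : continuous w by exact: (smooth_continuous sw).
pose f (v : 'rV[R]_n.+1) := F (z + (v 0 ord0 *: e + w (\row_i v 0 (lift ord0 i)))).
have ctl : continuous (fun v : 'rV[R]_n.+1 => \row_i v 0 (lift ord0 i)).
  move=> v A' /nbhs_ballP[r /= r0 rA]; apply/nbhs_ballP; exists r => //= v' [_ vv'].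
  by apply: rA; split => // i j; rewrite ord1 !mxE; exact: vv'.
have ch : continuous (fun v : 'rV[R]_n.+1 => v 0 ord0 *: e).
  apply: (@comp_continuous _ _ _ (fun v : 'rV[R]_n.+1 => v 0 ord0) (fun s => s *: e)).
    exact: coord_continuous.
  exact: scalel_continuous.
have cf : continuous f.
  by apply: comp_shift_continuous => //; apply: addf_continuous => //; exact: (comp_continuous ctl cw).
have tlE (x : R) (y : 'rV[R]_n) : \row_i consv x y 0 (lift ord0 i) = y.
  by apply/rowP => i; rewrite mxE consvS.
have fE (x : R) (y : 'rV[R]_n) : f (consv x y) = F (z + x *: e + w y).
  by rewrite /f consv0 tlE addrA.
have -> : cube_integral (fun x => avg e F (z + w x)) = cube_integral f.
  rewrite (cube_integralSr cf); apply: cube_integral_ext => y; apply: unit_integral_ext => x.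
  by rewrite fE addrAC.
rewrite (cube_integralS cf) /avg.
have cs (s : R) : continuous (fun y : 'rV[R]_n => f (consv s y)).
  by apply: (comp_continuous _ cf); exact: consv_continuousr.
have cin : continuous (fun s => cube_integral (fun y => f (consv s y))).
  move=> s; apply/cvgrPdist_le => d d0.
  have L0 : 0 < `|L * `|e| | + 1 by rewrite ltr_wpDl.
  near=> s'; apply: (cube_integral_dist (cs s) (cs s')) => y _.
  rewrite !fE (le_trans (lF _ _))// opprD addrACA subrr addr0 opprD addrACA subrr add0r.
  rewrite -scalerBl normrZ mulrCA.
  have h : `|s - s'| <= d / (`|L * `|e| | + 1) by near: s'; apply: cvgr_dist_le => //; exact: divr_gt0.
  rewrite (le_trans (ler_wpM2l (normr_ge0 _) (ler_norm _)))//.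
  rewrite (le_trans (ler_wpM2r (normr_ge0 _) h))// mulrAC ler_pdivrMr// ler_wpM2l ?(ltW d0)//.
  by rewrite lerDl.
apply: le_unit_integral => // [|s]; first exact: line_continuous.
rewrite (@cube_integral_ext _ _ _ (fun y : 'rV[R]_n => F ((z + s *: e) + w y))); first exact: qF.
by move=> y; exact: fE.
Unshelve. all: by end_near. Qed.

(** The remainder is uniform in [y] and the slope [g] is Lipschitz, so that expansions along several
    directions can be added. *)
Definition smooth_along e F := exists (g : V -> R) K, [/\ lipschitz_with g K &
  forall y s, `|F (y + s *: e) - F y - s * g y| <= K * s ^+ 2].

(* Along [e] the average of [F] has the derivative [F (y + e) - F y]. *)
Lemma avg_smooth_along F L e : lipschitz_with F L -> smooth_along e (avg e F).
Proof.
move=> lF; have cF := lipschitz_with_continuous lF.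
have lF' y y' : `|F y - F y'| <= `|L| * `|y - y'|.
  by rewrite (le_trans (lF _ _))// ler_wpM2r// ler_norm.
exists (fun y => F (y + e) - F y), (2 * (`|L| * `|e|) + 2 * `|L|); split => [y y'|y s].
  rewrite opprD addrACA -opprD (le_trans (ler_normB _ _))//.
  have := lF' (y + e) (y' + e); rewrite opprD addrACA subrr addr0.
  have := lF' y y'; have : 0 <= `|L| * `|e| * `|y - y'| by rewrite !mulr_ge0.
  by lra.
pose f s := F (y + s *: e); have cf : continuous f by exact: line_continuous.
have cfa (a b : R) : continuous (fun s : R => f (a * s + b)).
  by apply: (comp_continuous _ cf); exact: affine_continuous.
have -> : avg e F (y + s *: e) = unit_integral (fun r => f (1 * r + s)).
  by apply: unit_integral_ext => r; rewrite /f mul1r -addrA -scalerDl [s + r]addrC.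
have -> : avg e F y = unit_integral (fun r => f (1 * r + 0)).
  by apply: unit_integral_ext => r; rewrite /f mul1r addr0.
rewrite unit_integral_difference//.
have -> : F (y + e) - F y = f 1 - f 0 by rewrite /f scale1r scale0r addr0.
have step (b : R) : `|unit_integral (fun r => f (s * r + b)) - f b| <= `|L| * `|e| * `|s|.
  rewrite -[f b]unit_integral_cst; apply: unit_integral_dist => //; first exact: cst_continuous.
  move=> r /andP[r0 r1]; rewrite (le_trans (lF' _ _))// opprD addrACA subrr add0r.
  rewrite -scalerBl addrK normrZ normrM (ger0_norm r0).
  by rewrite -[leRHS]mulrA ler_wpM2l// [leRHS]mulrC mulrAC ler_piMr// mulr_ge0.
have h0 := step 0; have h1 := step 1.
by apply: second_order => //; rewrite mulr_ge0.
Qed.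

Lemma avg_smooth_along_other F L e e' : lipschitz_with F L -> smooth_along e' F -> smooth_along e' (avg e F).
Proof.
move=> lF [g [K [lg hg]]]; have cF := lipschitz_with_continuous lF.
have cg := lipschitz_with_continuous lg.
exists (avg e g), K; split; first exact: avg_lipschitz.
move=> y s; rewrite /avg.
have c1 := line_continuous (y := y) (e := e) cF; have c2 := line_continuous (y := y) (e := e) cg.
have c3 := line_continuous (y := y + s *: e') (e := e) cF.
rewrite -addrA -opprD -(unit_integral_lin s c1 c2).
apply: unit_integral_dist => //; first by apply: addf_continuous => //; exact: mulc_continuous.
by move=> r _; rewrite opprD addrA [y + s *: e' + _]addrAC hg.
Qed.

End averaging.

Section regularization.
Context {R : realType}.
Variable V : innerProductType R.
Implicit Types (F G : V -> R) (e : V).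

Definition regularize (d : R) (s : seq 'I_(\dim {:V})) F : V -> R :=
  foldr (fun i G => avg (d *: bv i) G) F s.

Lemma regularize_lipschitz d s F L : lipschitz_with F L -> lipschitz_with (regularize d s F) L.
Proof. by move=> lF; elim: s => //= i s; exact: avg_lipschitz. Qed.

Lemma regularize_close d s F L y : lipschitz_with F L ->
  `|regularize d s F y - F y| <= L * \sum_(i <- s) `|d *: bv i|.
Proof.
move=> lF; elim: s => [|i s ih] /=; first by rewrite subrr normr0 big_nil mulr0.
rewrite big_cons mulrDr -(subrKA (regularize d s F y)) (le_trans (ler_normD _ _))// lerD//.
exact: avg_close (regularize_lipschitz _ _ lF).
Qed.

Lemma regularize_quasiconvex n k (W : innerProductType R) (A : diff_op n k V W) d s F L :
  lipschitz_with F L -> quasiconvex A F -> quasiconvex A (regularize d s F).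
Proof.
move=> lF qF; elim: s => //= i s ih.
exact: avg_quasiconvex (regularize_lipschitz d s lF) ih.
Qed.

Lemma regularize_smooth d s F L i : lipschitz_with F L -> i \in s ->
  smooth_along (d *: bv i) (regularize d s F).
Proof.
move=> lF; elim: s => //= j s ih; rewrite inE => /orP[/eqP->|/ih h].
  exact: avg_smooth_along (regularize_lipschitz d s lF).
exact: avg_smooth_along_other (regularize_lipschitz d s lF) h.
Qed.

Lemma sum_square_bound (K M c S x y z : R) : 0 <= K -> 0 <= M -> 0 <= S -> `|x| <= K * c ^+ 2 ->
  `|y| <= `|c| * (K * (M * S)) -> `|z| <= K * (1 + M) * S ^+ 2 ->
  `|x + y + z| <= K * (1 + M) * (`|c| + S) ^+ 2.
Proof.
move=> K0 M0 S0 hx hy hz.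
rewrite (le_trans (ler_normD _ _))// (le_trans (lerD (ler_normD _ _) (lexx _)))//.
rewrite (le_trans (lerD (lerD hx hy) hz))// -(real_normK (num_real c)).
have c0 : 0 <= `|c| by []; move: (`|c|) c0 => {hx hy}c c0.
have : 0 <= K * M * c ^+ 2 by rewrite !mulr_ge0// sqr_ge0.
have : 0 <= K * (c * S) by rewrite !mulr_ge0.
have : 0 <= K * M * (c * S) by rewrite !mulr_ge0.
by rewrite !expr2; lra.
Qed.

(** One direction at a time: the step along [e i] starts from [y + v], and replacing its slope
    [g i (y + v)] by [g i y] costs a term of order [|c i| |v|], which the square of the sum of all
    [|c i|] absorbs. *)
Lemma quadratic_expansion m (e : 'I_m -> V) G : (forall i, smooth_along (e i) G) ->
  exists (g : 'I_m -> V -> R) (C : R), 0 <= C /\ forall (y : V) (c : 'I_m -> R),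
    `|G (y + \sum_i c i *: e i) - G y - \sum_i c i * g i y| <= C * (\sum_i `|c i|) ^+ 2.
Proof.
move=> H.
have [g hg] := choice H; have [K_ hK] := choice hg.
pose K := \sum_i `|K_ i|; have K0 : 0 <= K by exact: sumr_ge0.
have KK i : K_ i <= K by rewrite (le_trans (ler_norm _))// /K (bigD1 i)//= lerDl sumr_ge0.
pose M := \sum_i `|e i|; have M0 : 0 <= M by exact: sumr_ge0.
have MM i : `|e i| <= M by rewrite /M (bigD1 i)//= lerDl sumr_ge0.
exists g, (K * (1 + M)); split => [|y c]; first by rewrite mulr_ge0// addr_ge0.
elim: (index_enum _) => [|i s ih].
  by rewrite !big_nil addr0 subrr subr0 normr0 expr0n mulr0.
rewrite !big_cons.
have [lg hG] := hK i.
set v := \sum_(j <- s) c j *: e j in ih *.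
set S := \sum_(j <- s) `|c j| in ih *.
have S0 : 0 <= S by exact: sumr_ge0.
have vS : `|v| <= M * S.
  rewrite (le_trans (ler_norm_sum _ _ _))// mulr_sumr ler_sum// => j _.
  by rewrite normrZ mulrC ler_wpM2r.
have E : G (y + (c i *: e i + v)) - G y - (c i * g i y + \sum_(j <- s) c j * g j y) =
   (G ((y + v) + c i *: e i) - G (y + v) - c i * g i (y + v)) + c i * (g i (y + v) - g i y) +
   (G (y + v) - G y - \sum_(j <- s) c j * g j y).
  by rewrite [c i *: e i + v]addrC addrA; ring.
rewrite E; apply: sum_square_bound ih => //.
  by rewrite (le_trans (hG _ _))// ler_wpM2r// sqr_ge0.
rewrite normrM ler_wpM2l// (le_trans (lg _ _))// addrAC subrr add0r.
by rewrite (le_trans (ler_wpM2r _ (KK i)))// ler_wpM2l.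
Qed.

Section coordinate_form.
Variable a : 'I_(\dim {:V}) -> R.

Definition coordinate_form (v : V) : R := \sum_i a i * co i v.

Lemma coordinate_form_linear : linear coordinate_form.
Proof.
move=> c u v; rewrite /coordinate_form scaler_sumr -big_split /=; apply: eq_bigr => i _.
by rewrite coD coZ mulrDr mulrCA.
Qed.

HB.instance Definition _ := GRing.isLinear.Build R V R *:%R coordinate_form coordinate_form_linear.

Lemma coordinate_form_continuous : continuous coordinate_form.
Proof. by apply: continuous_sum => i _; apply: mulc_continuous; exact: co_continuous. Qed.

Lemma quadratic_differentiable G (C : R) y :
  (forall v, `|G (y + v) - G y - coordinate_form v| <= C * `|v| ^+ 2) ->
  differentiable G y /\ 'd G y = coordinate_form :> (V -> R).
Proof.
move=> H.
have E : G \o shift y = cst (G y) + coordinate_form +o_ (0 : V) id.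
  apply/eqaddoP => e e0.
  have C0 : 0 < `|C| + 1 by rewrite ltr_wpDl.
  near=> v; rewrite /=.
  have -> : (G \o +%R^~ y - (cst (G y) + coordinate_form)) v = G (y + v) - G y - coordinate_form v.
    by rewrite -addrA -opprD [y + v]addrC.
  rewrite (le_trans (H v))// expr2 mulrA ler_wpM2r//.
  have h : `|v| <= e / (`|C| + 1) by near: v; apply: nbhs0_le; exact: divr_gt0.
  rewrite (le_trans (ler_wpM2r (normr_ge0 v) (ler_norm C)))//.
  rewrite (le_trans (ler_wpM2l (normr_ge0 C) h))// mulrCA ler_piMr ?(ltW e0)//.
  by rewrite ler_pdivrMr// mul1r lerDl.
have dE := diff_unique coordinate_form_continuous E.
split => //; apply/diff_locallyP; rewrite dE; split => //.
exact: coordinate_form_continuous.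
Unshelve. all: by end_near. Qed.

End coordinate_form.

Lemma regularize_differentiable F L (d : R) : lipschitz_with F L -> 0 < d ->
  let G := regularize d (enum 'I_(\dim {:V})) F in
  exists C : R, 0 <= C /\ forall y, differentiable G y /\
    forall v, `|G (y + v) - G y - 'd G y v| <= C * `|v| ^+ 2.
Proof.
move=> lF d0 G.
have sm i : smooth_along (d *: bv i) G by apply: regularize_smooth lF _; rewrite mem_enum.
have [g [C [C0 hC]]] := quadratic_expansion sm.
have [K K0 hK] := co_bound V.
pose D := \sum_(i < \dim {:V}) (K / d); have D0 : 0 <= D.
  by apply: sumr_ge0 => i _; rewrite divr_ge0 ?ltW.
have H y v : `|G (y + v) - G y - coordinate_form (fun i => g i y / d) v| <= C * D ^+ 2 * `|v| ^+ 2.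
  have := hC y (fun i => co i v / d).
  rewrite (_ : \sum_i (co i v / d) *: (d *: bv i) = v); last first.
    rewrite [RHS]coE; apply: eq_bigr => i _; by rewrite scalerA mulfVK ?gt_eqF.
  rewrite (_ : \sum_i co i v / d * g i y = coordinate_form (fun i => g i y / d) v); last first.
    by apply: eq_bigr => i _; rewrite mulrAC [RHS]mulrAC [co i v * _]mulrC.
  move=> /le_trans; apply; rewrite -mulrA -exprMn ler_wpM2l// lerXn2r ?nnegrE ?sumr_ge0 ?mulr_ge0//.
  rewrite mulr_suml ler_sum// => i _; rewrite normrM normfV (gtr0_norm d0) mulrAC.
  by rewrite ler_pM2r ?invr_gt0.
exists (C * D ^+ 2); split => [|y]; first by rewrite mulr_ge0// sqr_ge0.
have [dG dE] := quadratic_differentiable (H y).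
by split => // v; rewrite dE; exact: H.
Qed.

(** The segment is cut into [N + 1] equal steps. Each costs at most [h I] and a remainder quadratic
    in [h = t / (N + 1)]; the remainders add up to [c / (N + 1)]. *)
Lemma quadratic_growth G (C I t : R) (b v : V) : 0 <= t -> 0 <= C ->
  (forall y, differentiable G y /\ forall v, `|G (y + v) - G y - 'd G y v| <= C * `|v| ^+ 2) ->
  (forall y, 'd G y v <= I) -> G (b + t *: v) - G b <= t * I.
Proof.
move=> t0 C0 H hI; apply/ler_addgt0Pr => e e0.
pose c := C * `|v| ^+ 2 * t ^+ 2; have c0 : 0 <= c by rewrite !mulr_ge0// sqr_ge0.
have [N hN] : exists N : nat, c / e <= N.+1%:R.
  have : 0 <= c / e by rewrite divr_ge0// ltW.
  by move=> /truncn_itv/andP[_ h]; exists (Num.truncn (c / e)); exact: ltW.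
pose h := t / N.+1%:R; have h0 : 0 <= h by rewrite divr_ge0.
have step y : G (y + h *: v) <= G y + (h * I + C * `|v| ^+ 2 * h ^+ 2).
  have [dG /(_ (h *: v))] := H y; rewrite linearZ normrZ ger0_norm// exprMn => hq.
  have {}hq : G (y + h *: v) - G y - h * 'd G y v <= C * (h ^+ 2 * `|v| ^+ 2).
    exact: le_trans (ler_norm _) hq.
  by have := ler_wpM2l h0 (hI y); lra.
have walk m : G (b + (m%:R * h) *: v) <= G b + m%:R * (h * I + C * `|v| ^+ 2 * h ^+ 2).
  elim: m => [|m ih]; first by rewrite !mul0r scale0r !addr0.
  rewrite -natr1 mulrDl mul1r scalerDl addrA (le_trans (step _))//.
  by move: ih; lra.
have := walk N.+1; have N0 : N.+1%:R != 0 :> R by rewrite pnatr_eq0.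
have -> : N.+1%:R * h = t by rewrite /h mulrC mulfVK.
have -> : N.+1%:R * (h * I + C * `|v| ^+ 2 * h ^+ 2) = t * I + c / N.+1%:R.
  by rewrite /h /c; field.
have h1 : c / N.+1%:R <= e by rewrite ler_pdivrMr ?ltr0n// mulrC -ler_pdivrMr.
by move=> h2; rewrite lerBlDl (le_trans h2)// lerD2l lerD2l.
Qed.

(** The bound is assumed for all quasiconvex [G] with the recession function of [F], since it is
    applied not to [F] but to regularizations within [e / 2] of it, which are differentiable at
    every point. *)
Lemma lipschitz_growth n k (W : innerProductType R) (A : diff_op n k V W) F L (I t : R) (b v : V) :
  lipschitz_with F L -> H_space F -> quasiconvex A F -> 0 <= t ->
  (forall G, H_space G -> quasiconvex A G -> rec_fun G = rec_fun F ->
     forall y, differentiable G y -> 'd G y v <= I) ->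
  F (b + t *: v) <= F b + t * I.
Proof.
move=> lF HF qF t0 hI; apply/ler_addgt0Pr => e e0.
pose s := enum 'I_(\dim {:V}).
pose D := `|L| * \sum_(i <- s) `|bv i : V|; have D0 : 0 <= D by rewrite mulr_ge0// sumr_ge0.
pose d := e / (2 * (D + 1)); have d0 : 0 < d by rewrite divr_gt0// mulr_gt0// ltr_wpDl.
have close y : `|regularize d s F y - F y| <= e / 2.
  rewrite (le_trans (regularize_close d s y lF))//.
  rewrite (eq_bigr (fun i => d * `|bv i : V|)) => [|i _]; last by rewrite normrZ gtr0_norm.
  rewrite -mulr_sumr mulrCA.
  have h : L * \sum_(i <- s) `|bv i : V| <= D by rewrite ler_wpM2r ?ler_norm// sumr_ge0.
  rewrite (le_trans (ler_wpM2l (ltW d0) h))// /d mulrAC ler_pdivrMr ?mulr_gt0 ?ltr_wpDl//.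
  have : 0 <= e by exact: ltW.
  by lra.
have [C [C0 hG]] := regularize_differentiable lF d0.
set G := regularize d _ F in hG; have [cF _ _] := HF.
have lG : lipschitz_with G L by exact: regularize_lipschitz.
have qG : quasiconvex A G by exact: regularize_quasiconvex lF qF.
have [HG rG] : H_space G /\ rec_fun G = rec_fun F.
  apply: recession_H_space; first exact: lipschitz_with_continuous lG.
  have [ch hh Fh] := H_space_recession HF; split => // r r0.
  have [C1 hC1] := Fh r r0; exists (e / 2 + C1) => y.
  rewrite -(subrKA (F y)) (le_trans (ler_normD _ _))// addrCA lerD//; exact: close.
have := quadratic_growth b t0 C0 hG (fun y => hI G HG qG rG y (hG y).1).
have := close (b + t *: v); have := close b; rewrite -/G.
rewrite !ler_norml => /andP[? ?] /andP[? ?]; lra.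
Qed.

End regularization.

(** * Young measures *)

Section borel_integrals.
Context {R : realType}.
Variable V : innerProductType R.
Implicit Types (F G h : V -> R).

Lemma borel_measurable F : continuous F -> measurable_fun [set: borel V] (F : borel V -> R).
Proof.
move=> /continuousP cF; apply: (measurability _ (RGenOpens.measurableE R)).
move=> _ [_ [a [b ->] <-]]; rewrite setTI; apply: sub_sigma_algebra.
exact/cF/interval_open.
Qed.

Lemma sphere_measurable : measurable (unit_sphere V : set (borel V)).
Proof.
rewrite -[X in measurable X]setCK; apply: measurableC; apply: sub_sigma_algebra.
rewrite openC (_ : unit_sphere V = (@Num.norm _ V) @^-1` [set 1])//.
by apply: preimage_closed; [move=> y _; exact: norm_continuous|exact: closed_eq].
Qed.

Lemma Rintegral_mscale (k : {nonneg R}) (mu : {measure set (borel V) -> \bar R})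
    (D : set (borel V)) (f : borel V -> R) : measurable D -> mu.-integrable D (EFin \o f) ->
  \int[mscale k mu]_(y in D) f y = k%:num * \int[mu]_(y in D) f y.
Proof.
move=> mD fi; have mf := measurable_int _ fi.
rewrite /Rintegral integralE [in RHS]integralE.
rewrite !ge0_integral_mscale//; [|exact: measurable_funeneg|exact: measurable_funepos].
have p1 := integrable_pos_fin_num mD fi; have p2 := integrable_neg_fin_num mD fi.
rewrite -muleBr//; last by rewrite fin_num_adde_defr.
by rewrite fineM// fin_numB p1 p2.
Qed.

Lemma integrable_sphere (mu : {finite_measure set (borel V) -> \bar R}) h : continuous h ->
  mu.-integrable (unit_sphere V : set (borel V)) (EFin \o (h : borel V -> R)).
Proof.
move=> ch; apply: measurable_bounded_integrable; first exact: sphere_measurable.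
- by rewrite ltey_eq fin_num_measure//; exact: sphere_measurable.
- by apply: measurable_funTS; exact: borel_measurable.
have [M M0 hM] := continuous_ball_bounded 1 ch.
exists M; split; first exact: num_real.
by move=> x Mx y /= y1; rewrite (le_trans (hM _ _)) ?(ltW Mx)//= y1.
Qed.

Section moment.
Variable nu0 : probability (borel V) R.
Hypothesis nu0_moment : (\int[nu0]_y `|y : V|%:E < +oo)%E.

Lemma integrable_growth F (c : R) : continuous F -> (forall y, `|F y| <= c * (1 + `|y|)) ->
  nu0.-integrable [set: borel V] (EFin \o (F : borel V -> R)).
Proof.
move=> cF hF.
have mn : measurable_fun [set: borel V] (fun y : borel V => `|y : V|).
  by apply: borel_measurable; exact: norm_continuous.
have i1 : nu0.-integrable [set: borel V] (EFin \o (fun _ : borel V => 1 : R)).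
  by apply: finite_measure_integrable_cst.
have i2 : nu0.-integrable [set: borel V] (EFin \o (fun y : borel V => `|y : V|)).
  apply/integrableP; split; first exact/measurable_EFinP.
  by apply: le_lt_trans nu0_moment; rewrite le_eqVlt; apply/orP; left; apply/eqP;
     apply: eq_integral => y _; rewrite /= normr_id.
apply: (@le_integrable _ _ _ _ _ _ _ (EFin \o (fun y : borel V => c * (1 + `|y : V|)))).
- exact: measurableT.
- by apply/measurable_EFinP; exact: borel_measurable.
- move=> y _; rewrite /= lee_fin (le_trans (hF y))//; exact: ler_norm.
have := integrableZl measurableT c (integrableD measurableT i1 i2).
by apply: eq_integrable => // y _.
Qed.

Lemma integrable_H F : H_space F -> nu0.-integrable [set: borel V] (EFin \o (F : borel V -> R)).
Proof. by move=> [cF [c hc] _]; exact: integrable_growth hc. Qed.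

End moment.

Lemma Rintegral_lin_sum (mu : {measure set (borel V) -> \bar R}) (D : set (borel V)) (I : Type)
    (r : seq I) (c : I -> R) (f : I -> borel V -> R) : measurable D ->
  (forall i, mu.-integrable D (EFin \o f i)) ->
  mu.-integrable D (EFin \o (fun y => \sum_(i <- r) c i * f i y)) /\
  \int[mu]_(y in D) (\sum_(i <- r) c i * f i y) = \sum_(i <- r) c i * \int[mu]_(y in D) f i y.
Proof.
move=> mD fi; elim: r => [|i r [ir er]].
  rewrite (_ : (fun _ => _) = fun=> 0); last by apply/funext => y; rewrite big_nil.
  by rewrite big_nil Rintegral_cst// mul0r; split => //; exact: integrable0.
rewrite (_ : (fun _ => _) = fun y => c i * f i y + \sum_(i <- r) c i * f i y); last first.
  by apply/funext => y; rewrite big_cons.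
have ic : mu.-integrable D (EFin \o (fun y => c i * f i y)).
  by have := integrableZl mD (c i) (fi i); apply: eq_integrable => // y _.
split; first by have := integrableD mD ic ir; apply: eq_integrable => // y _.
by rewrite RintegralD// er RintegralZl// big_cons.
Qed.

Lemma linear_vector_integral (mu : {measure set (borel V) -> \bar R}) (D : set (borel V))
    (f : {linear V -> R}) : measurable D ->
  (forall i : 'I_(\dim {:V}), mu.-integrable D (EFin \o (fun y : borel V => co i (y : V)))) ->
  mu.-integrable D (EFin \o (f : borel V -> R)) /\
  \int[mu]_(y in D) f y = f (vector_integral mu D (fun y => y : V)).
Proof.
move=> mD ic; have [h1 h2] := Rintegral_lin_sum (index_enum _) (fun i => f (bv i)) mD ic.
have fE (y : V) : f y = \sum_i f (bv i) * co i y.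
  by rewrite [y in LHS]coE linear_sum; apply: eq_bigr => i _; rewrite linearZ mulrC.
split; first by apply: eq_integrable h1 => // y _ /=; rewrite -fE.
transitivity (\int[mu]_(y in D) (\sum_i f (bv i) * co i (y : V))).
  by apply: eq_Rintegral => y _; exact: fE.
rewrite h2 /vector_integral linear_sum; apply: eq_bigr => i _.
by rewrite linearZ mulrC.
Qed.

End borel_integrals.

(** * Affine changes of variable and linearization *)

Section affine_change.
Context {R : realType}.
Variable V : innerProductType R.
Implicit Types (F h : V -> R) (a y z : V).

(** For large [y], dividing by [|y|] makes the shift [a / |y|] small, and uniform continuity near
    the unit ball applies; the remaining [y] are bounded. *)
Lemma homogeneous_shift h a : continuous h -> (forall s y, 0 < s -> h (s *: y) = s * h y) ->
  forall e : R, 0 < e -> exists C : R, forall y, `|h (y + a) - h y| <= e * `|y| + C.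
Proof.
move=> ch hh e e0.
have [d d0 hd] := compact_uniformly_continuous (@ball_compact R V 1) ch e0.
have [M M0 hM] := continuous_ball_bounded (`|a| / d + `|a|) ch.
exists (M + M) => y; have [ya|ya] := leP `|y| (`|a| / d).
  rewrite (le_trans (ler_normB _ _))// ler_wpDl ?mulr_ge0 ?(ltW e0)// lerD// hM//.
    by rewrite (le_trans (ler_normD _ _))// lerD2r.
  by rewrite ler_wpDr.
have y0 : 0 < `|y| by rewrite (le_lt_trans _ ya)// divr_ge0 ?(ltW d0).
have hE x : h x = `|y| * h (`|y|^-1 *: x).
  by rewrite -hh// scalerA mulfV ?scale1r ?gt_eqF.
rewrite hE [h y]hE -mulrBr normrM normr_id mulrC ler_wpDr ?addr_ge0 ?(ltW M0)// ler_pM2r//.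
rewrite distrC; apply: hd => /=.
  by rewrite normrZ normfV normr_id mulVf ?gt_eqF.
rewrite scalerDr opprD addrA subrr add0r normrN normrZ normfV normr_id.
by rewrite ltr_pdivrMl// -ltr_pdivrMr.
Qed.

Lemma H_space_affine F (s : R) a : H_space F -> 0 < s ->
  H_space (fun y => F (s *: y + a)) /\ rec_fun (fun y => F (s *: y + a)) = (fun y => s * rec_fun F y).
Proof.
move=> HF s0; have [cF _ _] := HF; have [ch hh Fh] := H_space_recession HF.
set h := rec_fun F in ch hh Fh *.
have caff : continuous (fun y : V => s *: y + a) by exact: affine_continuous.
apply: recession_H_space; first exact: (comp_continuous caff cF).
split; first exact: mulc_continuous.
  by move=> r y r0; rewrite hh// mulrCA.
move=> e e0; pose d := e / (2 * s); have d0 : 0 < d by rewrite divr_gt0// mulr_gt0.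
have [C1 hC1] := Fh d d0; have [C2 hC2] := homogeneous_shift a ch hh d0.
exists (d * `|a| + C1 + C2) => y.
have h1 : `|F (s *: y + a) - h (s *: y + a)| <= d * (s * `|y| + `|a|) + C1.
  rewrite (le_trans (hC1 _))// lerD2r ler_pM2l// (le_trans (ler_normD _ _))// lerD2r.
  by rewrite normrZ gtr0_norm.
have h2 : `|h (s *: y + a) - s * h y| <= d * (s * `|y|) + C2.
  by rewrite -hh// (le_trans (hC2 _))// normrZ gtr0_norm.
rewrite -(subrKA (h (s *: y + a))) (le_trans (ler_normD _ _))// (le_trans (lerD h1 h2))//.
have : d * (s * `|y|) = e / 2 * `|y| by rewrite /d; field; rewrite gt_eqF.
by move=> E; move: E; lra.
Qed.

Lemma quasiconvex_affine n k (W : innerProductType R) (A : diff_op n k V W) F (s : R) a :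
  quasiconvex A F -> quasiconvex A (fun y => F (s *: y + a)).
Proof.
move=> [cF qF]; split.
  have caff : continuous (fun y : V => s *: y + a) by exact: affine_continuous.
  exact: (comp_continuous caff cF).
move=> z w sw pw w0 Aw.
have h := qF (s *: z + a) (fun x => s *: w x) (smoothZ s sw).
rewrite (@cube_integral_ext _ _ _ (fun x => F ((s *: z + a) + s *: w x))); last first.
  by move=> x; rewrite scalerDr addrAC.
apply: h.
- by move=> i x; rewrite pw.
- have := vintZ s (smooth_continuous sw); rewrite [vint w]w0 scaler0; exact.
- by move=> x; rewrite (op_applyZ A s x sw) Aw scaler0.
Qed.

Lemma differentiable_eps F a : differentiable F a -> forall e : R, 0 < e ->
  exists2 r : R, 0 < r & forall v : V, `|v| < r -> `|F (a + v) - F a - 'd F a v| <= e * `|v|.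
Proof.
move=> /diff_locally dF e e0.
have /eqaddoP/(_ _ e0)/nbhs_ballP[r /= r0 hr] := dF.
exists r => // v vr; have := hr v; rewrite -ball_normE /= sub0r normrN => /(_ vr).
have -> : (F \o +%R^~ a - (cst (F a) + 'd F a)) v = F (a + v) - F a - 'd F a v.
  by rewrite -addrA -opprD [a + v]addrC.
exact.
Qed.

(** Near [a] the differential controls the increment, far from [a] the linear growth does. The bound
    dominates the difference quotients of [F] at [a] by a multiple of [|y|], which is integrable. *)
Lemma differentiable_growth F a (c : R) : (forall y, `|F y| <= c * (1 + `|y|)) ->
  differentiable F a -> exists C : R, forall v, `|F (a + v) - F a| <= C * `|v|.
Proof.
move=> hF dF; have [r r0 hr] := differentiable_eps dF ltr01.
have [K /ltW K0 hK] := linear_lipschitz (diff_continuous dF).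
pose c' := `|c| * (2 * (1 + `|a|)) / r + `|c|.
have c0 : 0 <= c' by rewrite addr_ge0// divr_ge0 ?(ltW r0)// !mulr_ge0// addr_ge0.
exists (1 + K + c') => v; have [vr|rv] := ltP `|v| r.
  rewrite -[F _ - _](subrK ('d F a v)) (le_trans (ler_normD _ _))//.
  rewrite [leRHS]mulrDl ler_wpDr ?mulr_ge0// mulrDl lerD// ?hK//.
  exact: hr.
have hF' y : `|F y| <= `|c| * (1 + `|y|).
  by rewrite (le_trans (hF y))// ler_wpM2r ?addr_ge0// ler_norm.
rewrite [leRHS]mulrDl ler_wpDl ?mulr_ge0 ?addr_ge0//.
rewrite (le_trans (ler_normB _ _))// (le_trans (lerD (hF' _) (hF' _)))//.
have h1 : `|c| * (2 * (1 + `|a|)) <= `|c| * (2 * (1 + `|a|)) / r * `|v|.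
  by rewrite mulrAC ler_pdivlMr// ler_wpM2l// !mulr_ge0// addr_ge0.
have h2 : `|c| * `|a + v| <= `|c| * (`|a| + `|v|) by rewrite ler_wpM2l// ler_normD.
by rewrite /c' mulrDl; lra.
Qed.

Section moment.
Variable nu0 : probability (borel V) R.
Hypothesis nu0_moment : (\int[nu0]_y `|y : V|%:E < +oo)%E.

(* Subtract [F a], divide by [s] and let [s] tend to 0. *)
Lemma derivative_jensen F a z (J : R) : H_space F -> differentiable F a ->
  (forall s : R, 0 < s -> F (s *: z + a) <= \int[nu0]_y F (s *: (y : V) + a) + s * J) ->
  'd F a z <= 'd F a (vector_integral nu0 setT (fun y => y : V)) + J.
Proof.
move=> HF dF H; have [cF [c hc] _] := HF.
have [C hC] := differentiable_growth hc dF.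
pose s_ (m : nat) : R := m.+1%:R^-1; have s0 m : 0 < s_ m by rewrite invr_gt0.
have s_cvg : s_ @ \oo --> (0 : R) by apply: cvg_trans (@cvg_harmonic R); exact: cvg_id.
pose q m (y : V) := (F (s_ m *: y + a) - F a) / s_ m.
have q_le m y : `|q m y| <= C * `|y|.
  rewrite /q normrM normfV (gtr0_norm (s0 m)) ler_pdivrMr// [s_ m *: y + a]addrC (le_trans (hC _))//.
  by rewrite normrZ (gtr0_norm (s0 m)) mulrCA mulrC.
have q_cvg y : q ^~ y @ \oo --> 'd F a y.
  apply/cvgrPdist_le => e e0.
  have y1 : 0 < `|y| + 1 by rewrite ltr_wpDl.
  have [r r0 hr] := differentiable_eps dF (divr_gt0 e0 y1).
  have /cvgrPdist_lt/(_ _ (divr_gt0 r0 y1)) := s_cvg.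
  apply: filterS => m; rewrite sub0r normrN (gtr0_norm (s0 m)) => sm.
  have sy : `|s_ m *: y| < r.
    rewrite normrZ (gtr0_norm (s0 m)); move: sm; rewrite ltr_pdivlMr// => /le_lt_trans; apply.
    by rewrite ler_pM2l// lerDl.
  have -> : 'd F a y - q m y = - (F (a + s_ m *: y) - F a - 'd F a (s_ m *: y)) / s_ m.
    have -> : 'd F a (s_ m *: y) = s_ m * 'd F a y by rewrite linearZ.
    by rewrite /q [_ *: y + a]addrC; field; rewrite gt_eqF.
  rewrite normrM normrN normfV (gtr0_norm (s0 m)) ler_pdivrMr// (le_trans (hr _ sy))//.
  rewrite normrZ (gtr0_norm (s0 m)) mulrCA mulrC ler_pM2r// mulrAC ler_pdivrMr//.
  by rewrite ler_pM2l// lerDl.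
have cq m : continuous (q m).
  rewrite (_ : q m = fun y => (s_ m)^-1 * (F (s_ m *: y + a) + - F a)); last first.
    by apply/funext => y; rewrite /q mulrC.
  have caff : continuous (fun y : V => s_ m *: y + a) by exact: affine_continuous.
  apply: mulc_continuous; apply: addf_continuous; first exact: (comp_continuous caff cF).
  exact: cst_continuous.
have ico i : nu0.-integrable [set: borel V] (EFin \o (fun y : borel V => co i (y : V))).
  have [K K0 hK] := co_bound V.
  apply: (integrable_growth nu0_moment (c := K)); first exact: co_continuous.
  by move=> y; rewrite (le_trans (hK _ _))// ler_pM2l// lerDr.
have [id' <-] := linear_vector_integral ('d F a) measurableT ico.
have q_int : (fun m => \int[nu0]_y q m y) @ \oo --> \int[nu0]_y 'd F a y.
  apply: fine_cvg; rewrite fineK; last exact: integrable_fin_num.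
  have [|||||_ _] := @dominated_convergence _ _ R nu0 [set: borel V] measurableT
    (fun m => EFin \o (q m : borel V -> R)) (EFin \o ('d F a : borel V -> R)) (fun y => (C * `|y : V|)%:E).
  - by move=> m; apply/measurable_EFinP; exact: borel_measurable.
  - exact: measurable_int id'.
  - by apply: aeW => y _; apply: cvg_EFin; [exact: nearW|exact: q_cvg].
  - have cn : continuous (fun y : V => C * `|y|) by apply: mulc_continuous; exact: norm_continuous.
    apply: (integrable_growth nu0_moment (c := `|C|) cn) => y.
    by rewrite normrM normr_id ler_wpM2l// lerDr.
  - by apply: aeW => y m _; rewrite /= lee_fin.
  - by [].
apply: (@ler_cvg_to _ _ _ _ (q ^~ z) (fun m => \int[nu0]_y q m y + J) _ _ (q_cvg z)).
  by apply: cvgD => //; exact: cvg_cst.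
apply: nearW => m.
have iF : nu0.-integrable [set: borel V] (EFin \o (fun y : borel V => F (s_ m *: (y : V) + a))).
  exact: (integrable_H nu0_moment (H_space_affine a HF (s0 m)).1).
have -> : \int[nu0]_y q m y = (\int[nu0]_y F (s_ m *: (y : V) + a) - F a) / s_ m.
  have ic : nu0.-integrable [set: borel V] (EFin \o (fun _ : borel V => - F a)).
    exact: finite_measure_integrable_cst.
  transitivity (\int[nu0]_y ((s_ m)^-1 * (F (s_ m *: (y : V) + a) + - F a))).
    by apply: eq_Rintegral => y _; rewrite mulrC.
  rewrite RintegralZl//; last by have := integrableD measurableT iF ic; apply: eq_integrable => // y _.
  rewrite RintegralD// Rintegral_cst// [in RHS]mulrC; congr (_ * (_ + _)).
  by rewrite [X in fine X]probability_setT mulr1.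
rewrite /q ler_pdivrMr// mulrDl mulfVK ?gt_eqF// [J * _]mulrC.
by have := H _ (s0 m); lra.
Qed.

End moment.

End affine_change.

Section young_functional.
Context {R : realType}.
Variable V : innerProductType R.
Variables (nu0 nuoo : probability (borel V) R) (k : {nonneg R}).
Hypothesis nu0_moment : (\int[nu0]_y `|y : V|%:E < +oo)%E.
Implicit Types F G : V -> R.

Definition young_functional F : R :=
  \int[nu0]_y F y + k%:num * \int[nuoo]_(y in unit_sphere V) rec_fun F y.

Let i0 F : H_space F -> nu0.-integrable [set: borel V] (EFin \o (F : borel V -> R)).
Proof. exact: integrable_H. Qed.

Let ioo F : H_space F ->
  nuoo.-integrable (unit_sphere V : set (borel V)) (EFin \o (rec_fun F : borel V -> R)).
Proof. by move=> /H_space_recession[ch _ _]; exact: integrable_sphere. Qed.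

Lemma young_functional_mscale F : H_space F ->
  \int[nu0]_y F y + \int[mscale k nuoo]_(y in unit_sphere V) rec_fun F y = young_functional F.
Proof.
by move=> HF; rewrite Rintegral_mscale//; [exact: sphere_measurable|exact: ioo].
Qed.

Lemma young_functionalD F G : H_space F -> H_space G ->
  young_functional (fun y => F y + G y) = young_functional F + young_functional G.
Proof.
move=> HF HG; have [_ rE] := H_spaceD HF HG; rewrite /young_functional rE.
rewrite RintegralD//; [|exact: i0|exact: i0].
rewrite RintegralD//; [|exact: sphere_measurable|exact: ioo|exact: ioo].
by rewrite mulrDr addrACA.
Qed.

Lemma young_functionalZ F c : H_space F ->
  young_functional (fun y => c * F y) = c * young_functional F.
Proof.
move=> HF; have [_ rE] := H_spaceZ c HF; rewrite /young_functional rE.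
rewrite RintegralZl//; last exact: i0.
rewrite RintegralZl//; [|exact: sphere_measurable|exact: ioo].
by rewrite mulrDr mulrCA.
Qed.

Lemma young_functional_le F G : H_space F -> H_space G -> (forall y, F y <= G y) ->
  young_functional F <= young_functional G.
Proof.
move=> HF HG FG; apply: lerD.
  by apply: le_Rintegral => //; exact: i0.
apply: ler_wpM2l => //; apply: le_Rintegral; [exact: sphere_measurable|exact: ioo|exact: ioo|].
by move=> y _; exact: H_space_le.
Qed.

Lemma young_functional1 : young_functional (fun=> 1) = 1.
Proof.
have c1 : continuous (fun _ : V => 1 : R) by exact: cst_continuous.
have [|_ rE] := @recession_H_space R V (fun=> 1) (fun=> 0) c1.
  split; [exact: cst_continuous|by move=> s y _; rewrite mulr0|].
  by move=> e e0; exists 1 => y; rewrite subr0 normr1 lerDr mulr_ge0// ltW.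
rewrite /young_functional rE Rintegral_cst// [X in fine X]probability_setT mul1r.
by rewrite Rintegral_cst ?mul0r ?mulr0 ?addr0//; exact: sphere_measurable.
Qed.

End young_functional.

Lemma tame_envelope (R : realType) n (U V : innerProductType R) l (B : diff_op n l U V)
    (F : V -> R) z : tame F -> has_lbound (field_values B F z) -> tame (envelope B F).
Proof.
move=> [h [L [C [lF lh hh Fh]]]] lb.
have cF := lipschitz_with_continuous lF; have ch := lipschitz_with_continuous lh.
have lbh := field_values_lbound_perturb cF ch Fh lb.
exists (envelope B h), L, C; split.
- exact: (envelope_lipschitz lF lb).
- exact: (envelope_lipschitz lh lbh).
- by move=> s y s0; exact: (envelope_homogeneous y lh lbh hh s0).
- by move=> y; exact: (envelope_perturb y lF lh lb lbh Fh).
Qed.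

Theorem proposition4p2 (R : realType) (U V W : innerProductType R)
    (n k l : nat) (A : diff_op n k V W) (B : diff_op n l U V)
    (l_ge1 : (1 <= l)%N)
    (rankA : constant_rank A)
    (spanA : linear_span (wave_cone A) = setT)
    (exactAB : forall xi : 'rV[R]_n, xi != 0 ->
       lker (symbol A xi) = limg (symbol B xi))
    (nu0 nuoo : probability (borel V) R)
    (nu0_moment : (\int[nu0]_y `|y : V|%:E < +oo)%E)
    (nuoo_sphere : nuoo (~` unit_sphere V) = 0%E)
    (t : R) (t_gt0 : 0 < t)
    (jensen0 : forall F : V -> R, H_space F -> quasiconvex A F ->
       F (vector_integral nu0 setT (fun y => y : V)) <= \int[nu0]_y F y) :
  let bar0 : V := vector_integral nu0 setT (fun y => y : V) in
  let baroo : V := vector_integral nuoo (unit_sphere V) (fun y => y : V) in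
  young_pair B (bar0 + t *: baroo) nu0 (mscale (NngNum (ltW t_gt0)) nuoo) <->
  (forall F : V -> R, H_space F -> quasiconvex A F ->
     (dir_sup F baroo <= (\int[nuoo]_(y in unit_sphere V) rec_fun F y)%:E)%E).

Proof.
set bar0 := vector_integral nu0 _ _; set baroo := vector_integral nuoo _ _.
move=> /=; set z := bar0 + t *: baroo; set k' := NngNum (ltW t_gt0).
pose Lf := young_functional nu0 nuoo k'.
split=> [[_ _ [u [tu _ cvu]]] F HF qF|H].
  set I := \int[nuoo]_(y in _) _.
  have jensen G : H_space G -> quasiconvex A G -> G z <= Lf G.
    move=> HG qG; have := cvu G HG; rewrite young_functional_mscale// => cG.
    apply: (cvgr_to_ge cG); apply: nearW => j.
    exact: (quasiconvex_test l_ge1 exactAB z qG (tu j)).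
  apply: ge_ereal_sup => _ [a dF <-]; rewrite lee_fin.
  (* The affine substitute [y |-> F (s y + a)] is again quasiconvex, with recession function
     [s F^oo]; this produces the term linear in [s] that [derivative_jensen] expects. *)
  have h : 'd F a z <= 'd F a bar0 + t * I.
    apply: derivative_jensen => // s s0.
    have [Hs rs] := H_space_affine a HF s0.
    have := jensen _ Hs (quasiconvex_affine s a qF); rewrite /Lf /young_functional rs.
    rewrite RintegralZl//; [|exact: sphere_measurable|].
      by rewrite /= mulrCA.
    by have [ch _ _] := H_space_recession HF; exact: integrable_sphere.
  (* As [z = bar0 + t baroo], the term ['d F a bar0] occurs on both sides of [h]. *)
  have : t * 'd F a baroo <= t * I.
    by move: h; rewrite /z linearD linearZ lerD2l.
  by rewrite ler_pM2l.
(* For the envelope [E] of [F]: growth along [baroo] gives [E z <= E bar0 + t I], [jensen0] applied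
   to [E] turns this into [E z <= Lf E], and [E <= F] concludes. *)
have env (F : V -> R) : tame F -> has_lbound (field_values B F z) -> envelope B F z <= Lf F.
  move=> tF lb; have [h [L [C [lF _ _ _]]]] := tF.
  have HF := tame_H_space tF; have HE := tame_H_space (tame_envelope tF lb).
  have lE := envelope_lipschitz lF lb.
  have qE := envelope_quasiconvex exactAB lF lb.
  pose I := \int[nuoo]_(y in unit_sphere V) rec_fun (envelope B F) y.
  have growth : envelope B F z <= envelope B F bar0 + t * I.
    (* The condition on [dir_sup] is used for each [G] with the recession function of the envelope,
       hence always with the same right-hand side [I]. *)
    apply: (lipschitz_growth bar0 lE HE qE (ltW t_gt0)) => G HG qG rG y dG.
    have := H G HG qG; rewrite rG -/I => /(le_trans _); rewrite -lee_fin; apply.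
    by apply: ereal_sup_ubound; exists y.
  apply: le_trans growth _.
  apply: (@le_trans _ _ (Lf (envelope B F))); first by rewrite lerD2r; exact: jensen0.
  apply: young_functional_le => // y; exact: (envelope_le_self lF lb).
split => //.
  by rewrite /= /mscale/= nuoo_sphere mule0.
have [|||||u [tu su cu]] := young_sequence l_ge1 (z := z) (Lf := Lf) (B := B).
- exact: young_functionalD.
- by move=> F c; exact: young_functionalZ.
- exact: young_functional_le.
- exact: young_functional1.
- exact: env.
exists u; split => // Phi HPhi; rewrite young_functional_mscale//.
exact: cu.
Qed.
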